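(* Let $X$ be a connected compact polyhedron and let $f:X\to X$ be a continuous map such that all the numbers $R(f^n)$, $n\in\mathbb N$, are finite. Let $f_*:\pi_1(X)\to\pi_1(X)$ be an endomorphism of $\pi_1(X)$ induced by $f$, and let $H$ be a subgroup of $\pi_1(X)$ such that (1) $f_*(H)\subset H$; (2) for every $x\in\pi_1(X)$ there exists $n\in\mathbb N$ such that $f_*^n(x)\in H$. Suppose that $H$ is a finitely generated discrete group of type I (so that for every $n\in\mathbb N$ the restriction of $f_*^n$ to $H$ is an endomorphism of a finitely generated discrete group of type I). Then for all $n\in\mathbb N$ $$\sum_{d\mid n}\mu(d)\cdot R(f^{n/d})\equiv 0 \pmod n .$$
   Context: Let $p:\widetilde X\to X$ be the universal cover of $X$, with deck transformation group $\Gamma\cong\pi_1(X)$. A lifting of $f$ is a map $\widetilde f:\widetilde X\to\widetilde X$ with $p\circ\widetilde f=f\circ p$. Two liftings $\widetilde f,\widetilde f'$ are conjugate if $\widetilde f'=\gamma\circ\widetilde f\circ\gamma^{-1}$ for some $\gamma\in\Gamma$; the conjugacy classes are called lifting classes. The Reidemeister number $R(f)$ (a positive integer or $\infty$) is the number of lifting classes of $f$; $R(f^n)$ is the Reidemeister number of the $n$-th iterate of $f$. The endomorphism of $\pi_1(X)$ induced by $f$: fix a lifting $\widetilde f$ of $f$; identifying $\pi_1(X)$ with $\Gamma$, the endomorphism $f_*$ (also denoted $\widetilde f_*$) is defined by $\widetilde f_*(\gamma)\circ\widetilde f=\widetilde f\circ\gamma$ for all $\gamma\in\Gamma$. Equivalently,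 with base point $x_0$, it is the composition of the usual map $\pi_1(X,x_0)\to\pi_1(X,f(x_0))$ with the isomorphism $\pi_1(X,f(x_0))\to\pi_1(X,x_0)$ given by the path $w$ from $x_0$ to $f(x_0)$ corresponding to $\widetilde f$. $\mu(d)$, $d\in\mathbb N=\{1,2,\dots\}$, is the Möbius function: $\mu(1)=1$, $\mu(d)=(-1)^k$ if $d$ is a product of $k$ distinct primes, and $\mu(d)=0$ if $d$ is not square-free. A group is of type I if all its unitary representations generate von Neumann algebras of type I; a discrete group is of type I if and only if it has a normal abelian subgroup of finite index. *)

(* Defs.v *)
From HB Require Import structures.
From mathcomp Require Import all_boot all_order all_algebra.
From mathcomp Require Import all_classical all_reals all_analysis.
From mathcomp Require Import complex finmap.

Set Implicit Arguments.
Unset Strict Implicit.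
Unset Printing Implicit Defensive.

Import Order.TTheory GRing.Theory Num.Theory.
Import numFieldNormedType.Exports.

Local Open Scope classical_set_scope.
Local Open Scope ring_scope.

Definition homeomorphism (S T : topologicalType) (h : S -> T) : Prop :=
  continuous h /\
  exists k : T -> S, [/\ continuous k, cancel h k & cancel k h].

Definition simplicial_complex (n : nat) (K : {set {set 'I_n}}) : Prop :=
  forall s : {set 'I_n}, s \in K ->
    s != finset.set0 /\
    forall t : {set 'I_n}, t \subset s -> t != finset.set0 -> t \in K.

(* Barycentric coordinates: the vertex i is the i-th unit vector of R^n, and
   the simplex s is the convex hull of its vertices. *)
Definition realization (R : realType) (n : nat) (K : {set {set 'I_n}}) :
    set 'rV[R]_n :=
  [set x | [/\ forall i, 0 <= x 0 i, \sum_i x 0 i = 1 &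
               finset (fun i => x 0 i != 0) \in K]].

Definition compact_polyhedron (R : realType) (X : topologicalType) : Prop :=
  exists (n : nat) (K : {set {set 'I_n}}), simplicial_complex K /\
    exists h : X -> set_type (@realization R n K), homeomorphism h.

Definition is_path (R : realType) (T : topologicalType) (x y : T)
    (g : R -> T) : Prop :=
  [/\ {within `[0, 1], continuous g}, g 0 = x & g 1 = y].

Definition null_homotopic (R : realType) (T : topologicalType) (x : T)
    (g : R -> T) : Prop :=
  exists F : R * R -> T,
    [/\ {within `[0, 1] `*` `[0, 1], continuous F},
        forall t, 0 <= t <= 1 -> F (0, t) = g t,
        forall t, 0 <= t <= 1 -> F (1, t) = x &
        forall s, 0 <= s <= 1 -> F (s, 0) = x /\ F (s, 1) = x].

Definition simply_connected (R : realType) (T : topologicalType) : Prop :=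
  [/\ [set: T] !=set0,
      forall x y : T, exists g : R -> T, is_path x y g &
      forall (x : T) (g : R -> T), is_path x x g -> null_homotopic x g].

Definition evenly_covered (Y X : topologicalType) (p : Y -> X) (U : set X) :
    Prop :=
  exists F : set (set Y),
    [/\ p @^-1` U = \bigcup_(S in F) S,
        trivIset F id &
        forall S, F S ->
          [/\ open S, set_inj S p, p @` S = U &
              forall W, open W -> W `<=` S -> open (p @` W)]].

Definition covering_map (Y X : topologicalType) (p : Y -> X) : Prop :=
  [/\ continuous p, range p = [set: X] &
      forall x : X, exists U, [/\ open U, U x & evenly_covered p U]].

Definition universal_cover (R : realType) (Y X : topologicalType)
    (p : Y -> X) : Prop :=
  covering_map p /\ simply_connected R Y.

Record deck (Y X : topologicalType) (p : Y -> X) := Deck {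
  deck_fun :> Y -> Y;
  deck_homeo : homeomorphism deck_fun;
  deck_over : p \o deck_fun = p
}.

Section DeckGroup.
Context (Y X : topologicalType) (p : Y -> X).
Implicit Types a b c : deck p.

HB.instance Definition _ := gen_eqMixin (deck p).
HB.instance Definition _ := gen_choiceMixin (deck p).

Lemma deckP a b : (forall y, a y = b y) -> a = b.
Proof.
case: a b => [f hf pf] [g hg pg] /= /funext fg; subst g.
by rewrite (Prop_irrelevance hf hg) (Prop_irrelevance pf pg).
Qed.

Lemma deck1_homeo : homeomorphism (@id Y).
Proof. by split; [move=> ? | exists id; split=> // ?]. Qed.

Definition deck1 : deck p := Deck deck1_homeo (erefl p).

Lemma deckM_homeo a b : homeomorphism (a \o b).
Proof.
case: a b => [f [cf [f' [cf' ff' f'f]]] _] [g [cg [g' [cg' gg' g'g]]] _] /=.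
split; first by move=> x; apply: continuous_comp; [exact: cg|exact: cf].
exists (g' \o f'); split.
- by move=> x; apply: continuous_comp; [exact: cf'|exact: cg'].
- by move=> x /=; rewrite ff' gg'.
- by move=> x /=; rewrite g'g f'f.
Qed.

Lemma deckM_over a b : p \o (a \o b) = p.
Proof. by rewrite compA !deck_over. Qed.

Definition deckM a b : deck p := Deck (deckM_homeo a b) (deckM_over a b).

Definition deckV_fun a : Y -> Y := projT1 (cid (deck_homeo a).2).

Lemma deckV_funP a :
  [/\ continuous (deckV_fun a), cancel a (deckV_fun a) &
      cancel (deckV_fun a) a].
Proof. exact: projT2 (cid (deck_homeo a).2). Qed.

Lemma deckV_homeo a : homeomorphism (deckV_fun a).
Proof.
case: (deckV_funP a) => cV aV Va; split=> //; exists a; split=> //.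
exact: (deck_homeo a).1.
Qed.

Lemma deckV_over a : p \o deckV_fun a = p.
Proof.
case: (deckV_funP a) => _ _ Va; apply/funext => y /=.
by rewrite -{1}(deck_over a) /= Va.
Qed.

Definition deckV a : deck p := Deck (deckV_homeo a) (deckV_over a).

Lemma deckMA : associative deckM.
Proof. by move=> a b c; apply: deckP. Qed.

Lemma deck1M : left_id deck1 deckM.
Proof. by move=> a; apply: deckP. Qed.

Lemma deckM1 : right_id deck1 deckM.
Proof. by move=> a; apply: deckP. Qed.

Lemma deckVM : left_inverse deck1 deckV deckM.
Proof. by move=> a; apply: deckP => y /=; case: (deckV_funP a) => _ ->. Qed.

Lemma deckMV : right_inverse deck1 deckV deckM.
Proof. by move=> a; apply: deckP => y /=; case: (deckV_funP a) => _ _ ->. Qed.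

HB.instance Definition _ :=
  isGroup.Build (deck p) deckMA deck1M deckM1 deckVM deckMV.

End DeckGroup.

Section Reidemeister.
Context (Y X : topologicalType) (p : Y -> X).

Definition lifting (f : X -> X) (g : Y -> Y) : Prop :=
  continuous g /\ p \o g = f \o p.

Definition lifting_class (g : Y -> Y) : set (Y -> Y) :=
  [set c \o g \o (c^-1)%g | c in [set: deck p]].

Definition lifting_classes (f : X -> X) : set (set (Y -> Y)) :=
  [set lifting_class g | g in lifting f].

(* fset_set is empty on infinite sets: an infinite Reidemeister number must be
   excluded by a hypothesis finite_set (lifting_classes f). *)
Definition reidemeister_number (f : X -> X) : nat :=
  #|` fset_set (lifting_classes f)|%fset.

Definition induced_endomorphism (g : Y -> Y) (phi : deck p -> deck p) : Prop :=
  forall c : deck p, phi c \o g = g \o c.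

End Reidemeister.

Section TypeI_algebra.
Context (R : realType) (V : lmodType R[i]) (dot : {dot V for Num.conj}).
Implicit Types (A B E Z : V -> V) (S M : set (V -> V)).

(* dot (x - y) (x - y) is the squared distance; the order of R[i] is partial and
   0 < e forces e to be real. *)
Definition hilbert_complete : Prop :=
  forall u : nat -> V,
    (forall e : R[i], 0 < e -> exists N, forall m n, (N <= m)%N -> (N <= n)%N ->
       dot (u m - u n) (u m - u n) < e) ->
    exists l : V, forall e : R[i], 0 < e -> exists N, forall n, (N <= n)%N ->
       dot (u n - l) (u n - l) < e.

Definition bounded_operator A : Prop :=
  linear A /\ exists C : R[i], forall u, dot (A u) (A u) <= C * dot u u.

Definition unitary_operator A : Prop :=
  [/\ linear A, range A = [set: V] & forall u v, dot (A u) (A v) = dot u v].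

Definition commutant S : set (V -> V) :=
  [set A | bounded_operator A /\ forall B, S B -> A \o B = B \o A].

Definition projection E : Prop :=
  [/\ bounded_operator E, E \o E = E & forall u v, dot (E u) v = dot u (E v)].

Definition abelian_projection M E : Prop :=
  [/\ M E, projection E &
      forall A B, M A -> M B ->
        (E \o A \o E) \o (E \o B \o E) = (E \o B \o E) \o (E \o A \o E)].

Definition central_projection M Z : Prop :=
  [/\ M Z, commutant M Z & projection Z].

(* Type I von Neumann algebra: every nonzero central projection majorizes a
   nonzero abelian projection (E <= Z being expressed by Z E = E). *)
Definition type_I_algebra M : Prop :=
  forall Z, central_projection M Z -> Z <> (fun=> 0) ->
    exists E, [/\ abelian_projection M E, E <> (fun=> 0) & Z \o E = E].

End TypeI_algebra.

Section Groups.
Context (G : groupType).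

Definition subgroup (H : set G) : Prop :=
  [/\ H 1%g, forall x y, H x -> H y -> H (x * y)%g &
      forall x, H x -> H (x^-1)%g].

Definition finitely_generated (H : set G) : Prop :=
  exists s : seq G, (forall x, x \in s -> H x) /\
    forall K : set G, subgroup K -> (forall x, x \in s -> K x) -> H `<=` K.

(* H carries no topology, so no continuity is required; only the values of pi
   on H matter. *)
Definition unitary_representation (R : realType) (V : lmodType R[i])
    (dot : {dot V for Num.conj}) (H : set G) (pi : G -> V -> V) : Prop :=
  (forall x, H x -> unitary_operator dot (pi x)) /\
  (forall x y, H x -> H y -> pi (x * y)%g = pi x \o pi y).

(* Since pi @` H is closed under adjoints, the von Neumann algebra that it
   generates is its bicommutant. *)
Definition type_I (R : realType) (H : set G) : Prop :=
  forall (V : lmodType R[i]) (dot : {dot V for Num.conj}) (pi : G -> V -> V),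
    hilbert_complete dot -> unitary_representation dot H pi ->
    type_I_algebra dot (commutant dot (commutant dot (pi @` H))).

End Groups.

Definition moebius (d : nat) : int :=
  if all (fun q => logn q d == 1%N) (primes d)
  then (-1) ^+ size (primes d) else 0.

(* Main.v *)
Require Import Defs.
From HB Require Import structures.
From mathcomp Require Import all_boot all_order all_algebra.
From mathcomp Require Import fingroup action.
From mathcomp Require Import all_classical all_reals all_analysis.
From mathcomp Require Import complex finmap ring lra zify.

Set Implicit Arguments.
Unset Strict Implicit.
Unset Printing Implicit Defensive.

Import Order.TTheory GRing.Theory Num.Theory.
Import numFieldNormedType.Exports.

Local Open Scope classical_set_scope.
Local Open Scope ring_scope.

(** The idea is to find a finite set and a self-map of it such that, for every d
    up to a given bound, the d-th iterate has exactly R(f^d) fixed points.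
    Points of exact period n fall into cycles of length n, so the numbers of
    fixed points of the iterates of any self-map of a finite set satisfy the
    congruences, by Moebius inversion (gauss_congruence).

    Topology. The universal cover of a polyhedron is locally path-connected, so
    that path lifting makes the deck group transitive on the fibres
    (deck_transitive). Every lifting of f^d is therefore c o ft^d for exactly
    one deck transformation c, and conjugating by gamma turns c into gamma c
    phi^d(gamma)^-1: the lifting classes of f^d are the phi^d-twisted conjugacy
    classes (reidemeister_transversal). An element x is always twisted conjugate
    to phi(x), hence to an element of H, and the twisted classes of the deck
    group and of H correspond (twisted_transversal_restrict).

    H is virtually abelian. Type I yields a nonzero abelian projection E in the
    von Neumann algebra of the regular representation on l2(H). If the FC-centre
    of H had infinite index, there would be group elements g, h escaping to
    infinity in a controlled way, and E L_g E L_h E = E L_h E L_g E would give,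
    in the limit, E delta_1 = 0 and so E = 0 (abelian_projection_delta). Hence
    the FC-centre has finite index (type_I_fc_center); by Schreier it is
    finitely generated, and its centre, the intersection of finitely many
    centralizers of finite index, is abelian of finite index
    (virtually_abelian_of_fc).

    Reduction to a finite group. Let B be the subgroup generated by the k-th
    powers, which for a suitable k is abelian; it is normal and invariant.
    Finiteness of the number of phi^d-twisted classes bounds the exponents of
    the quotients of B by the images of the maps c -> c g phi^d(c)^-1 g^-1. So
    for a suitable multiple l of k the subgroup N generated by the l-th powers
    is contained in all these images: each coset of N lies in one phi^d-twisted
    class, for all d at most n (finite_quotient_twisted). The group modulo N is
    finite, because the abelian subgroup of finite index is finitely generated.
    In a finite group the number of psi-twisted conjugacy classes is the number
    of ordinary conjugacy classes C with psi(C) contained in C, by the orbit-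
    counting lemma (card_twisted_orbits). So the finite set is the set of
    conjugacy classes of the quotient, on which psi acts. *)

(** * Subgroups of finite index and the FC-centre *)

(** Rewriting with these rules computes reduced words of a free group. *)
Definition gsimp (G : groupType) := (@invgM G, @invgK G, @invg1 G, @mulgA G,
  @mulgK G, @mulgVK G, @mulgV G, @mulVg G, @mul1g G, @mulg1 G).

Section InfiniteGroups.
Context (G : groupType).
Implicit Types (A K L M : set G) (S T : seq G) (g h x y z : G).
Local Open Scope group_scope.

Definition finite_index K : Prop :=
  exists T, forall g, exists2 t, t \in T & K (t^-1 * g).

Definition centralizer (D : set G) : set G :=
  [set g | forall x, D x -> commute g x].

Definition fc_center : set G := [set x | finite_index (centralizer [set x])].

Definition generated (D : set G) : set G :=
  [set x | forall K, subgroup K -> D `<=` K -> K x].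

Lemma sub_generated (D : set G) : D `<=` generated D.
Proof. by move=> x Dx K _; apply. Qed.

Lemma generated_subgroup (D : set G) : subgroup (generated D).
Proof.
split=> [K [] //|x y gx gy K sK DK|x gx K sK DK].
- by case: (sK) => _ + _; apply; [exact: gx|exact: gy].
- by case: (sK) => _ _; apply; exact: gx.
Qed.

Lemma subgroupX K x n : subgroup K -> K x -> K (x ^+ n).
Proof.
move=> [K1 KM _] Kx; elim: n => [|n IH]; first by rewrite expg0.
by rewrite expgS; apply: KM.
Qed.

Lemma centralizer_subgroup (D : set G) : subgroup (centralizer D).
Proof.
split=> [x _|g h cg ch x Dx|g cg x Dx].
- exact/commute_sym/commute1.
- by apply/commute_sym/commuteM; apply/commute_sym; [exact: cg|exact: ch].
- by apply/commute_sym/commuteV/commute_sym; exact: cg.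
Qed.

Lemma subgroupI K L : subgroup K -> subgroup L -> subgroup (K `&` L).
Proof.
move=> [K1 KM KV] [L1 LM LV]; split=> //.
- by move=> x y [Kx Lx] [Ky Ly]; split; [exact: KM|exact: LM].
- by move=> x [Kx Lx]; split; [exact: KV|exact: LV].
Qed.

Lemma subgroup_div K x y z : subgroup K -> K (x^-1 * y) -> K (x^-1 * z) ->
  K (y^-1 * z).
Proof.
move=> [_ KM KV] Ky Kz; have -> : y^-1 * z = (x^-1 * y)^-1 * (x^-1 * z).
  by rewrite invgM invgK -mulgA mulVKg.
by apply: KM => //; apply: KV.
Qed.

Lemma finite_index_sub K L : K `<=` L -> finite_index K -> finite_index L.
Proof. by move=> KL [T fT]; exists T => g; have [t tT /KL] := fT g; exists t. Qed.

Lemma finite_indexI K L : subgroup K -> subgroup L ->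
  finite_index K -> finite_index L -> finite_index (K `&` L).
Proof.
move=> sK sL [T fT] [T' fT'].
pose r t t' := xget 1 [set r | K (t^-1 * r) /\ L (t'^-1 * r)].
exists [seq r t t' | t <- T, t' <- T'] => g.
have [t tT Kt] := fT g; have [t' tT' Lt'] := fT' g.
exists (r t t'); first exact: allpairs_f.
have [Kr Lr] : [set r | K (t^-1 * r) /\ L (t'^-1 * r)] (r t t').
  by apply: xgetPex; exists g.
by split; [exact: subgroup_div Kr Kt|exact: subgroup_div Lr Lt'].
Qed.

Lemma finite_index_setT : finite_index [set: G].
Proof. by exists [:: 1] => g; exists 1; rewrite ?mem_head. Qed.

Lemma finite_index_trans K L :
  (exists T, forall k, K k -> exists2 t, t \in T & L (t^-1 * k)) ->
  finite_index K -> finite_index L.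
Proof.
move=> [T' fT'] [T fT]; exists [seq t * t' | t <- T, t' <- T'] => g.
have [t tT /fT' [t' t'T Lt']] := fT g.
by exists (t * t'); [exact: allpairs_f|rewrite invgM -mulgA].
Qed.

Lemma finite_index_conj K x : finite_index K ->
  finite_index [set g | K (x^-1 * g * x)].
Proof.
case=> T fT; exists [seq x * t * x^-1 | t <- T] => g.
have [t tT Kt] := fT (x^-1 * g * x).
exists (x * t * x^-1); first exact: map_f.
by move: Kt; rewrite /= !gsimp.
Qed.

Lemma fc_center_subgroup : subgroup fc_center.
Proof.
have sI x y z : centralizer [set x] `&` centralizer [set y] `<=` centralizer [set z] ->
    fc_center x -> fc_center y -> fc_center z.
  move=> szz fx fy; apply: finite_index_sub szz _.
  by apply: finite_indexI => //; exact: centralizer_subgroup.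
split.
- by apply: finite_index_sub finite_index_setT => x _ _ ->; exact: commute1.
- move=> x y; apply: sI => g [gx gy] _ ->.
  by apply: commuteM; [exact: gx|exact: gy].
- move=> x fx; apply: (sI x x x^-1 _ fx fx) => g [gx _] _ ->.
  by apply: commuteV; exact: gx.
Qed.

Lemma fc_center_conj x y : fc_center x -> fc_center (y * x * y^-1).
Proof.
move=> /(@finite_index_conj _ y); apply: finite_index_sub => g cg _ ->.
have := cg x erefl; rewrite /commute !gsimp => e.
by apply: (mulgI y^-1); apply: (mulIg y); rewrite !gsimp.
Qed.

Lemma finite_index_commuting S : (forall x, x \in S -> fc_center x) ->
  finite_index (centralizer [set` S]).
Proof.
elim: S => [|s S IH] fS; first exact: finite_index_sub finite_index_setT.
have : finite_index (centralizer [set s] `&` centralizer [set` S]).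
  apply: finite_indexI; try exact: centralizer_subgroup.
    by apply: fS; rewrite mem_head.
  by apply: IH => x xS; apply: fS; rewrite inE xS orbT.
apply: finite_index_sub => g [cs cS] x /=.
by rewrite inE => /predU1P[->|/cS//]; exact: cs.
Qed.

(** B. H. Neumann's lemma. If K i has infinite index, some coset of K i is
    missed by the listed cosets of K i, hence is covered by cosets of the other
    subgroups; by translation so are all the cosets of K i, and K i can be
    dropped from the list. *)
Lemma neumann (I : eqType) (K : I -> set G) (r : seq I) T :
  (forall i, subgroup (K i)) ->
  (forall g, exists2 i, i \in r & exists2 t, t \in T & K i (t^-1 * g)) ->
  exists2 i, i \in r & finite_index (K i).
Proof.
move=> sK; elim: r T => [|i r IH] T cov; first by case: (cov 1).
have [fi|] := pselect (finite_index (K i)).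
  by exists i; rewrite ?mem_head.
move=> nfi; have [x nx] : exists x, forall t, t \in T -> ~ K i (t^-1 * x).
  apply: contrapT => nx; apply: nfi; exists T => g.
  apply: contrapT => ng; apply: nx; exists g => t tT Kt.
  by apply: ng; exists t.
have [|j jr fj] := IH (T ++ [seq t * x^-1 * t' | t <- T, t' <- T]); last first.
  by exists j; rewrite ?inE ?jr ?orbT.
  move=> g; have [j] := cov g; rewrite inE => /predU1P[->|jr]; last first.
    by case=> t tT Kt; exists j => //; exists t; rewrite ?mem_cat ?tT.
  case=> t tT Kt; have [j'] := cov (x * (t^-1 * g)).
  rewrite inE => /predU1P[->|jr [t' t'T Kt']].
    case=> t' t'T Kt'; exfalso; apply: (nx t' t'T).
    have [_ KM KV] := sK i.
    have -> : t'^-1 * x = t'^-1 * (x * (t^-1 * g)) * (t^-1 * g)^-1.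
      by rewrite mulgA mulgK.
    by apply: KM => //; apply: KV.
  exists j' => //; exists (t * x^-1 * t').
    by rewrite mem_cat; apply/orP; right; apply: allpairs_f.
  by rewrite !invgM invgK -!mulgA.
Qed.

(** The elements commuting with the FC part of S form a subgroup of finite index.
    Those among them that violate one of the other two conditions lie in
    finitely many cosets of the FC-centre and of centralizers of elements
    outside it, all subgroups of infinite index: by Neumann's lemma some element
    is left. *)
Lemma generic_element S T : ~ finite_index fc_center ->
  exists g, [/\ forall x, x \in S -> fc_center x -> g * x = x * g,
    forall x y, x \in S -> y \in S -> ~ fc_center x -> g * x * g^-1 <> y &
    forall t, t \in T -> ~ fc_center (t^-1 * g)].
Proof.
move=> nfc; pose S0 := [seq x <- S | `[< fc_center x >]].
have memS0 x : (x \in S0) = (x \in S) && `[< fc_center x >].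
  by rewrite mem_filter andbC.
have fC0 : finite_index (centralizer [set` S0]).
  by apply: finite_index_commuting => x; rewrite memS0 => /andP[_ /asboolP].
apply: contrapT => nog.
(* The elements conjugating x into y form the coset of r x y modulo the
   centralizer of x. *)
pose r x y := xget 1 [set g | g * x * g^-1 = y].
pose T1 := [seq r x y | x <- S, y <- S] ++ T.
pose K (o : option G) := if o is Some x then centralizer [set x] else fc_center.
pose I := None :: [seq Some x | x <- S & `[< ~ fc_center x >]].
have cov g : centralizer [set` S0] g -> exists2 i, i \in I & exists2 t, t \in T1 & K i (t^-1 * g).
  move=> Cg; apply: contrapT => ncov; apply: nog; exists g; split.
  - by move=> x xS fx; apply: Cg; rewrite /= memS0 xS; exact/asboolP.
  - move=> x y xS yS nx gxy; apply: ncov; exists (Some x).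
      rewrite inE /=; apply: map_f; rewrite mem_filter xS andbT; exact/asboolP.
    exists (r x y); first by rewrite mem_cat allpairs_f.
    have rxy : [set g | g * x * g^-1 = y] (r x y) by apply: xgetPex; exists g.
    move=> _ ->; rewrite /commute; apply: (mulgI (r x y)); apply: (mulIg g^-1).
    by rewrite !gsimp gxy; exact/esym.
  - move=> t tT fct; apply: ncov; exists None => //.
    by exists t => //; rewrite mem_cat tT orbT.
have [T0 fT0] := fC0.
have [|g|i iI] := @neumann _ K I [seq t * t' | t <- T0, t' <- T1].
- by case=> [x|] /=; [exact: centralizer_subgroup|exact: fc_center_subgroup].
- have [t tT /cov [i iI [t' t'T Kt']]] := fT0 g.
  by exists i => //; exists (t * t'); [exact: allpairs_f|rewrite invgM -mulgA].
rewrite inE in iI; case/orP: iI => [/eqP->//|/mapP[x]].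
by rewrite mem_filter => /andP[/asboolP nx _] ->.
Qed.

(** Schreier: the products of coset representatives with generators that fall
    in K generate it, since the union of the cosets of the subgroup that they
    generate is stable under the generators. *)
Lemma schreier K : finitely_generated [set: G] -> subgroup K ->
  finite_index K -> finitely_generated K.
Proof.
move=> [s [_ gs]] sK [T fT].
pose Q := [seq x <- [seq t'^-1 * x | t' <- T, x <- [seq u * t | u <- s, t <- T]]
                    ++ T | `[< K x >]].
have memQ t t' u : t \in T -> t' \in T -> u \in s -> K (t'^-1 * (u * t)) ->
    t'^-1 * (u * t) \in Q.
  move=> tT t'T us Kx; rewrite mem_filter; apply/andP; split; first exact/asboolP.
  rewrite mem_cat; apply/orP; left.
  by do 2!apply: allpairs_f => //.
have memQT t : t \in T -> K t -> t \in Q.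
  by move=> tT Kt; rewrite mem_filter mem_cat tT orbT andbT; exact/asboolP.
exists Q; split=> [x|M sM QM]; first by rewrite mem_filter => /andP[/asboolP].
have sMK := subgroupI sM sK.
have QMK x : x \in Q -> (M `&` K) x.
  by move=> xQ; split; [exact: QM|move: xQ; rewrite mem_filter => /andP[/asboolP]].
pose U g := exists2 t, t \in T & (M `&` K) (t^-1 * g).
have U1 : U 1.
  have [t tT] := fT 1; rewrite mulg1 => Kt; exists t => //; rewrite mulg1.
  case: (sMK) => _ _; apply; apply: QMK; apply: memQT => //.
  by case: sK => _ _ KV; rewrite -[t]invgK; apply: KV.
have [_ KM KV] := sK; have [_ mkM mkV] := sMK.
pose St : set G := [set u | forall g, U g -> U (u * g) /\ U (u^-1 * g)].
have sSt : subgroup St.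
  split.
  - by move=> g Ug; rewrite invg1 mul1g.
  - move=> x y Sx Sy g Ug; rewrite invgM -!mulgA; split.
      by apply: (Sx _ _).1; apply: (Sy _ _).1.
    by apply: (Sy _ _).2; apply: (Sx _ _).2.
  - by move=> x Sx g Ug; rewrite invgK; have [] := Sx g Ug.
have sSt' u : u \in s -> St u.
  move=> us g [t tT mt]; split.
    have [t' t'T Kt'] := fT (u * t); exists t' => //.
    have -> : t'^-1 * (u * g) = t'^-1 * (u * t) * (t^-1 * g).
      by rewrite -!mulgA mulVKg.
    by apply: mkM => //; apply: QMK; apply: memQ.
  have [t' t'T Kt'] := fT (u^-1 * t); exists t' => //.
  have -> : t'^-1 * (u^-1 * g) = (t^-1 * (u * t'))^-1 * (t^-1 * g).
    by rewrite !invgM invgK -!mulgA mulVKg.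
  apply: mkM => //; apply: mkV; apply: QMK; apply: memQ => //.
  by have := KV _ Kt'; rewrite !invgM !invgK mulgA.
move=> k Kk; have [Uk _] := (gs St sSt sSt' k I) 1 U1.
move: Uk; rewrite mulg1 => -[t tT [Mt Kt]].
have Ktt : K t.
  have -> : t = k * (t^-1 * k)^-1 by rewrite invgM invgK mulVKg.
  by apply: KM => //; apply: KV.
rewrite -[k](mulVKg t); case: (sM) => _ + _; apply=> //.
by apply: QM; apply: memQT.
Qed.

Definition abelian_set A := forall x y, A x -> A y -> x * y = y * x.

(** A is the centre of the FC-centre: it is cut out in it by the centralizers of
    finitely many generators, each of finite index. *)
Lemma virtually_abelian_of_fc : finitely_generated [set: G] ->
  finite_index fc_center ->
  exists A, [/\ subgroup A, abelian_set A & finite_index A].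
Proof.
move=> fg fi; have sF := fc_center_subgroup.
have [s [sF' gF]] := schreier fg sF fi.
exists (fc_center `&` centralizer [set` s]); split.
- exact/subgroupI/centralizer_subgroup.
- move=> x y [_ Cx] [Fy _].
  apply/commute_sym; apply: (gF _ (centralizer_subgroup [set x]) _ _ Fy) => //.
  by move=> z zs _ ->; apply/commute_sym/Cx.
- by apply: finite_indexI => //; [exact: centralizer_subgroup|exact: finite_index_commuting].
Qed.

Lemma pigeonhole (E : eqType) (s : seq E) (f : nat -> E) :
  (forall i, f i \in s) -> exists i j, (i < j <= size s)%N /\ f i = f j.
Proof.
move=> fs; apply: contrapT => nij.
have inj : {in iota 0 (size s).+1 &, injective f}.
  move=> i j; rewrite !mem_iota !ltnS /= => ile jle fij.
  apply/eqP; case: ltngtP => // ij; exfalso; apply: nij.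
    by exists i, j; rewrite ij.
  by exists j, i; rewrite ij.
have := @uniq_leq_size _ (map f (iota 0 (size s).+1)) s.
rewrite map_inj_in_uniq // iota_uniq size_map size_iota ltnn => h.
by suff: false by []; apply: h => // x /mapP[i _ ->].
Qed.

(** Two of the powers g ^+ i with i at most the number of cosets lie in the same
    coset, and the difference of their exponents divides the factorial. *)
Lemma finite_index_exponent K : subgroup K -> finite_index K ->
  exists2 k, (0 < k)%N & forall g, K (g ^+ k).
Proof.
move=> sK [T fT]; exists (size T)`! => [|g]; first exact: fact_gt0.
pose f i := xget 1 [set t | t \in T /\ K (t^-1 * g ^+ i)].
have fP i : f i \in T /\ K ((f i)^-1 * g ^+ i).
  suff: [set t | t \in T /\ K (t^-1 * g ^+ i)] (f i) by [].
  by apply: xgetPex; have [t] := fT (g ^+ i); exists t.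
have [i [j [/andP[ij jT] fij]]] := pigeonhole (fun i => (fP i).1).
have Kij : K (g ^+ (j - i)).
  have := subgroup_div sK (fP i).2; rewrite fij => /(_ _ (fP j).2).
  by rewrite -{1}(subnKC (ltnW ij)) expgnDr mulKg.
have /dvdnP[q ->] : (j - i %| (size T)`!)%N.
  apply: dvdn_fact; rewrite subn_gt0 ij /=.
  exact: leq_trans (leq_subr _ _) jT.
by rewrite mulnC expgnA; apply: subgroupX.
Qed.

(** A finitely generated abelian group has finitely many classes modulo its
    m-th powers: adjoin the generators one at a time. *)
Lemma finite_index_power A m : subgroup A -> abelian_set A ->
  finitely_generated A -> (0 < m)%N ->
  exists T, forall a, A a -> exists2 t, t \in T & exists2 b, A b & t^-1 * a = b ^+ m.
Proof.
move=> sA cA [s [sA' gA]] m0; have [A1 AM AV] := sA.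
suff [T [K [sK KA mK sKs covK]]] : exists T K, [/\ subgroup K, K `<=` A,
    forall b, A b -> K (b ^+ m), forall x, x \in s -> K x &
    forall k, K k -> exists2 t, t \in T & exists2 b, A b & t^-1 * k = b ^+ m].
  by exists T => a Aa; apply: covK; apply: gA Aa.
have eM x y n : A x -> A y -> (x * y) ^+ n = x ^+ n * y ^+ n.
  by move=> Ax Ay; apply: expgMn; apply: cA.
elim: s {gA} sA' => [|x s IH] sA'.
  exists [:: 1], [set b ^+ m | b in A]; split=> //.
  - split; first by exists 1; rewrite ?expg1n.
    + by move=> _ _ [b Ab <-] [c Ac <-]; exists (b * c); [exact: AM|exact: eM].
    + by move=> _ [b Ab <-]; exists b^-1; [exact: AV|rewrite expVgn].
  - by move=> _ [b Ab <-]; apply: subgroupX.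
  - by move=> b Ab; exists b.
  - move=> _ [b Ab <-]; exists 1; rewrite ?mem_head //.
    by exists b; rewrite // invg1 mul1g.
have [|T [K [[K1 KM KV] KA mK sKs covK]]] := IH.
  by move=> y ys; apply: sA'; rewrite inE ys orbT.
have Ax : A x by apply: sA'; rewrite mem_head.
have AX n : A (x ^+ n) by apply: subgroupX.
exists [seq x ^+ e * t | e <- iota 0 m, t <- [seq t <- T | `[< A t >]]],
  [set g | exists e k, K k /\ g = x ^+ e * k]; split.
- split.
  + by exists 0%N, 1; rewrite expg0 mulg1.
  + move=> _ _ [e [k [Kk ->]]] [e' [k' [Kk' ->]]].
    exists (e + e')%N, (k * k'); split; first exact: KM.
    rewrite expgnDr -!mulgA; congr (_ * _); rewrite !mulgA; congr (_ * _).
    by apply: cA => //; apply: KA.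
  + move=> _ [e [k [Kk ->]]]; exists (m.-1 * e)%N, ((x ^+ e)^-1 ^+ m * k^-1).
    split; first by apply: KM; [apply: mK; exact: AV|exact: KV].
    rewrite invgM (cA k^-1) //; [|by apply: AV; apply: KA|exact: AV].
    rewrite mulgA; congr (_ * _); rewrite expVgn -expgnA.
    have -> : (m.-1 * e = e * m - e)%N by rewrite -subn1 mulnBl mul1n mulnC.
    apply: (mulgI (x ^+ e)).
    by rewrite mulgV mulgA -expgnDr subnKC ?leq_pmulr // mulgV.
- by move=> _ [e [k [Kk ->]]]; apply: AM => //; apply: KA.
- by move=> b Ab; exists 0%N, (b ^+ m); rewrite expg0 mul1g; split=> //; apply: mK.
- move=> y; rewrite inE => /predU1P[->|ys]; first by exists 1%N, 1; rewrite expg1 mulg1.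
  by exists 0%N, y; rewrite expg0 mul1g; split=> //; apply: sKs.
- move=> _ [e [k [Kk ->]]]; have [t tT [b Ab tb]] := covK k Kk.
  have At : A t.
    have -> : t = k * (t^-1 * k)^-1 by rewrite invgM invgK mulVKg.
    by apply: AM; [exact: KA|apply: AV; rewrite tb; apply: subgroupX].
  exists (x ^+ (e %% m) * t).
    apply: allpairs_f; first by rewrite mem_iota /= add0n ltn_mod.
    by rewrite mem_filter tT andbT; exact/asboolP.
  exists (x ^+ (e %/ m) * b); first exact: AM.
  have -> : k = t * b ^+ m by rewrite -tb mulVKg.
  have cx : t^-1 * x ^+ (e %/ m * m) = x ^+ (e %/ m * m) * t^-1.
    by apply: cA => //; apply: AV.
  by rewrite eM // -expgnA {2}(divn_eq e m) addnC expgnDr !gsimp cx !gsimp.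
Qed.

End InfiniteGroups.

(** * Square-summable families *)

Section UnconditionalSums.
Context (R : realType) (I : choiceType).
Local Notation C := R[i].
Implicit Types (f g : I -> C) (F : {fset I}) (e s : C).

Definition has_sum f s : Prop := forall e, 0 < e ->
  exists F0, forall F, (F0 `<=` F)%fset -> `|\sum_(i <- F) f i - s| <= e.

Definition square_summable f : Prop :=
  exists B : C, forall F, \sum_(i <- F) `|f i| ^+ 2 <= B.

Lemma has_sum_unique f s s' : has_sum f s -> has_sum f s' -> s = s'.
Proof.
move=> fs fs'; apply/eqP; rewrite -subr_eq0 -normr_eq0; apply/negPn/negP => n0.
have d0 : 0 < `|s - s'| / 3 by rewrite divr_gt0 ?ltr0n // lt_def n0 normr_ge0.
have [F1 h1] := fs _ d0; have [F2 h2] := fs' _ d0.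
have := h1 _ (fsubsetUl F1 F2); have := h2 _ (fsubsetUr F1 F2).
set S := \sum_(i <- _) _ => a b.
have : `|s - s'| <= `|s - s'| / 3 + `|s - s'| / 3.
  apply: le_trans (lerD b a); rewrite distrC.
  have -> : s' - s = (S - s) - (S - s') by ring.
  exact: ler_normB.
apply/negP; rewrite -real_ltNge ?realE ?normr_ge0 //; last first.
  by rewrite addr_ge0 // ltW.
have p : 0 < `|s - s'| by rewrite lt_def n0 normr_ge0.
rewrite -mulrDr -[ltRHS]mulr1 (ltr_pM2l p).
have -> : 3^-1 + 3^-1 = 2 / 3 :> C by ring.
by rewrite ltr_pdivrMr ?ltr0n // mul1r ltr_nat.
Qed.

Lemma has_sumD f g s t : has_sum f s -> has_sum g t ->
  has_sum (fun i => f i + g i) (s + t).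
Proof.
move=> fs gt e e0; have e2 : 0 < e / 2 by rewrite divr_gt0 ?ltr0n.
have [F1 h1] := fs _ e2; have [F2 h2] := gt _ e2.
exists (F1 `|` F2)%fset => F FF; rewrite big_split /= opprD addrACA.
apply: le_trans (ler_normD _ _) _; rewrite [e]splitr; apply: lerD.
  by apply: h1; apply: fsubset_trans FF; exact: fsubsetUl.
by apply: h2; apply: fsubset_trans FF; exact: fsubsetUr.
Qed.

Lemma has_sumZ a f s : has_sum f s -> has_sum (fun i => a * f i) (a * s).
Proof.
move=> fs e e0; have [->|a0] := eqVneq a 0.
  exists fset0 => F _; rewrite big1 ?mul0r ?subrr ?normr0 ?ltW // => i _.
  by rewrite mul0r.
have [|F0 h] := fs (e / `|a|); first by rewrite divr_gt0 ?normr_gt0.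
exists F0 => F /h; rewrite -mulr_sumr -mulrBr normrM.
by rewrite ler_pdivlMr ?normr_gt0 // mulrC.
Qed.

Lemma has_sum_conj f s : has_sum f s -> has_sum (fun i => (f i)^*) s^*.
Proof.
move=> fs e /fs [F0 h]; exists F0 => F /h.
by rewrite -rmorph_sum -rmorphB norm_conjC.
Qed.

Lemma has_sum_reindex f s (h k : I -> I) : cancel h k -> cancel k h ->
  has_sum f s -> has_sum (f \o h) s.
Proof.
move=> hk kh fs e /fs [F0 H]; exists [fset k x | x in F0]%fset => F F0F.
have -> : \sum_(i <- F) (f \o h) i = \sum_(j <- [fset h x | x in F]%fset) f j.
  by rewrite big_imfset //= => x y _ _ /(can_inj hk).
apply: H; apply/fsubsetP => x xF0; apply/imfsetP; exists (k x); rewrite ?kh //.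
by apply: (fsubsetP F0F); apply: in_imfset.
Qed.

Lemma sum_fset_le f F F' : (forall i, 0 <= f i) -> (F `<=` F')%fset ->
  \sum_(i <- F) f i <= \sum_(i <- F') f i.
Proof.
move=> f0 FF'; rewrite [leRHS](big_fsetID _ (mem F)) /=.
have -> : [fset x in F' | x \in F]%fset = F.
  apply/fsetP => x; rewrite !inE /=; apply/andP/idP => [[]//|xF].
  by split=> //; apply: (fsubsetP FF').
by rewrite lerDl sumr_ge0.
Qed.

Lemma has_sum_real f s : (forall i, 0 <= f i) -> has_sum f s -> s \is Num.real.
Proof.
move=> f0 fs; apply/CrealP; have := has_sum_conj fs.
suff fE : (fun i => (f i)^*) = f by rewrite fE => /has_sum_unique; apply.
by apply/funext => i; apply/CrealP/ger0_real.
Qed.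

Lemma has_sum_ub f s F : (forall i, 0 <= f i) -> has_sum f s ->
  \sum_(i <- F) f i <= s.
Proof.
move=> f0 fs; apply/ler_addgt0Pr => e /fs [F0 /(_ _ (fsubsetUr F F0))] h.
apply: le_trans (sum_fset_le f0 (fsubsetUl F F0)) _.
rewrite -lerBlDl; apply: le_trans h; apply: real_ler_norm.
by rewrite realB ?(has_sum_real f0 fs) // realE sumr_ge0.
Qed.

Lemma has_sum_lub f s B : (forall i, 0 <= f i) -> has_sum f s ->
  (forall F, \sum_(i <- F) f i <= B) -> s <= B.
Proof.
move=> f0 fs fB; apply/ler_addgt0Pr => e /fs [F0 /(_ _ (fsubset_refl F0))] h.
rewrite -lerBlDl; apply: le_trans (lerB (lexx s) (fB F0)) _.
rewrite distrC in h; apply: le_trans h; apply: real_ler_norm.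
by rewrite realB ?(has_sum_real f0 fs) // realE sumr_ge0.
Qed.

Lemma has_sum_ge0 f s : (forall i, 0 <= f i) -> has_sum f s -> 0 <= s.
Proof.
by move=> f0 fs; have := has_sum_ub fset0 f0 fs; rewrite big_seq_fset0.
Qed.

Lemma has_sum_nneg (g : I -> R) (b : R) : (forall i, 0 <= g i) ->
  (forall F, \sum_(i <- F) g i <= b) ->
  exists s, has_sum (fun i => (g i)%:C%C) s.
Proof.
move=> g0 gb; pose E := [set \sum_(i <- F) g i | F in [set: {fset I}]].
have sE : has_sup E.
  by split; [exists (\sum_(i <- fset0) g i), fset0|exists b => _ [F _ <-]].
exists (sup E)%:C%C => e e0.
have eR : e = (complex.Re e)%:C%C by rewrite RRe_real // gtr0_real.
have re0 : 0 < complex.Re e by rewrite -ltcR -eR.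
have [_ [F0 _ <-] lt] := sup_adherent re0 sE; exists F0 => F F0F.
rewrite -rmorph_sum -rmorphB eR.
have -> (x : R) : `|x%:C%C| = `|x|%:C%C.
  by rewrite normc_def /= expr0n addr0 sqrtr_sqr.
rewrite lecR ler_norml; apply/andP; split.
  rewrite lerBrDl; apply: ltW; apply: lt_le_trans lt _.
  rewrite -lecR !rmorph_sum; apply: sum_fset_le F0F => i.
  by rewrite ler0c.
rewrite lerBlDl; apply: (@le_trans _ _ (sup E)); last by rewrite lerDl ltW.
by apply: sup_ubound; [case: sE|exists F].
Qed.

(** The family g is the difference of the nonnegative families |g| + g and |g|. *)
Lemma has_sum_real_ex (g : I -> R) (b : R) :
  (forall F, \sum_(i <- F) `|g i| <= b) ->
  exists s, has_sum (fun i => (g i)%:C%C) s.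
Proof.
move=> gb.
have [//|//|s hs] := @has_sum_nneg (fun i => `|g i|) b.
have [i|F|t ht] := @has_sum_nneg (fun i => `|g i| + g i) (b + b).
- by rewrite -lerBlDr sub0r -normrN ler_norm.
- by rewrite big_split /=; apply: lerD => //; apply: le_trans (gb F); apply: ler_sum => i _; exact: ler_norm.
exists (t + (-1) * s).
have -> : (fun i => (g i)%:C%C) =
    fun i => (`|g i| + g i)%:C%C + (-1) * `|g i|%:C%C.
  by apply/funext => i; rewrite mulN1r rmorphD /= addrAC subrr add0r.
by apply: has_sumD => //; exact: has_sumZ.
Qed.

Lemma has_sum_ex f (B : C) : (forall F, \sum_(i <- F) `|f i| <= B) ->
  exists s, has_sum f s.
Proof.
move=> fB; have reb F (h : I -> R) : (forall i, (`|h i|%:C)%C <= `|f i|) ->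
    \sum_(i <- F) `|h i| <= complex.Re B.
  move=> hf; suff : ((\sum_(i <- F) `|h i|)%:C%C <= B) by rewrite lecE => /andP[_].
  by apply: le_trans (fB F); rewrite rmorph_sum; apply: ler_sum => i _; exact: hf.
have [F|s hs] := @has_sum_real_ex (fun i => complex.Re (f i)) (complex.Re B).
  by apply: reb => i; exact: normc_ge_Re.
have [F|t ht] := @has_sum_real_ex (fun i => complex.Im (f i)) (complex.Re B).
  apply: reb => i; have := normc_ge_Re (f i * 'i%C).
  by rewrite ReiNIm normrN normrM (normc_def 'i%C) /= expr0n expr1n add0r sqrtr1 mulr1.
exists (s + 'i%C * t).
have -> : f = fun i => (complex.Re (f i))%:C%C + 'i%C * (complex.Im (f i))%:C%C.
  by apply/funext => i; rewrite -complexE.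
by apply: has_sumD => //; exact: has_sumZ.
Qed.

Lemma square_summableM f g : square_summable f -> square_summable g ->
  exists s, has_sum (fun i => f i * (g i)^*) s.
Proof.
move=> [A fA] [B gB]; apply: (@has_sum_ex _ (A + B)) => F.
apply: le_trans (lerD (fA F) (gB F)); rewrite -big_split /=.
apply: ler_sum => i _; rewrite normrM norm_conjC.
set a := `|f i|; set b := `|g i|.
have a0 : 0 <= a by exact: normr_ge0. have b0 : 0 <= b by exact: normr_ge0.
have : 0 <= (a - b) ^+ 2 by rewrite real_exprn_even_ge0 // realB ?ger0_real.
rewrite sqrrB addrAC subr_ge0 => h; apply: le_trans h.
by rewrite mulr2n lerDl mulr_ge0.
Qed.

Lemma sqr_norm_le2 (x y z : C) :
  `|x - z| ^+ 2 <= 2 * `|x - y| ^+ 2 + 2 * `|y - z| ^+ 2.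
Proof.
have -> : x - z = (x - y) + (y - z) by ring.
set p := x - y; set q := y - z.
apply: (@le_trans _ _ ((`|p| + `|q|) ^+ 2)).
  by rewrite ler_sqr ?nnegrE ?addr_ge0 // ler_normD.
have : 0 <= (`|p| - `|q|) ^+ 2 by rewrite real_exprn_even_ge0 // realB ?ger0_real.
rewrite sqrrB sqrrD => h; rewrite -subr_ge0.
by move: h; congr (0 <= _); ring.
Qed.

Lemma square_summableP a f g : square_summable f -> square_summable g ->
  square_summable (fun i => a * f i + g i).
Proof.
move=> [A fA] [B gB]; exists (2 * (`|a| ^+ 2 * A) + 2 * B) => F.
apply: (@le_trans _ _ (\sum_(i <- F) (2 * (`|a| ^+ 2 * `|f i| ^+ 2) + 2 * `|g i| ^+ 2))).
  apply: ler_sum => i _; rewrite -exprMn -normrM.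
  by have := sqr_norm_le2 (a * f i) 0 (- g i); rewrite subr0 opprK add0r.
rewrite big_split /= -!mulr_sumr; apply: lerD; rewrite ler_pM2l ?ltr0n //.
by apply: ler_wpM2l; rewrite ?exprn_ge0.
Qed.

End UnconditionalSums.

Lemma cauchy_real_limit (R : realType) (x : nat -> R) :
  (forall e, 0 < e -> exists N, forall m n, (N <= m)%N -> (N <= n)%N ->
     `|x m - x n| <= e) ->
  exists l, forall e, 0 < e -> exists N, forall n, (N <= n)%N -> `|x n - l| <= e.
Proof.
move=> cx; have : cvgn x.
  apply/cauchy_cvgP/cauchy_exP => e e0.
  have e2 : 0 < e / 2 by rewrite divr_gt0.
  have [N hN] := cx _ e2; exists (x N); exists N => // n /= Nn.
  rewrite -ball_normE /=; apply: le_lt_trans (hN _ _ _ _) _ => //.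
  by rewrite ltr_pdivrMr // mulr_natr mulr2n ltrDl.
move=> /cvgrPdist_le h; exists (limn x) => e /h [N _ hN].
by exists N => n Nn; rewrite distrC; exact: hN.
Qed.

(** It suffices to treat the real and the imaginary parts. *)
Lemma cauchy_complex_limit (R : realType) (x : nat -> R[i]) :
  (forall e, 0 < e -> exists N, forall m n, (N <= m)%N -> (N <= n)%N ->
     `|x m - x n| <= e) ->
  exists l, forall e, 0 < e -> exists N, forall n, (N <= n)%N -> `|x n - l| <= e.
Proof.
move=> cx.
have cauR (h : R[i] -> R) : (forall y z, h y - h z = h (y - z)) ->
    (forall y, (`|h y|%:C)%C <= `|y|) ->
    exists l : R, forall e, 0 < e -> exists N, forall n, (N <= n)%N ->
      `|h (x n) - l| <= e.
  move=> hB hn; apply: cauchy_real_limit => e e0.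
  have [|N hN] := cx e%:C%C; first by rewrite ltcR.
  exists N => m n Nm Nn; rewrite hB -lecR; apply: le_trans (hn _) _.
  exact: hN.
have [y z|y|a ha] := cauR (@complex.Re R); [by rewrite raddfB|exact: normc_ge_Re|].
have [y z|y|b hb] := cauR (@complex.Im R); first by rewrite raddfB.
  have := normc_ge_Re (y * 'i%C).
  by rewrite ReiNIm normrN normrM (normc_def 'i%C) /= expr0n expr1n add0r sqrtr1 mulr1.
exists (a +i* b)%C => e e0.
have eR : e = (complex.Re e)%:C%C by rewrite RRe_real // gtr0_real.
have e2 : 0 < complex.Re e / 2 by rewrite divr_gt0 // -ltcR -eR.
have [N hN] := ha _ e2; have [M hM] := hb _ e2; exists (maxn N M) => n.
rewrite geq_max => /andP[/hN h1 /hM h2]; rewrite [x n]complexE.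
have -> : (a +i* b)%C = a%:C%C + 'i%C * b%:C%C by rewrite {1}[(a +i* b)%C]complexE.
set p := complex.Re _ in h1 *; set q := complex.Im _ in h2 *.
have -> : p%:C%C + 'i%C * q%:C%C - (a%:C%C + 'i%C * b%:C%C) =
  (p - a)%:C%C + 'i%C * (q - b)%:C%C by rewrite !rmorphB /=; ring.
apply: le_trans (ler_normD _ _) _.
rewrite normrM (normc_def 'i%C) /= expr0n expr1n add0r sqrtr1 mul1r.
have nC (y : R) : `|y%:C%C| = `|y|%:C%C.
  by rewrite normc_def /= expr0n addr0 sqrtr_sqr.
rewrite !nC -rmorphD eR lecR; apply: le_trans (lerD h1 h2) _.
by rewrite -splitr.
Qed.

Definition l2_pred (R : realType) (I : choiceType) : {pred I -> R[i]^o} :=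
  fun f => `[< square_summable f >].

Definition l2 (R : realType) (I : choiceType) := {f : I -> R[i]^o | l2_pred f}.

Section SquareSummableSpace.
Context (R : realType) (I : choiceType).
Local Notation C := R[i].
Local Notation V := (l2 R I).

HB.instance Definition _ := Choice.on V.
HB.instance Definition _ := [isSub of V for @sval _ _].

Fact l2_submod_closed : submod_closed (@l2_pred R I).
Proof.
split=> [|a f g /asboolP sf /asboolP sg]; apply/asboolP.
  by exists 0 => F; rewrite big1 // => i _; rewrite normr0 expr0n.
exact: square_summableP.
Qed.

HB.instance Definition _ := GRing.isSubmodClosed.Build C (I -> R[i]^o)
  (@l2_pred R I) l2_submod_closed.
HB.instance Definition _ := [SubChoice_isSubLmodule of V by <:].

Implicit Types (u v w : V) (i : I) (A : set I) (F : {fset I}).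

Definition coef u i : C := val u i.

Lemma l2P u v : (forall i, coef u i = coef v i) -> u = v.
Proof. by move=> uv; apply/val_inj/funext. Qed.

Lemma coefD u v i : coef (u + v) i = coef u i + coef v i.
Proof. by rewrite /coef raddfD. Qed.

Lemma coefB u v i : coef (u - v) i = coef u i - coef v i.
Proof. by rewrite /coef raddfB. Qed.

Lemma coefZ a u i : coef (a *: u) i = a * coef u i.
Proof. by rewrite /coef linearZ. Qed.

Lemma coef0 i : coef 0 i = 0.
Proof. by rewrite /coef raddf0. Qed.

Lemma coef_summable u : square_summable (coef u).
Proof. by have /asboolP := valP u. Qed.

Definition l2_of (f : I -> C) : V :=
  if pselect (square_summable f) is left sf then exist _ f (asboolT sf) else 0.

Lemma coef_l2_of f i : square_summable f -> coef (l2_of f) i = f i.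
Proof. by rewrite /l2_of; case: pselect. Qed.

Definition l2_dot u v : C :=
  xget 0 [set s | has_sum (fun i => coef u i * (coef v i)^*) s].

Lemma l2_dotP u v : has_sum (fun i => coef u i * (coef v i)^*) (l2_dot u v).
Proof.
have [s hs] := square_summableM (coef_summable u) (coef_summable v).
by rewrite /l2_dot; case: xgetP => // /(_ s).
Qed.

Lemma l2_dotE u v s : has_sum (fun i => coef u i * (coef v i)^*) s ->
  l2_dot u v = s.
Proof. by move=> hs; apply: has_sum_unique hs; exact: l2_dotP. Qed.

Lemma l2_dotPl v a u w :
  l2_dot (a *: u + w) v = a * l2_dot u v + l2_dot w v.
Proof.
apply: l2_dotE; have := has_sumD (has_sumZ a (l2_dotP u v)) (l2_dotP w v).
by congr has_sum; apply/funext => i; rewrite coefD coefZ mulrDl mulrA.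
Qed.

Lemma l2_dotC u v : l2_dot u v = (l2_dot v u)^*.
Proof.
apply: l2_dotE; have := has_sum_conj (l2_dotP v u).
by congr has_sum; apply/funext => i; rewrite rmorphM /= conjCK mulrC.
Qed.

Let nneg u i : 0 <= coef u i * (coef u i)^*.
Proof. by rewrite -normCK exprn_ge0. Qed.

Lemma l2_dot_ub u F : \sum_(i <- F) `|coef u i| ^+ 2 <= l2_dot u u.
Proof.
under eq_bigr do rewrite normCK.
exact: has_sum_ub (nneg u) (l2_dotP u u).
Qed.

Lemma l2_dot_lub u B : (forall F, \sum_(i <- F) `|coef u i| ^+ 2 <= B) ->
  l2_dot u u <= B.
Proof.
move=> uB; apply: has_sum_lub (nneg u) (l2_dotP u u) _ => F.
by under eq_bigr do rewrite -normCK.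
Qed.

Lemma l2_coef_le u i : `|coef u i| ^+ 2 <= l2_dot u u.
Proof. by have := l2_dot_ub u [fset i]%fset; rewrite big_seq_fset1. Qed.

Let dot_ge0 u : 0 <= l2_dot u u.
Proof. exact: has_sum_ge0 (nneg u) (l2_dotP u u). Qed.

Lemma l2_dot_gt0 u : u != 0 -> 0 < l2_dot u u.
Proof.
move=> u0; rewrite lt_def dot_ge0 andbT; apply: contra u0 => /eqP d0.
apply/eqP/l2P => i; rewrite coef0; apply/eqP; rewrite -normr_eq0 -sqrf_eq0.
by rewrite eq_le exprn_ge0 // andbT -d0 l2_coef_le.
Qed.

Lemma l2_dot_bilinear : bilinear_for
  (GRing.Scale.Law.clone _ _ *%R _) (GRing.Scale.Law.clone _ _ (Num.conj \; *%R) _)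
  l2_dot.
Proof.
split=> [v|u] a x y /=; first exact: l2_dotPl.
by rewrite l2_dotC l2_dotPl rmorphD rmorphM /= -!l2_dotC.
Qed.

HB.instance Definition _ := bilinear_isBilinear.Build C V V C _ _ l2_dot l2_dot_bilinear.
HB.instance Definition _ := isHermitianSesquilinear.Build C V false Num.conj l2_dot
  (fun x y => etrans (l2_dotC x y) (esym (mul1r _))).
HB.instance Definition _ := isDotProduct.Build C V l2_dot l2_dot_gt0.

Definition l2_form : {dot V for Num.conj} := l2_dot.

(** The limit is taken coefficientwise; the estimates of the tails pass to the
    limit on each finite set of indices, and from there to the whole norm. *)
Lemma l2_complete : hilbert_complete l2_form.
Proof.
move=> u cu.
have cvg_coef i : exists l : C, forall e, 0 < e -> exists N, forall n, (N <= n)%N ->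
    `|coef (u n) i - l| <= e.
  apply: cauchy_complex_limit => e e0.
  have [N hN] := cu _ (exprn_gt0 2 e0); exists N => m n Nm Nn.
  rewrite -coefB -ler_sqr ?nnegrE ?normr_ge0 ?(ltW e0) //.
  exact: le_trans (l2_coef_le _ _) (ltW (hN _ _ Nm Nn)).
pose l i := projT1 (cid (cvg_coef i)).
have lP i e : 0 < e -> exists N, forall n, (N <= n)%N -> `|coef (u n) i - l i| <= e.
  exact: (projT2 (cid (cvg_coef i))).
have lF e F : 0 < e -> exists N, forall n, (N <= n)%N ->
    \sum_(i <- F) `|coef (u n) i - l i| ^+ 2 <= e.
  move=> e0; pose c : C := e / (size F).+1%:R.
  have c0 : 0 < c by rewrite divr_gt0 ?ltr0n.
  have hs (s : seq I) : exists N, forall n, (N <= n)%N ->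
      \sum_(i <- s) `|coef (u n) i - l i| ^+ 2 <= c *+ size s.
    elim: s => [|i s [N hN]]; first by exists 0%N => n _; rewrite big_nil.
    have sc0 : 0 < sqrtC c by rewrite sqrtC_gt0.
    have [M hM] := lP i _ sc0; exists (maxn N M) => n; rewrite geq_max.
    move=> /andP[/hN h1 /hM h2]; rewrite big_cons /= mulrS; apply: lerD => //.
    by rewrite -[c]sqrtCK ler_sqr ?nnegrE ?normr_ge0 // ltW.
  have [N hN] := hs F; exists N => n /hN h; apply: le_trans h _.
  rewrite -[leLHS]mulr_natr /c mulrAC ler_pdivrMr ?ltr0n // ler_pM2l //.
  by rewrite ler_nat.
have tail e : 0 < e -> exists N, forall n, (N <= n)%N -> forall F,
    \sum_(i <- F) `|coef (u n) i - l i| ^+ 2 <= e.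
  move=> e0; have e4 : 0 < e / 4 by rewrite divr_gt0 ?ltr0n.
  have [N hN] := cu _ e4; exists N => n Nn F.
  have [M hM] := lF _ F e4; pose m := maxn M N.
  have h1 := hM m (leq_maxl _ _); have h2 := hN n m Nn (leq_maxr _ _).
  have h3 := le_trans (l2_dot_ub (u n - u m) F) (ltW h2).
  apply: (@le_trans _ _ (\sum_(i <- F) (2 * `|coef (u n - u m) i| ^+ 2
                          + 2 * `|coef (u m) i - l i| ^+ 2))).
    apply: ler_sum => i _; rewrite coefB.
    exact: sqr_norm_le2.
  rewrite big_split /= -!mulr_sumr.
  apply: (@le_trans _ _ (2 * (e / 4) + 2 * (e / 4))).
    by apply: lerD; rewrite ler_pM2l ?ltr0n.
  by rewrite le_eqVlt; apply/orP; left; apply/eqP; field.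
have sl : square_summable l.
  have [N hN] := tail 1 ltr01; have [B hB] := coef_summable (u N).
  exists (2 * 1 + 2 * B) => F.
  apply: (@le_trans _ _ (\sum_(i <- F) (2 * `|coef (u N) i - l i| ^+ 2
                          + 2 * `|coef (u N) i| ^+ 2))).
    apply: ler_sum => i _; have := sqr_norm_le2 (l i) (coef (u N) i) 0.
    by rewrite !subr0 distrC.
  rewrite big_split /= -!mulr_sumr.
  by apply: lerD; rewrite ler_pM2l ?ltr0n //; exact: hN.
exists (l2_of l) => e e0; have e2 : 0 < e / 2 by rewrite divr_gt0 ?ltr0n.
have [N hN] := tail _ e2; exists N => n Nn.
apply: (@le_lt_trans _ _ (e / 2)); last first.
  by rewrite ltr_pdivrMr ?ltr0n // mulr_natr mulr2n ltrDl.
apply: l2_dot_lub => F; under eq_bigr do rewrite coefB coef_l2_of //.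
exact: hN.
Qed.

Definition delta i : V := l2_of (fun j => (j == i)%:R).

Lemma coef_delta i j : coef (delta i) j = (j == i)%:R.
Proof.
rewrite coef_l2_of //; exists 1 => F.
have e0 k : k != i -> `|(k == i)%:R : C| ^+ 2 = 0.
  by move=> /negbTE ->; rewrite normr0 expr0n.
have [iF|iF] := boolP (i \in F).
  rewrite (big_fsetD1 i) //= eqxx normr1 expr1n big1_seq ?addr0 // => k.
  by rewrite !inE => /andP[_ /andP[/e0]].
by rewrite big1_seq // => k /= kF; apply: e0; apply: contraNneq iF => <-.
Qed.

Lemma l2_dot_delta u i : l2_dot u (delta i) = coef u i.
Proof.
apply: l2_dotE => e e0; exists [fset i]%fset => F /fsubsetP /(_ i).
rewrite fset11 => /(_ isT) iF; rewrite (big_fsetD1 i) //=.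
rewrite coef_delta eqxx conjC1 mulr1 big1_seq ?addr0 ?subrr ?normr0 ?ltW //.
move=> j; rewrite !inE => /andP[_ /andP[/negbTE ji _]].
by rewrite coef_delta ji conjC0 mulr0.
Qed.

Definition restrict A u : V := l2_of (fun i => if `[< A i >] then coef u i else 0).

Lemma coef_restrict A u i : coef (restrict A u) i = if `[< A i >] then coef u i else 0.
Proof.
rewrite coef_l2_of //; have [B hB] := coef_summable u; exists B => F.
apply: le_trans (hB F); apply: ler_sum => j _; case: ifP => // _.
by rewrite normr0 expr0n /= exprn_ge0.
Qed.

Lemma restrict_le A B u : A `<=` B ->
  l2_dot (restrict A u) (restrict A u) <= l2_dot (restrict B u) (restrict B u).
Proof.
move=> AB; apply: l2_dot_lub => F; apply: le_trans (l2_dot_ub _ F).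
apply: ler_sum => i _; rewrite !coef_restrict.
case: asboolP => [/AB Bi|_]; first by rewrite asboolT.
by rewrite normr0 expr0n /= exprn_ge0.
Qed.

Lemma restrictT u : restrict setT u = u.
Proof. by apply: l2P => i; rewrite coef_restrict asboolT. Qed.

Lemma restrict_dot A u v : l2_dot (restrict A u) v = l2_dot u (restrict A v).
Proof.
apply: l2_dotE; have := l2_dotP u (restrict A v).
congr has_sum; apply/funext => i; rewrite !coef_restrict.
by case: asboolP => // _; rewrite conjC0 mul0r mulr0.
Qed.

(** The mass of u outside F is what the partial sum over F still lacks. *)
Lemma l2_tail u e : 0 < e -> exists F, forall A, [set` F] `<=` A ->
  l2_dot (u - restrict A u) (u - restrict A u) <= e.
Proof.
move=> e0; have e2 : 0 < e / 2 by rewrite divr_gt0 ?ltr0n.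
have [F0 hF] := l2_dotP u u e2; exists F0 => A FA.
have hub F : \sum_(i <- F) `|coef u i| ^+ 2 <= l2_dot u u by exact: l2_dot_ub.
apply: l2_dot_lub => F.
pose h i := `|coef (u - restrict A u) i| ^+ 2.
have h0 i : 0 <= h i by rewrite exprn_ge0.
apply: le_trans (sum_fset_le h0 (fsubsetUl F F0)) _.
have hle i : h i <= (i \notin F0)%:R * `|coef u i| ^+ 2.
  rewrite /h coefB coef_restrict; case: asboolP => [_|nA].
    by rewrite subrr normr0 expr0n mulr_ge0 // exprn_ge0.
  rewrite subr0; suff -> : i \notin F0 by rewrite mul1r.
  by apply/negP => iF0; apply: nA; exact: FA.
apply: le_trans (ler_sum _ (fun i _ => hle i)) _.
set X := (F `|` F0)%fset; set t := \sum_(i <- X) _.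
have hX : \sum_(i <- X) `|coef u i| ^+ 2 = \sum_(i <- F0) `|coef u i| ^+ 2 + t.
  pose g i := (i \in F0)%:R * `|coef u i| ^+ 2.
  have -> : \sum_(i <- F0) `|coef u i| ^+ 2 = \sum_(i <- X) g i.
    rewrite -(big_fset_incl _ (fsubsetUr F F0)) => [|i _ /negbTE iF0]; last first.
      by rewrite /g iF0 mul0r.
    by apply: eq_big_seq => i iF0; rewrite /g iF0 mul1r.
  rewrite -big_split; apply: eq_bigr => i _.
  by rewrite /g; case: (i \in F0); rewrite /= ?mul0r ?mul1r ?addr0 ?add0r.
have {}hF := hF _ (fsubset_refl F0).
have rt : t \is Num.real.
  by rewrite realE sumr_ge0 // => i _; rewrite mulr_ge0 ?exprn_ge0.
have tle : t <= l2_dot u u - \sum_(i <- F0) `|coef u i| ^+ 2.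
  by rewrite lerBrDl -hX.
apply: le_trans tle _; apply: (@le_trans _ _ (e / 2)); last first.
  by rewrite ler_pdivrMr ?ltr0n // mulr_natr mulr2n lerDl ltW.
rewrite distrC in hF; apply: le_trans hF.
under [X in _ - X <= _]eq_bigr do rewrite normCK.
apply: real_ler_norm; rewrite realB //; first by rewrite realE dot_ge0.
by rewrite realE sumr_ge0 // => i _; exact: nneg.
Qed.

Definition l2_comp (h : I -> I) u : V := l2_of (coef u \o h).

Lemma coef_l2_comp (h k : I -> I) u i : cancel h k -> coef (l2_comp h u) i = coef u (h i).
Proof.
move=> hk; rewrite coef_l2_of //; have [B hB] := coef_summable u; exists B => F.
apply: le_trans (hB [fset h x | x in F]%fset).
by rewrite big_imfset //= => x y _ _ /(can_inj hk).
Qed.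

Lemma l2_comp_dot (h k : I -> I) u v : cancel h k -> cancel k h ->
  l2_dot (l2_comp h u) (l2_comp h v) = l2_dot u v.
Proof.
move=> hk kh; apply: l2_dotE; have := has_sum_reindex hk kh (l2_dotP u v).
by congr has_sum; apply/funext => i /=; rewrite !(coef_l2_comp _ _ hk).
Qed.

End SquareSummableSpace.

(** * Abelian projections of the regular representation *)

Section CauchySchwarz.
Context (C : numClosedFieldType) (V : lmodType C) (dot : {dot V for Num.conj}).

Lemma cauchy_schwarz u v : `|dot u v| ^+ 2 <= dot u u * dot v v.
Proof.
have [->|v0] := eqVneq v 0.
  by rewrite linear0r normr0 expr0n mulr_ge0 // dnorm_ge0.
have vv : 0 < dot v v by rewrite dnorm_gt0.
have hC : dot v u = (dot u v)^* by rewrite hermC /= expr0 mul1r.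
have rv : (dot v v)^* = dot v v by apply/CrealP/gtr0_real.
set n := dot v v in vv rv *; set d := dot u v; pose q := `|d| ^+ 2 / n.
pose w := u - (d / n) *: v.
have : 0 <= dot w w by exact: dnorm_ge0.
have hq : dot u ((d / n) *: v) = q.
  by rewrite linearZr_LR /= rmorphM fmorphV /= rv /q normCK -/d mulrAC [_ * d]mulrC.
have rq : q^* = q.
  by apply/CrealP; rewrite realM ?realX ?normr_real // realV gtr0_real.
have -> : dot w w = dot u u - q.
  rewrite /w dnormB dnormZ hq rq normrM exprMn normfV (ger0_norm (ltW vv)) -/n /q.
  by field; rewrite gt_eqF.
by rewrite subr_ge0 /q ler_pdivrMr.
Qed.

Lemma dot_small u v e : 0 <= e -> dot u u <= e ^+ 2 -> dot v v <= 1 ->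
  `|dot u v| <= e /\ `|dot v u| <= e.
Proof.
move=> e0 ue v1; have h : `|dot u v| <= e.
  rewrite -ler_sqr ?nnegrE //; apply: le_trans (cauchy_schwarz u v) _.
  by rewrite -[leRHS]mulr1; apply: ler_pM => //; exact: dnorm_ge0.
split=> //; suff -> : dot v u = (dot u v)^* by rewrite norm_conjC.
by rewrite hermC /= expr0 mul1r.
Qed.

Lemma dnormD_le u v : dot (u + v) (u + v) <= 2 * dot u u + 2 * dot v v.
Proof.
rewrite -subr_ge0; have : 0 <= dot (u - v) (u - v) by exact: dnorm_ge0.
congr (0 <= _); rewrite dnormB dnormD; ring.
Qed.

Lemma dnorm_sum_le (J : eqType) (s : seq J) (w : J -> V) (e : C) :
  (forall j, j \in s -> dot (w j) (w j) <= e) -> 0 <= e ->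
  dot (\sum_(j <- s) w j) (\sum_(j <- s) w j) <= 4 ^+ size s * e.
Proof.
move=> + e0; elim: s => [|j s IH] we; first by rewrite big_nil linear0l mul1r.
have {}IH := IH (fun i is_ => we i (mem_behead (s := j :: s) is_)).
have {}we := we j (mem_head _ _).
rewrite big_cons /=; apply: le_trans (dnormD_le _ _) _.
have le1 : e <= 4 ^+ size s * e.
  by rewrite ler_peMl // exprn_ege1 // ler1n.
have -> : 4 ^+ (size s).+1 * e = 2 * (4 ^+ size s * e) + 2 * (4 ^+ size s * e).
  by rewrite exprS; ring.
by apply: lerD; rewrite ler_pM2l ?ltr0n //; apply: le_trans le1.
Qed.

End CauchySchwarz.

Section RegularRepresentation.
Context (R : realType) (G : groupType).
Local Notation C := R[i].
Local Notation V := (l2 R G).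
Local Notation dot := (@l2_dot R G).
Implicit Types (u v w : V) (g h k x y z : G) (A B E : V -> V) (F S : {fset G}).

Definition left_translation g u : V := l2_comp (fun x => (g^-1 * x)%g) u.
Definition right_translation g u : V := l2_comp (fun x => (x * g)%g) u.
Definition conjugation g u : V := l2_comp (fun x => (g^-1 * x * g)%g) u.

Local Notation L := left_translation.
Local Notation T := right_translation.
Local Notation Ad := conjugation.
Local Notation d1 := (delta R (1%g : G)).

Lemma coefL g u x : coef (L g u) x = coef u (g^-1 * x)%g.
Proof. by apply: (@coef_l2_comp _ _ _ (fun x => g * x)%g) => y; rewrite !gsimp. Qed.

Lemma coefT g u x : coef (T g u) x = coef u (x * g)%g.
Proof. by apply: (@coef_l2_comp _ _ _ (fun x => x * g^-1)%g) => y; rewrite !gsimp. Qed.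

Lemma coefAd g u x : coef (Ad g u) x = coef u (g^-1 * x * g)%g.
Proof.
by apply: (@coef_l2_comp _ _ _ (fun x => g * x * g^-1)%g) => y; rewrite !gsimp.
Qed.

Lemma L_dot g u v : dot (L g u) (L g v) = dot u v.
Proof.
by apply: (@l2_comp_dot _ _ _ (fun x => g * x)%g) => y; rewrite !gsimp.
Qed.

Lemma T_dot g u v : dot (T g u) (T g v) = dot u v.
Proof.
by apply: (@l2_comp_dot _ _ _ (fun x => x * g^-1)%g) => y; rewrite !gsimp.
Qed.

Lemma Ad_dot g u v : dot (Ad g u) (Ad g v) = dot u v.
Proof.
by apply: (@l2_comp_dot _ _ _ (fun x => g * x * g^-1)%g) => y; rewrite !gsimp.
Qed.

Lemma L_linear g : linear (L g).
Proof. by move=> a u v; apply: l2P => x; rewrite !(coefL, coefD, coefZ). Qed.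

Lemma T_linear g : linear (T g).
Proof. by move=> a u v; apply: l2P => x; rewrite !(coefT, coefD, coefZ). Qed.

Lemma LM g h u : L (g * h)%g u = L g (L h u).
Proof. by apply: l2P => x; rewrite !coefL !gsimp. Qed.

Lemma LVK g : cancel (L g^-1%g) (L g).
Proof. by move=> u; apply: l2P => x; rewrite !coefL !gsimp. Qed.

Lemma LT g h u : L g (T h u) = T h (L g u).
Proof. by apply: l2P => x; rewrite !(coefL, coefT) !gsimp. Qed.

Lemma AdE g u : Ad g u = L g (T g u).
Proof. by apply: l2P => x; rewrite !(coefL, coefT, coefAd). Qed.

Lemma L_delta g x : L g (delta R x) = delta R (g * x)%g.
Proof.
apply: l2P => y; rewrite coefL !coef_delta; congr (nat_of_bool _)%:R.
by apply/eqP/eqP => [<-|->]; rewrite !gsimp.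
Qed.

Lemma T_delta g x : T g (delta R x) = delta R (x * g^-1)%g.
Proof.
apply: l2P => y; rewrite coefT !coef_delta; congr (nat_of_bool _)%:R.
by apply/eqP/eqP => [<-|->]; rewrite !gsimp.
Qed.

(** The operators commuting with the right translations form the von Neumann
    algebra of the left regular representation. Such an operator A is the
    convolution by its value A d1, so that all computations can be made with
    these vectors; A' is its adjoint. *)
Definition adjoint_convolvers A A' : Prop :=
  [/\ forall u v, dot (A u) v = dot u (A' v),
      forall g u, A (T g u) = T g (A u) & forall g u, A' (T g u) = T g (A' u)].

Local Notation conv := adjoint_convolvers.

Lemma convV A A' : conv A A' -> conv A' A.
Proof. by case=> h hT hT'; split=> // u v; rewrite l2_dotC -h -l2_dotC. Qed.

Lemma convM A A' B B' : conv A A' -> conv B B' -> conv (A \o B) (B' \o A').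
Proof.
move=> [hA TA TA'] [hB TB TB']; split=> [u v|g u|g u] /=.
- by rewrite hA hB.
- by rewrite TB TA.
- by rewrite TA' TB'.
Qed.

Lemma convL g : conv (L g) (L g^-1%g).
Proof.
split=> [u v|h u|h u]; rewrite ?LT //.
by rewrite -{1}[v](LVK g) L_dot.
Qed.

Lemma convP a A A' B B' : conv A A' -> conv B B' ->
  conv (fun u => a *: A u + B u) (fun u => a^* *: A' u + B' u).
Proof.
move=> [hA TA TA'] [hB TB TB']; split=> [u v|g u|g u].
- by rewrite linearPl linearDr linearZr_LR /= conjCK hA hB.
- by rewrite TA TB T_linear.
- by rewrite TA' TB' T_linear.
Qed.

Lemma conv0 : conv (fun=> 0) (fun=> 0).
Proof.
split=> [u v|g u|g u]; first by rewrite linear0l linear0r.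
  by apply: l2P => x; rewrite coefT !coef0.
by apply: l2P => x; rewrite coefT !coef0.
Qed.

(** The adjoint of the convolution by u is the convolution by the conjugate of u
    composed with the inversion of the group. *)
Lemma coef_conv_adj A A' x : conv A A' ->
  coef (A' d1) x = (coef (A d1) x^-1%g)^*.
Proof.
move=> [hA TA _]; rewrite -l2_dot_delta l2_dotC; congr (_^*).
rewrite -hA -l2_dot_delta -[RHS](T_dot x^-1%g).
by rewrite -TA !T_delta !gsimp.
Qed.

Lemma conv_dotC A A' B B' : conv A A' -> conv B B' ->
  dot (B d1) (A' d1) = dot (A d1) (B' d1).
Proof.
move=> cA cB; apply: l2_dotE.
have := has_sum_reindex (@invgK G) (@invgK G) (l2_dotP (A d1) (B' d1)).
congr has_sum; apply/funext => x /=.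
by rewrite (coef_conv_adj _ cA) (coef_conv_adj _ cB) invgK !conjCK mulrC.
Qed.

Definition trace A : C := dot (A d1) d1.

(** The vector state at d1 is a trace because inversion permutes the basis of
    the space. *)
Lemma traceC A A' B B' : conv A A' -> conv B B' ->
  trace (A \o B) = trace (B \o A).
Proof.
move=> cA cB; have [hA _ _] := cA; have [hB _ _] := cB.
by rewrite /trace /= hA (hB (A d1)); exact: conv_dotC cA cB.
Qed.

Lemma conv_adj_norm A A' : conv A A' -> dot (A' d1) (A' d1) = dot (A d1) (A d1).
Proof. by move=> cA; exact: (conv_dotC cA (convV cA)). Qed.

Lemma conv_conjugate A A' g : conv A A' ->
  L g (A (L g^-1%g d1)) = Ad g (A d1).
Proof.
by case=> _ TA _; rewrite AdE -TA; congr (L _ (A _)); rewrite L_delta T_delta !gsimp.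
Qed.

Let sum_conv (s : seq G) (c : G -> C) :
  { D : (V -> V) * (V -> V) | conv D.1 D.2 /\ D.1 d1 = \sum_(x <- s) c x *: delta R x }.
Proof.
elim: s => [|x s [[D D'] /= [cD DE]]].
  by exists (fun=> 0, fun=> 0); split; [exact: conv0|rewrite big_nil].
exists (fun u => c x *: L x u + D u, fun u => (c x)^* *: L x^-1%g u + D' u).
split=> /=; first exact: convP (convL x) cD.
by rewrite big_cons DE L_delta mulg1.
Qed.

Lemma restrict_fset F u (P : set G) :
  restrict ([set` F] `&` P) u = \sum_(x <- [seq x <- F | `[< P x >]]) coef u x *: delta R x.
Proof.
apply: l2P => y.
have -> : coef (\sum_(x <- [seq x <- F | `[< P x >]]) coef u x *: delta R x) y =
    \sum_(x <- [seq x <- F | `[< P x >]]) coef u x * (y == x)%:R.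
  elim: [seq x <- _ | _] => [|x s IH]; first by rewrite !big_nil coef0.
  by rewrite !big_cons coefD coefZ coef_delta IH.
rewrite coef_restrict; case: asboolP => [[yF Py]|n].
  have us : uniq [seq x <- F | `[< P x >]] by rewrite filter_uniq // fset_uniq.
  rewrite (bigD1_seq y) //= ?mem_filter ?(asboolT Py) //.
  rewrite eqxx mulr1 big1 ?addr0 // => x /negbTE xy.
  by rewrite eq_sym xy mulr0.
rewrite big1_seq // => x /=; rewrite mem_filter => /andP[/asboolP Px xF].
by case: eqP => [yx|]; rewrite ?mulr0 //; exfalso; apply: n; rewrite yx.
Qed.

Definition generic_for S g : Prop :=
  (forall x, x \in S -> fc_center x -> commute g x) /\
  (forall x y, x \in S -> y \in S -> ~ fc_center x -> (g * x * g^-1)%g <> y).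

(** Conjugation by a generic g fixes the FC part of S pointwise and moves the rest
    of S off S. Weakly on S, Ad g thus acts as the projection to the
    FC-centre. *)
Lemma mixing S g u v e : generic_for S g -> 0 <= e ->
  dot u u <= 1 -> dot v v <= 1 ->
  dot (u - restrict [set` S] u) (u - restrict [set` S] u) <= e ^+ 2 ->
  dot (v - restrict [set` S] v) (v - restrict [set` S] v) <= e ^+ 2 ->
  `|dot (Ad g u) v - dot (restrict ([set` S] `&` @fc_center G) u) v| <= e + e.
Proof.
move=> [gc gn] e0 u1 v1 ue ve; pose P : V -> V := restrict [set` S].
have -> : restrict ([set` S] `&` @fc_center G) u = P (Ad g (P u)).
  apply: l2P => x; rewrite !coef_restrict coefAd coef_restrict.
  case: asboolP => [[xS fx]|nx]; last first.
    case: asboolP => // xS; case: asboolP => // yS; exfalso.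
    have nfx : ~ fc_center x by move=> fx; apply: nx.
    have nfy : ~ fc_center (g^-1 * x * g)%g.
      by move=> /(@fc_center_conj _ _ g); rewrite !gsimp.
    by apply: (gn _ _ yS xS nfy); rewrite !gsimp.
  rewrite (asboolT xS).
  have -> : (g^-1 * x * g)%g = x by rewrite -mulgA -(gc x xS fx) !gsimp.
  by rewrite (asboolT xS).
rewrite restrict_dot.
have -> : dot (Ad g u) v - dot (Ad g (P u)) (P v) =
    dot (Ad g (u - P u)) v + dot (Ad g (P u)) (v - P v).
  have -> : Ad g (u - P u) = Ad g u - Ad g (P u).
    by apply: l2P => x; rewrite !(coefB, coefAd).
  by rewrite linearBl linearBr /=; ring.
apply: le_trans (ler_normD _ _) _; apply: lerD.
  by apply: (dot_small (dot := @l2_form R G) e0 _ v1).1 => /=; rewrite Ad_dot.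
apply: (dot_small (dot := @l2_form R G) e0 ve _).2 => /=; rewrite Ad_dot.
apply: le_trans u1; rewrite -[X in _ <= l2_dot X X]restrictT.
exact: restrict_le.
Qed.

Section AbelianProjection.
Variable E : V -> V.
Hypotheses (Ecv : conv E E) (EE : forall u, E (E u) = E u)
  (Eab : forall g h u, E (L g (E (L h (E u)))) = E (L h (E (L g (E u)))))
  (nfc : ~ finite_index (@fc_center G)).

Let xi := E d1.
Let tau : C := coef xi 1%g.

Let contr u : dot (E u) (E u) <= dot u u.
Proof.
have [hE _ _] := Ecv.
rewrite -subr_ge0; have : 0 <= dot (u - E u) (u - E u).
  exact: (dnorm_ge0 (@l2_form R G)).
have e1 : dot (E u) u = dot (E u) (E u) by rewrite -{1}EE hE.
have e2 : dot u (E u) = dot (E u) (E u) by rewrite -hE.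
congr (0 <= _); rewrite linearBl !linearBr /= e1 e2.
by ring.
Qed.

Let contrL g u : dot (E (L g u)) (E (L g u)) <= dot u u.
Proof. by apply: le_trans (contr _) _; rewrite L_dot. Qed.

Let d1_norm : dot d1 d1 = 1.
Proof. by rewrite l2_dot_delta coef_delta eqxx. Qed.

Let xi1 : dot xi xi <= 1.
Proof. by rewrite -d1_norm; exact: contr. Qed.

Let tau_xi : tau = dot xi xi.
Proof.
by have [hE _ _] := Ecv; rewrite /tau -l2_dot_delta -{1}[xi]EE hE.
Qed.

(** The operator L g o (E L h E) o L g^-1 takes d1 to Ad g (E (L h xi)). Moving
    the outer factors to the other side of the scalar product leaves a product
    in which E L g E and E L h E, which commute, can be exchanged. *)
Let exchange g h : dot (Ad g (E (L h xi))) (E (L h xi)) =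
  dot (Ad g xi) (E (L h^-1%g (E (L h xi)))).
Proof.
have cB : conv (E \o L h \o E) (E \o (L h^-1%g \o E)).
  exact: convM (convM Ecv (convL h)) Ecv.
have cG : conv (E \o L h^-1%g \o E \o L h \o E)
    (E \o (L h^-1%g \o (E \o (L h^-1^-1%g \o E)))).
  exact: convM (convM (convM (convM Ecv (convL h^-1%g)) Ecv) (convL h)) Ecv.
have [hB _ _] := convV cB; have [hG _ _] := cG.
have := conv_conjugate g cB; have := conv_conjugate g Ecv; rewrite /= => <- <-.
have -> : dot (L g (E (L h (E (L g^-1%g d1))))) (E (L h xi)) =
    dot (E (L h^-1%g (E (L g (E (L h (E (L g^-1%g d1)))))))) d1.
  exact/esym/hB.
have := hG (L g (E (L g^-1%g d1))) d1; rewrite /= !invgK => <-.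
by rewrite (Eab g h).
Qed.

Let conv_linear A A' : conv A A' -> linear A.
Proof.
move=> [hA _ _] a u v; apply: l2P => x.
rewrite coefD coefZ -!l2_dot_delta !hA.
by rewrite linearDl linearZl_LR.
Qed.

Let restrict_linear (P : set G) : linear (restrict P : V -> V).
Proof.
move=> a u v; apply: l2P => x; rewrite !(coef_restrict, coefD, coefZ).
by case: asboolP => // _; rewrite mulr0 addr0.
Qed.

Let linear_sum_ext (M : V -> V) (s : seq G) (w : G -> V) : linear M ->
  M (\sum_(x <- s) w x) = \sum_(x <- s) M (w x).
Proof.
move=> lM; have MD u v : M (u + v) = M u + M v by have := lM 1 u v; rewrite !scale1r.
have M0 : M 0 = 0 by apply: (addrI (M 0)); rewrite -MD !addr0.
by elim: s => [|x s IH]; rewrite ?big_nil ?M0 // !big_cons MD IH.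
Qed.

Let restrict_norm (P : set G) u : dot (restrict P u) (restrict P u) <= dot u u.
Proof. by rewrite -[X in _ <= l2_dot X X]restrictT; exact: restrict_le. Qed.

(** Up to a small error xi is a finite sum of multiples of vectors delta x, and
    E (L k^-1 (delta x)) is a right translate of xi. Its part on the FC-centre is
    a translate of the part of xi on a coset of the FC-centre; when k avoids
    finitely many cosets, this coset misses the finite set F' that carries most
    of xi. The factor 4 ^+ size F pays for the number of terms. *)
Let escape (e : C) F : 0 < e ->
  dot (xi - restrict [set` F] xi) (xi - restrict [set` F] xi) <= e ^+ 2 ->
  exists S : seq G, forall k,
  (forall t, t \in S -> ~ fc_center (t^-1 * k)%g) ->
  dot (restrict (@fc_center G) (E (L k^-1%g xi)))
      (restrict (@fc_center G) (E (L k^-1%g xi))) <= 2 * e ^+ 2 + 2 * e.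
Proof.
move=> e0 hF; pose e' := e / 4 ^+ size F.
have p4 : 0 < (4 : C) ^+ size F by rewrite exprn_gt0 ?ltr0n.
have e'0 : 0 < e' by rewrite divr_gt0.
have [F' hF'] := l2_tail xi e'0.
exists [seq (s * f)%g | s <- F, f <- F'] => k hk.
pose M u := restrict (@fc_center G) (E (L k^-1%g u)).
have lM : linear M.
  by move=> a u v; rewrite /M L_linear (conv_linear Ecv) restrict_linear.
rewrite -/(M xi); have -> : M xi = M (xi - restrict [set` F] xi) + M (restrict [set` F] xi).
  have := lM 1 (xi - restrict [set` F] xi) (restrict [set` F] xi).
  by rewrite !scale1r subrK.
apply: le_trans (dnormD_le (@l2_form R G) _ _) _ => /=.
apply: lerD; rewrite ler_pM2l ?ltr0n //.
  apply: le_trans hF; apply: le_trans (restrict_norm _ _) _; exact: contrL.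
have -> : restrict [set` F] xi = \sum_(x <- F) coef xi x *: delta R x.
  have -> : [set` F] = [set` F] `&` setT by rewrite setIT.
  rewrite restrict_fset; congr bigop.body; apply/all_filterP/allP => x _.
  exact/asboolP.
rewrite (linear_sum_ext _ _ lM).
have -> : e = 4 ^+ size F * e' by rewrite /e' mulrC divfK // gt_eqF.
apply: (@dnorm_sum_le _ _ (@l2_form R G)); last exact: ltW.
move=> x xF /=.
have -> : M (coef xi x *: delta R x) = coef xi x *: M (delta R x).
  have M0 : M 0 = 0.
    by have := lM 1 0 0; rewrite !scale1r !addr0 => M00; apply: (addrI (M 0)); rewrite -M00 addr0.
  by have := lM (coef xi x) (delta R x) 0; rewrite M0 !addr0.
rewrite -/(l2_form R G) dnormZ.
apply: (@le_trans _ _ (dot (M (delta R x)) (M (delta R x)))).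
  rewrite -[leRHS]mul1r; apply: ler_wpM2r; first exact: (dnorm_ge0 (@l2_form R G)).
  exact: le_trans (l2_coef_le _ _) xi1.
pose y := (k^-1 * x)%g; pose P : set G := [set z | fc_center (z * y)%g].
have -> : M (delta R x) = T y^-1%g (xi - restrict (~` P) xi).
  have -> : M (delta R x) = restrict (@fc_center G) (T y^-1%g xi).
    have [_ TE _] := Ecv.
    by rewrite /M L_delta -TE T_delta invgK mul1g.
  apply: l2P => z; rewrite !(coef_restrict, coefT, coefB) asbool_neg /P /= !gsimp.
  by case: asboolP => _ /=; rewrite ?subr0 ?subrr.
rewrite T_dot; apply: hF' => f /= fF' /=; rewrite /P /y /= => fy.
apply: (hk (x * f)%g); first exact: allpairs_f.
have [_ _ FV] := fc_center_subgroup G.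
have := fc_center_conj f^-1%g (FV _ fy).
by rewrite !gsimp.
Qed.

Let truncation_close F S (e : C) : (F `<=` S)%fset ->
  dot (xi - restrict [set` F] xi) (xi - restrict [set` F] xi) <= e ^+ 2 ->
  let d := restrict ([set` S] `&` @fc_center G) xi -
           restrict ([set` F] `&` @fc_center G) xi in dot d d <= e ^+ 2.
Proof.
move=> FS hF; rewrite /=; apply: le_trans hF; set d := _ - _.
have -> : d = restrict ([set` S] `&` @fc_center G) (xi - restrict [set` F] xi).
  apply: l2P => x; rewrite /d !(coef_restrict, coefB).
  case: asboolP => [[xS fx]|nx].
    case: asboolP => [[xF _]|nxF]; first by rewrite asboolT.
    by rewrite asboolF // => xF; apply: nxF.
  rewrite asboolF ?subrr // => -[xF fx]; apply: nx; split=> //.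
  exact: (fsubsetP FS).
exact: restrict_norm.
Qed.

Let restrict_sq (P : set G) u :
  dot (restrict P u) u = dot (restrict P u) (restrict P u).
Proof.
rewrite -restrict_dot; congr (l2_dot _ _); apply: l2P => x.
by rewrite !coef_restrict; case: asboolP.
Qed.

Let norm_split (x y p q : C) : `|x - y| <= p -> `|y| <= q -> `|x| <= p + q.
Proof.
move=> hp hq; rewrite -[x](subrK y); apply: le_trans (ler_normD _ _) _.
exact: lerD.
Qed.

(** Let zeta = D d1 be the part of xi on finitely many elements of the FC-centre,
    k a generic element, h = k^-1, b = E (L h xi), c = E (L h^-1 b), and let g be
    generic with respect to b, c and xi. All the approximations being up to
    multiples of e,
    - dot (Ad g b) b = dot (Ad g xi) c by the exchange of g and h;
    - by mixing in g the left side is the squared norm of b on the FC-centre,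
      which is small because k escapes, and the right side is dot zeta c;
    - by the trace property dot zeta c = dot eta (Ad k xi), with eta = E D E d1,
      and by mixing in k this is dot eta zeta, the squared norm of eta.
    On the other hand the squared norm of eta is at least the square of
    dot eta d1 = dot zeta zeta, hence at least tau ^+ 4, where tau is the
    coefficient of xi at 1, which belongs to the FC-centre. *)
Let estimate (e : C) : 0 < e -> e <= 1 -> tau ^+ 4 <= 12 * e.
Proof.
move=> e0 e1; have [hE _ _] := Ecv.
have e20 : 0 < e ^+ 2 by rewrite exprn_gt0.
have [Fx hFx] := l2_tail xi e20.
pose F := (1%g |` Fx)%fset.
have hF S : (F `<=` S)%fset ->
    dot (xi - restrict [set` S] xi) (xi - restrict [set` S] xi) <= e ^+ 2.
  move=> FS; apply: hFx => x /= xF; apply: (fsubsetP FS).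
  by rewrite !inE xF orbT.
pose zeta := restrict ([set` F] `&` @fc_center G) xi.
have [[D D'] /= [cD Dd]] :=
  sum_conv [seq x <- F | `[< fc_center x >]] (coef xi).
have {}Dd : D d1 = zeta by rewrite Dd /zeta restrict_fset.
have [hD _ _] := cD.
pose eta := E (D (E d1)).
have zeta1 : dot zeta zeta <= 1 by apply: le_trans xi1; exact: restrict_norm.
have eta1 : dot eta eta <= 1.
  apply: le_trans (contr _) _.
  have := conv_adj_norm (convM cD Ecv) => /= <-.
  apply: le_trans (contr _) _; rewrite (conv_adj_norm cD) Dd.
  exact: zeta1.
have [hD' _ _] := convV cD.
have eta_zeta : dot eta zeta = dot eta eta.
  have cX := convM (convM (convM (convV cD) Ecv) cD) Ecv.
  have := traceC Ecv cX; rewrite /trace /= EE hE => t.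
  by rewrite -Dd -hD' -/eta -t -/eta -/xi hD' -hE EE.
have zz : dot zeta zeta = dot zeta xi by rewrite -restrict_sq.
have eta_d1 : dot eta d1 = dot zeta zeta.
  have := traceC Ecv (convM cD Ecv); rewrite /trace /= EE => ->.
  by have := traceC cD Ecv; rewrite /trace /= => ->; rewrite Dd hE zz.
have tau4 : tau ^+ 4 <= `|dot eta zeta|.
  rewrite eta_zeta ger0_norm; last exact: (dnorm_ge0 (@l2_form R G)).
  have tau0 : 0 <= tau by rewrite tau_xi; exact: (dnorm_ge0 (@l2_form R G)).
  have z0 : 0 <= dot zeta zeta by exact: (dnorm_ge0 (@l2_form R G)).
  have tz : tau ^+ 2 <= dot zeta zeta.
    have := l2_coef_le zeta 1%g; rewrite coef_restrict asboolT ?ger0_norm //.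
    split; first by rewrite /= !inE eqxx.
    by have [] := fc_center_subgroup G.
  have := cauchy_schwarz (@l2_form R G) eta d1.
  rewrite /= d1_norm mulr1 eta_d1 ger0_norm //; apply: le_trans.
  have -> : tau ^+ 4 = (tau ^+ 2) ^+ 2 by rewrite -exprM.
  by rewrite ler_sqr ?nnegrE ?exprn_ge0.
have [Fe hFe] := l2_tail eta e20.
pose S1 := (F `|` Fe)%fset.
have [Tl hT] := escape e0 (hF F (fsubset_refl F)).
have [k [kc kn kT]] := generic_element S1 Tl nfc.
have {}kT := hT k kT.
have [h hk] : exists h, h = k^-1%g by exists k^-1%g.
rewrite -hk in kT.
pose b := E (L h xi); pose c := E (L h^-1%g (E (L h xi))).
have b1 : dot b b <= 1 by apply: le_trans xi1; exact: contrL.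
have c1 : dot c c <= 1 by apply: le_trans (contrL _ _) _.
have [Fb hFb] := l2_tail b e20; have [Fc hFc] := l2_tail c e20.
pose S2 := (F `|` (Fb `|` Fc))%fset.
have [g [gc gn _]] := generic_element S2 [::] nfc.
have close S v : (F `<=` S)%fset -> dot v v <= 1 ->
    `|dot (restrict ([set` S] `&` @fc_center G) xi) v - dot zeta v| <= e.
  move=> FS v1; rewrite -linearBl.
  apply: (dot_small (dot := @l2_form R G) (ltW e0) _ v1).1.
  exact: truncation_close (hF F (fsubset_refl F)).
have zeta_c : dot zeta c = dot eta (Ad k xi).
  have cG : conv (E \o L h^-1%g \o E \o L h \o E)
      (E \o (L h^-1%g \o (E \o (L h^-1^-1%g \o E)))).
    exact: convM (convM (convM (convM Ecv (convL h^-1%g)) Ecv) (convL h)) Ecv.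
  have [hG _ _] := cG.
  have cY := convM (convM (convM (convM (convL h^-1%g) Ecv) (convL h)) Ecv) cD.
  have := hG zeta d1; rewrite /= invgK -/xi -/c => <-.
  have := traceC Ecv cY; rewrite /trace /= Dd => ->.
  have [hQ _ _] := convM (convM (convL h^-1%g) Ecv) (convL h).
  have := hQ eta d1; rewrite /= => ->; congr (l2_dot _ _).
  have := conv_conjugate k Ecv; rewrite /= => <-.
  by rewrite hk !invgK.
have sub2 S S' : (S `<=` S')%fset -> [set` S] `<=` [set` S'].
  by move=> /fsubsetP SS' x /=; exact: SS'.
have FS1 : (F `<=` S1)%fset := fsubsetUl _ _.
have FS2 : (F `<=` S2)%fset := fsubsetUl _ _.
have S2b : (Fb `<=` S2)%fset by rewrite fsubsetU // fsubsetUl orbT.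
have S2c : (Fc `<=` S2)%fset by rewrite fsubsetU // fsubsetUr orbT.
have gS2 : generic_for S2 g by [].
have bound_b : `|dot (Ad g b) b| <= (e + e) + (2 * e ^+ 2 + 2 * e).
  apply: norm_split (mixing gS2 (ltW e0) b1 b1 _ _) _; try exact: hFb (sub2 _ _ S2b).
  rewrite restrict_sq ger0_norm; last exact: (dnorm_ge0 (@l2_form R G)).
  by apply: le_trans kT; apply: restrict_le => x [].
have bound_c : `|dot zeta c| <= e + ((e + e) + ((e + e) + (2 * e ^+ 2 + 2 * e))).
  apply: (@norm_split _ (dot (restrict ([set` S2] `&` @fc_center G) xi) c)).
    by rewrite distrC; exact: close.
  apply: (@norm_split _ (dot (Ad g xi) c)); last by rewrite -exchange.
  rewrite distrC; apply: mixing gS2 (ltW e0) xi1 c1 (hF _ FS2) _.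
  exact: hFc (sub2 _ _ S2c).
apply: le_trans tau4 _; rewrite l2_dotC norm_conjC.
have -> : 12 * e = e + ((e + e) + (e + ((e + e) + ((e + e) + (2 * e + 2 * e))))).
  by ring.
apply: (@norm_split _ (dot (restrict ([set` S1] `&` @fc_center G) xi) eta)).
  by rewrite distrC; exact: close.
apply: (@norm_split _ (dot (Ad k xi) eta)).
  rewrite distrC; apply: (@mixing S1) => //; [exact: ltW|exact: hF|].
  by apply: hFe; apply: sub2; exact: fsubsetUr.
rewrite l2_dotC norm_conjC -zeta_c; apply: le_trans bound_c _.
do 3!(rewrite lerD2l); rewrite lerD2r ler_pM2l ?ltr0n //.
by rewrite -[leRHS]mulr1 expr2 ler_pM2l.
Qed.

Lemma abelian_projection_delta : E d1 = 0.
Proof.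
apply/eqP; rewrite -(dnorm_eq0 (@l2_form R G)) /= -/xi -tau_xi.
apply/negPn/negP => tau0.
have {}tau0 : 0 < tau.
  by rewrite lt_def tau0 tau_xi; exact: (dnorm_ge0 (@l2_form R G)).
have p0 : 0 < tau ^+ 4 by rewrite exprn_gt0.
have := @estimate (tau ^+ 4 / 24); rewrite divr_gt0 ?ltr0n // => /(_ isT).
rewrite ler_pdivrMr ?ltr0n // mul1r.
have -> : tau ^+ 4 <= 24.
  apply: (@le_trans _ _ 1); last by rewrite ler1n.
  by rewrite exprn_ile1 ?(ltW tau0) // tau_xi.
move=> /(_ isT); have -> : 12 * (tau ^+ 4 / 24) = tau ^+ 4 / 2 by field.
apply/negP; rewrite -real_ltNge ?gtr0_real ?divr_gt0 ?ltr0n //.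
by rewrite ltr_pdivrMr ?ltr0n // mulr_natr mulr2n ltrDl.
Qed.

End AbelianProjection.

End RegularRepresentation.

(** * Type I groups have an FC-centre of finite index *)

Section SubgroupAsGroup.
Context (G : groupType) (H : set G) (sH : subgroup H).

(** The proof sH is a parameter so that the group structure can be found from
    the type alone. *)
Definition subgroup_type of subgroup H := {x : G | `[< H x >]}.
Local Notation K := (subgroup_type sH).

HB.instance Definition _ := Choice.on K.

Implicit Types a b c : K.

Definition in_subgroup x (Hx : H x) : K := exist _ x (asboolT Hx).

Let sval_in a : H (sval a). Proof. exact/asboolP/(svalP a). Qed.

Let sval_inj a b : sval a = sval b -> a = b.
Proof. by case: a b => [x px] [y py] /= xy; exact: eq_exist. Qed.

Let subM a b : K.
Proof. by apply: (@in_subgroup (sval a * sval b)%g); case: sH => _ + _; apply. Defined.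
Let subV a : K.
Proof. by apply: (@in_subgroup (sval a)^-1%g); case: sH => _ _; apply. Defined.
Let sub1 : K.
Proof. by apply: (@in_subgroup 1%g); case: sH. Defined.

Let subMA : associative subM.
Proof. by move=> a b c; apply: sval_inj; rewrite /= mulgA. Qed.
Let sub1M : left_id sub1 subM.
Proof. by move=> a; apply: sval_inj; rewrite /= mul1g. Qed.
Let subM1 : right_id sub1 subM.
Proof. by move=> a; apply: sval_inj; rewrite /= mulg1. Qed.
Let subVM : left_inverse sub1 subV subM.
Proof. by move=> a; apply: sval_inj; rewrite /= mulVg. Qed.
Let subMV : right_inverse sub1 subV subM.
Proof. by move=> a; apply: sval_inj; rewrite /= mulgV. Qed.

HB.instance Definition _ := isGroup.Build K subMA sub1M subM1 subVM subMV.

Definition subgroup_val a : G := sval a.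

Lemma subgroup_valP a : H (subgroup_val a). Proof. exact: sval_in. Qed.

Lemma subgroup_val_inj : injective subgroup_val. Proof. exact: sval_inj. Qed.

Lemma subgroup_valM a b : subgroup_val (a * b)%g = (subgroup_val a * subgroup_val b)%g.
Proof. by []. Qed.

Lemma subgroup_valV a : subgroup_val a^-1%g = (subgroup_val a)^-1%g.
Proof. by []. Qed.

Lemma subgroup_valK x (Hx : H x) : subgroup_val (in_subgroup Hx) = x.
Proof. by []. Qed.

Lemma in_subgroup_val a (Ha : H (subgroup_val a)) : in_subgroup Ha = a.
Proof. exact: sval_inj. Qed.

Lemma finitely_generated_subgroup_type :
  finitely_generated H -> finitely_generated [set: K].
Proof.
move=> [s [sH' gs]].
pose t := pmap (fun x => if pselect (H x) is left Hx then Some (in_subgroup Hx) else None) s.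
exists t; split=> // L [L1 LM LV] tL a _.
pose L' : set G := [set x | exists Hx : H x, L (in_subgroup Hx)].
have [] : L' (subgroup_val a).
  apply: gs (subgroup_valP a) => [|x xs]; last first.
    have Hx := sH' x xs; exists Hx; apply: tL.
    rewrite mem_pmap; apply/mapP; exists x => //.
    by case: pselect => // Hx'; congr Some; apply: subgroup_val_inj.
  split.
  - have [H1 _ _] := sH; exists H1; suff -> : in_subgroup H1 = 1%g by [].
    exact: subgroup_val_inj.
  - move=> x y [Hx Lx] [Hy Ly]; have [_ HM _] := sH; exists (HM _ _ Hx Hy).
    suff -> : in_subgroup (HM _ _ Hx Hy) = (in_subgroup Hx * in_subgroup Hy)%g.
      exact: LM.
    exact: subgroup_val_inj.
  - move=> x [Hx Lx]; have [_ _ HV] := sH; exists (HV _ Hx).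
    suff -> : in_subgroup (HV _ Hx) = (in_subgroup Hx)^-1%g by exact: LV.
    exact: subgroup_val_inj.
by move=> Ha; rewrite in_subgroup_val.
Qed.

End SubgroupAsGroup.

Section TypeI.
Context (R : realType) (G : groupType) (H : set G) (sH : subgroup H).
Local Notation K := (subgroup_type sH).

(** The regular representation of H generates an algebra with a nonzero abelian
    projection E, by type I applied to its unit. E commutes with the right
    translations, hence vanishes as soon as it kills delta 1. *)
Lemma type_I_fc_center :
  type_I R H -> finite_index (@fc_center K).
Proof.
move=> tI; apply: contrapT => nfc.
pose V := l2 R K.
pose toK (x : G) : K := if pselect (H x) is left Hx then in_subgroup sH Hx else 1%g.
have toKE (a : K) : toK (subgroup_val a) = a.
  rewrite /toK; case: pselect => [Ha|]; last by have := subgroup_valP a.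
  exact: in_subgroup_val.
have toKM x y : H x -> H y -> toK (x * y)%g = (toK x * toK y)%g.
  move=> Hx Hy; rewrite -[x](subgroup_valK sH Hx) -[y](subgroup_valK sH Hy).
  by rewrite -subgroup_valM !toKE.
pose pi x : V -> V := left_translation (toK x).
have rep : unitary_representation (@l2_form R K) H pi.
  split=> [x Hx|x y Hx Hy]; last first.
    by apply/funext => u; rewrite /pi toKM // LM.
  split; first exact: L_linear.
    apply/seteqP; split=> // u _; exists (left_translation (toK x)^-1%g u) => //.
    exact: LVK.
  by move=> u v; exact: L_dot.
pose M := commutant (@l2_form R K) (commutant (@l2_form R K) (pi @` H)).
have bL (g : K) : bounded_operator (@l2_form R K) (left_translation g).
  split; first exact: L_linear.
  by exists 1 => u; rewrite mul1r /= L_dot.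
have bT (g : K) : bounded_operator (@l2_form R K) (right_translation g).
  split; first exact: T_linear.
  by exists 1 => u; rewrite mul1r /= T_dot.
have b1 : bounded_operator (@l2_form R K) id.
  by split=> //; exists 1 => u; rewrite mul1r.
have ML (g : K) : M (left_translation g).
  split=> // B [_ cB]; apply/esym/cB; exists (subgroup_val g) => //.
    exact: subgroup_valP.
  by rewrite /pi toKE.
have d1 : delta R (1%g : K) != 0.
  apply/eqP => d0; have := coef_delta R (1%g : K) 1%g.
  by rewrite d0 coef0 eqxx => /esym/eqP; rewrite oner_eq0.
have [||E [[ME [[lE bE] EE hE] abE] E0 _]] := tI V (@l2_form R K) pi (@l2_complete R K) rep id.
- by split=> //; split=> // B [_ cB].
- by move=> /(congr1 (fun A => A (delta R (1%g : K)))) /eqP; apply/negP.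
have TE g u : E (right_translation g u) = right_translation g (E u).
  have [_ cE] := ME; have cT : commutant (@l2_form R K) (pi @` H) (right_translation g).
    by split=> // _ [x Hx <-]; apply/funext => w; rewrite /= /pi LT.
  exact: (congr1 (fun A => A u) (cE _ cT)).
have EE' u : E (E u) = E u by exact: (congr1 (fun A => A u) EE).
have Ed : E (delta R (1%g : K)) = 0.
  apply: (abelian_projection_delta (E := E)) nfc => // g h u.
  have := congr1 (fun A => A u) (abE _ _ (ML g) (ML h)).
  by rewrite /= !EE'.
apply: E0; apply/funext => u; apply: l2P => x; rewrite coef0 -l2_dot_delta.
rewrite -/(l2_form R K) [LHS]hE.
have -> : delta R x = right_translation x^-1%g (delta R 1%g).
  by rewrite T_delta invgK mul1g.
rewrite TE Ed.
have -> : right_translation x^-1%g (0 : V) = 0.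
  by apply: l2P => y; rewrite coefT !coef0.
by rewrite linear0r.
Qed.

End TypeI.

(** * Twisted conjugacy in virtually abelian groups *)

Section TwistedConjugacy.
Context (G : groupType).
Implicit Types (A B K N : set G) (g x y z : G) (phi : G -> G).
Local Open Scope group_scope.

Definition morphic (K : groupType) (phi : G -> K) : Prop :=
  forall x y, phi (x * y) = phi x * phi y.

Definition twisted_conjugate phi x y : Prop := exists z, y = z * x * (phi z)^-1.

(** The length of such a sequence is the number of twisted conjugacy classes; the
    existence of one says that this number is finite. *)
Definition twisted_transversal phi (s : seq G) : Prop :=
  [/\ uniq s, forall x y, x \in s -> y \in s -> twisted_conjugate phi x y -> x = y
    & forall y, exists2 x, x \in s & twisted_conjugate phi x y].

Lemma morphic1 (K : groupType) (phi : G -> K) : morphic phi -> phi 1 = 1.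
Proof.
by move=> phiM; apply: (mulgI (phi 1)); rewrite -phiM !mulg1.
Qed.

Lemma morphicV (K : groupType) (phi : G -> K) x :
  morphic phi -> phi x^-1 = (phi x)^-1.
Proof.
move=> phiM; apply: (mulgI (phi x)).
by rewrite -phiM !mulgV morphic1.
Qed.

Lemma morphicX (K : groupType) (phi : G -> K) x n :
  morphic phi -> phi (x ^+ n) = phi x ^+ n.
Proof.
move=> phiM; elim: n => [|n IH]; first by rewrite !expg0 morphic1.
by rewrite !expgS phiM IH.
Qed.

Lemma morphic_iter phi n : morphic phi -> morphic (iter n phi).
Proof. by move=> phiM; elim: n => [//|n IH] x y; rewrite !iterS IH phiM. Qed.

Lemma twisted_conjugate_refl phi x : morphic phi -> twisted_conjugate phi x x.
Proof. by move=> phiM; exists 1; rewrite (morphic1 phiM) invg1 mulg1 mul1g. Qed.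

Lemma twisted_conjugate_sym phi x y : morphic phi ->
  twisted_conjugate phi x y -> twisted_conjugate phi y x.
Proof.
by move=> phiM [z ->]; exists z^-1; rewrite (morphicV _ phiM) !gsimp.
Qed.

Lemma twisted_conjugate_trans phi x y z : morphic phi ->
  twisted_conjugate phi x y -> twisted_conjugate phi y z -> twisted_conjugate phi x z.
Proof.
by move=> phiM [a ->] [b ->]; exists (b * a); rewrite phiM !gsimp.
Qed.

Lemma generated_morphic (K : groupType) (phi : G -> K) (D : set G) (D' : set K) x :
  morphic phi -> (forall y, D y -> generated D' (phi y)) ->
  generated D x -> generated D' (phi x).
Proof.
move=> phiM DD' /(_ (phi @^-1` generated D')); apply=> //.
have [g1 gM gV] := generated_subgroup D'; split=> [|y z|y] /=.
- by rewrite morphic1.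
- by rewrite phiM; exact: gM.
- by rewrite (morphicV _ phiM); exact: gV.
Qed.

(** Verbal, hence invariant under all endomorphisms. *)
Definition power_subgroup l : set G := generated [set x ^+ l | x in setT].

Lemma power_subgroup_morphic phi l x : morphic phi ->
  power_subgroup l x -> power_subgroup l (phi x).
Proof.
move=> phiM; apply: generated_morphic => // _ [y _ <-].
by rewrite (morphicX _ _ phiM); apply: sub_generated; exists (phi y).
Qed.

Lemma power_subgroup_conj l g x : power_subgroup l x ->
  power_subgroup l (g * x * g^-1).
Proof.
apply: (power_subgroup_morphic (phi := fun x => g * x * g^-1)) => y z.
by rewrite !gsimp.
Qed.

Lemma power_subgroup_finite_index A l : subgroup A -> abelian_set A ->
  finitely_generated A -> finite_index A -> (0 < l)%N ->
  finite_index (power_subgroup l).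
Proof.
move=> sA cA fgA fA l0; apply: finite_index_trans fA.
have [T hT] := finite_index_power sA cA fgA l0; exists T => a /hT [t tT [b _ tb]].
by exists t => //; rewrite tb; apply: sub_generated; exists b.
Qed.

(** For an abelian normal subgroup B, written additively, this is the image of
    the endomorphism 1 - tau phi, where tau is the conjugation by g. *)
Definition twisted_image phi B g : set G :=
  [set c * g * (phi c)^-1 * g^-1 | c in B].

Section TwistedImage.
Context (phi : G -> G) (B : set G).
Hypotheses (phiM : morphic phi) (sB : subgroup B) (cB : abelian_set B)
  (nB : forall g x, B x -> B (g * x * g^-1)) (phiB : forall x, B x -> B (phi x)).

Lemma twisted_image_subgroup g : subgroup (twisted_image phi B g).
Proof.
have [B1 BM BV] := sB.
have Bt c : B c -> B (g * (phi c)^-1 * g^-1) by move=> Bc; apply/nB/BV/phiB.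
have eI c : c * g * (phi c)^-1 * g^-1 = c * (g * (phi c)^-1 * g^-1).
  by rewrite !gsimp.
split.
- by exists 1 => //; rewrite (morphic1 phiM) !gsimp.
- move=> _ _ [c Bc <-] [d Bd <-]; exists (c * d); first exact: BM.
  rewrite !eI phiM -[RHS]mulgA (mulgA _ d) (cB (Bt _ Bc) Bd) -!(mulgA c) -!(mulgA d).
  congr (_ * (_ * _)); rewrite (cB (Bt _ Bc) (Bt _ Bd)).
  by rewrite !gsimp.
- move=> _ [c Bc <-]; exists c^-1; first exact: BV.
  rewrite !eI (morphicV _ phiM) invgM [RHS]cB; first by rewrite !gsimp.
    by apply: BV; apply: Bt.
  exact: BV.
Qed.

(** The elements b ^+ i * g fall into finitely many twisted classes, and, after
    multiplication of the conjugating element by a coset representative of B,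
    into finitely many classes for twisted conjugation by B. Two exponents i < j
    in the same class have b ^+ (j - i) in the twisted image. *)
Lemma twisted_image_exponent (r T : seq G) :
  (forall g, exists2 t, t \in T & B (t^-1 * g)) ->
  (forall y, exists2 x, x \in r & twisted_conjugate phi x y) ->
  exists2 m, (0 < m)%N & forall g b, B b -> twisted_image phi B g (b ^+ m).
Proof.
move=> fT fr; exists (size [seq (x, t) | x <- r, t <- T])`!; first exact: fact_gt0.
move=> g b Bb; have [B1 BM BV] := sB.
set s := [seq (x, t) | x <- r, t <- T].
have ex i : exists2 p, p \in s &
    exists2 c, B c & b ^+ i * g = c * (p.2 * p.1 * (phi p.2)^-1) * (phi c)^-1.
  have [x xr [z zE]] := fr (b ^+ i * g); have [t tT Bt] := fT z.
  exists (x, t); first exact: allpairs_f.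
  exists (z * t^-1); first by have := nB t Bt; rewrite !gsimp.
  by rewrite zE /= phiM (morphicV _ phiM) !gsimp.
pose f i := s2val (cid2 (ex i)).
have fs i : f i \in s by rewrite /f; case: cid2.
have fP i : exists2 c, B c & b ^+ i * g = c * ((f i).2 * (f i).1 * (phi (f i).2)^-1) * (phi c)^-1.
  by rewrite /f; case: cid2.
have [i [j [/andP[ij js] fij]]] := pigeonhole fs.
have [ci Bi ei] := fP i; have [cj Bj ej] := fP j.
rewrite -fij in ej; set w := (f i).2 * _ * _ in ei ej.
have Iji : twisted_image phi B g (b ^+ (j - i)).
  exists (cj * ci^-1); first by apply: BM => //; apply: BV.
  have wE : w = ci^-1 * (b ^+ i * g) * phi ci by rewrite ei !gsimp.
  have Bbi : B (b ^+ i) by apply: subgroupX.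
  have e1 : b ^+ j = (cj * ci^-1) * b ^+ i * (g * (phi (cj * ci^-1))^-1 * g^-1).
    apply: (mulIg g); rewrite ej wE phiM (morphicV _ phiM) !gsimp.
    by [].
  have Bc : B (cj * ci^-1) by apply: BM => //; apply: BV.
  have BY : B (g * (phi (cj * ci^-1))^-1 * g^-1) by apply/nB/BV/phiB.
  rewrite expgnFr 1?ltnW // e1 -(mulgA _ (b ^+ i)) (cB Bbi BY).
  by rewrite !mulgA mulgK.
have /dvdnP[q ->] : (j - i %| (size s)`!)%N.
  apply: dvdn_fact; rewrite subn_gt0 ij /=.
  exact: leq_trans (leq_subr _ _) js.
by rewrite mulnC expgnA; apply: subgroupX => //; exact: twisted_image_subgroup.
Qed.

End TwistedImage.

(** The passage to a finite group: for a multiple l of the exponents of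
    B / (1 - tau phi^d) B, the subgroup N generated by the l-th powers is
    contained in all these images. *)
Lemma finite_quotient_twisted A phi n : morphic phi ->
  finitely_generated [set: G] -> subgroup A -> abelian_set A -> finite_index A ->
  (forall d, (0 < d)%N -> exists s, twisted_transversal (iter d phi) s) ->
  exists N, [/\ subgroup N, forall g x, N x -> N (g * x * g^-1),
    forall x, N x -> N (phi x), finite_index N &
    forall d x g, (0 < d <= n)%N -> N x -> twisted_conjugate (iter d phi) g (x * g)].
Proof.
move=> phiM fgG sA cA fA ftw.
have fgA := schreier fgG sA fA.
have [k k0 kA] := finite_index_exponent sA fA.
pose B := power_subgroup k.
have sB : subgroup B by exact: generated_subgroup.
have BA : B `<=` A by move=> x; apply => // _ [y _ <-].
have cB : abelian_set B by move=> x y /BA Ax /BA Ay; exact: cA.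
have nB g x : B x -> B (g * x * g^-1) by exact: power_subgroup_conj.
have phiB d x : B x -> B (iter d phi x).
  by apply: power_subgroup_morphic; exact: morphic_iter.
have [T fT] := power_subgroup_finite_index sA cA fgA fA k0.
have [m m0 hm] : exists2 m, (0 < m)%N & forall d g b, (0 < d <= n)%N -> B b ->
    twisted_image (iter d phi) B g (b ^+ m).
  elim: n => [|n [m m0 hm]]; first by exists 1%N => // -[].
  have [s [_ _ hs]] := ftw n.+1 isT.
  have [m' m'0 hm'] := twisted_image_exponent (morphic_iter n.+1 phiM) sB cB nB
    (phiB n.+1) fT hs.
  exists (m * m')%N => [|d g b /andP[d0]]; first by rewrite muln_gt0 m0.
  have sI := twisted_image_subgroup (morphic_iter d phiM) sB cB nB (phiB d) g.
  rewrite leq_eqVlt => /predU1P[dn|dn] Bb.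
    by rewrite mulnC expgnA; apply: subgroupX => //; rewrite dn; exact: hm'.
  by rewrite expgnA; apply: subgroupX => //; apply: hm; rewrite ?d0.
exists (power_subgroup (k * m)); split.
- exact: generated_subgroup.
- exact: power_subgroup_conj.
- by move=> x; exact: power_subgroup_morphic.
- by apply: (power_subgroup_finite_index sA) => //; rewrite muln_gt0 k0.
- move=> d x g dn Nx.
  suff [c _ <-] : twisted_image (iter d phi) B g x by exists c; rewrite !gsimp.
  apply: Nx; first exact: (twisted_image_subgroup (morphic_iter d phiM) sB cB nB (phiB d)).
  move=> _ [y _ <-]; rewrite expgnA; apply: hm => //.
  by apply: sub_generated; exists y.
Qed.

End TwistedConjugacy.

(** * Counting twisted conjugacy classes of a finite group *)

Section FiniteQuotient.
Context (G : groupType) (N : set G) (T : seq G).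
Hypotheses (sN : subgroup N) (nN : forall g x, N x -> N (g * x * g^-1)%g)
  (fT : forall g, exists2 t, t \in T & N (t^-1 * g)%g).
Local Open Scope group_scope.
Implicit Types g h : G.

(** The hypotheses on N are arguments, so that the group structure of the
    quotient can be found from its type. The quotient is realized on a list T of
    coset representatives, with repetitions allowed: only the first
    representative of each coset is kept. *)
Definition coset_rep of subgroup N & (forall g x, N x -> N (g * x * g^-1)) &
    (forall g, exists2 t, t \in T & N (t^-1 * g)) := fun g : G =>
  nth 1 T (find (fun t => `[< N (t^-1 * g) >]) T).
Local Notation rep := (coset_rep sN nN fT).

Lemma coset_repP g : N ((rep g)^-1 * g).
Proof.
have [t tT Nt] := fT g; apply/asboolP.
apply: (nth_find 1 (a := fun t => `[< N (t^-1 * g) >]) (s := T)).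
by apply/hasP; exists t => //; exact/asboolP.
Qed.

Lemma coset_rep_in g : rep g \in T.
Proof.
have [t tT Nt] := fT g; rewrite /coset_rep mem_nth // -has_find.
by apply/hasP; exists t => //; exact/asboolP.
Qed.

Lemma coset_rep_eq g h : N (g^-1 * h) -> rep g = rep h.
Proof.
move=> Ngh; rewrite /coset_rep; congr nth; apply: eq_find => t.
have [_ NM NV] := sN; apply/asboolP/asboolP => Nt.
  by have := NM _ _ Nt Ngh; rewrite !gsimp.
by have := NM _ _ Nt (NV _ Ngh); rewrite !gsimp.
Qed.

Lemma coset_rep_idem g : rep (rep g) = rep g.
Proof. exact/coset_rep_eq/coset_repP. Qed.

Definition quotient_type := {x : seq_sub T | rep (val x) == val x}.
HB.instance Definition _ := Finite.on quotient_type.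

Fact to_quotient_proof g : rep (val (SeqSub (coset_rep_in g))) == val (SeqSub (coset_rep_in g)).
Proof. by rewrite /= coset_rep_idem. Qed.

Definition to_quotient g : quotient_type := Sub (SeqSub (coset_rep_in g)) (to_quotient_proof g).

Definition of_quotient (q : quotient_type) : G := val (val q).

Lemma of_quotient_inj : injective of_quotient.
Proof. by move=> p q pq; apply/val_inj/val_inj. Qed.

Lemma to_quotientE g h : N (g^-1 * h) -> to_quotient g = to_quotient h.
Proof. by move=> gh; apply: of_quotient_inj; exact: coset_rep_eq. Qed.

Lemma of_quotientK q : to_quotient (of_quotient q) = q.
Proof. by apply: of_quotient_inj; rewrite /of_quotient /= (eqP (valP q)). Qed.

Lemma to_quotientK g : N ((of_quotient (to_quotient g))^-1 * g).
Proof. exact: coset_repP. Qed.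

Lemma to_quotient_eqP g h : to_quotient g = to_quotient h -> N (g^-1 * h).
Proof.
have [_ NM NV] := sN => gh; have := NM _ _ (NV _ (to_quotientK g)) (to_quotientK h).
by rewrite gh !gsimp.
Qed.

Let qmul p q := to_quotient (of_quotient p * of_quotient q).
Let qone := to_quotient 1.
Let qinv p := to_quotient (of_quotient p)^-1.

Lemma to_quotient_mul g h :
  to_quotient (of_quotient (to_quotient g) * of_quotient (to_quotient h)) =
  to_quotient (g * h).
Proof.
apply: to_quotientE; set a := of_quotient _; set b := of_quotient _.
have [_ NM NV] := sN.
have -> : (a * b)^-1 * (g * h) = (b^-1 * (a^-1 * g) * b^-1^-1) * (b^-1 * h).
  by rewrite !gsimp.
by apply: NM; [apply: nN|]; exact: to_quotientK.
Qed.

Let qmulA : associative qmul.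
Proof.
move=> p q r; rewrite /qmul -{1}[p]of_quotientK -{2}[r]of_quotientK !to_quotient_mul.
by rewrite mulgA.
Qed.
Let qmul1 : left_id qone qmul.
Proof.
by move=> p; rewrite /qmul /qone -{1}[p]of_quotientK to_quotient_mul mul1g of_quotientK.
Qed.
Let qmulV : left_inverse qone qinv qmul.
Proof.
by move=> p; rewrite /qmul /qinv -{2}[p]of_quotientK to_quotient_mul mulVg.
Qed.

HB.instance Definition _ := Finite_isGroup.Build quotient_type qmulA qmul1 qmulV.

Lemma to_quotientM g h : to_quotient (g * h) = to_quotient g * to_quotient h.
Proof. by rewrite -to_quotient_mul. Qed.

End FiniteQuotient.

Section FiniteTwistedConjugacy.
Local Open Scope set_scope.
Local Close Scope classical_set_scope.
Context (gT : finGroupType) (psi : gT -> gT).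
Hypothesis psiM : forall x y, psi (x * y)%g = (psi x * psi y)%g.
Local Open Scope group_scope.

Let psi1 : psi 1 = 1.
Proof. by apply: (mulgI (psi 1)); rewrite -psiM !mulg1. Qed.

Let psiV x : psi x^-1 = (psi x)^-1.
Proof. by apply: (mulgI (psi x)); rewrite -psiM !mulgV. Qed.

Let tact (g x : gT) : gT := x^-1 * g * psi x.

Let tact_action : is_action [set: gT] tact.
Proof.
apply: is_total_action => [g|g x y]; first by rewrite /tact psi1 mulg1 invg1 mul1g.
by rewrite /tact invMg psiM !mulgA.
Qed.

Definition twisted_action := Action tact_action.

Let class_stabilizer a : (#|a ^: [set: gT]| * #|'C[a]|)%N = #|gT|.
Proof.
by rewrite -index_cent1 mulnC finset.setTI -cardsT Lagrange ?finset.subsetT.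
Qed.

Let card_fix a : #|'Fix_([set: gT] | twisted_action)[a]| =
  ((psi a \in a ^: [set: gT]) * #|'C[a]|)%N.
Proof.
have fixE : 'Fix_([set: gT] | twisted_action)[a] = [set g | psi a == a ^ g].
  apply/setP => g; rewrite !inE finset.sub1set inE /=; apply/eqP/eqP => [ga|e].
    apply: (mulgI (a^-1 * g)); rewrite -/(tact g a) ga conjgE.
    by rewrite !mulgA mulgK mulVg mul1g.
  by rewrite /tact e conjgE !mulgA mulgK mulVg mul1g.
rewrite fixE; case: imsetP => [[g _ psig]|nC]; rewrite ?mul1n ?mul0n; last first.
  apply/eqP; rewrite cards_eq0; apply/eqP/setP => g; rewrite !inE.
  by apply/eqP => psig; apply: nC; exists g.
rewrite -(card_rcoset 'C[a] g); apply: eq_card => h.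
rewrite [LHS]inE mem_rcoset psig.
apply/eqP/cent1P => [e|c].
  by apply/commute_sym/commgP; rewrite -conjg_fix conjgM -e conjgK.
have /eqP fx : a ^ (h * g^-1) == a by rewrite conjg_fix; apply/commgP/commute_sym.
by rewrite -{1}fx conjgM conjgKV.
Qed.

(** Both sides count, up to the factor #|gT|, the pairs (g, x) with
    x^-1 * g * psi x = g, that is psi x = x ^ g. *)
Lemma card_twisted_orbits :
  #|orbit twisted_action [set: gT] @: [set: gT]| =
  #|[set C in classes [set: gT] | psi (repr C) ^: [set: gT] == C]|.
Proof.
have h0 : [acts [set: gT], on [set: gT] | twisted_action].
  by apply/actsP => x _ y; rewrite !inE.
have G0 : (0 < #|[set: gT]|)%N by rewrite cardsT; apply/card_gt0P; exists 1.
apply/eqP; rewrite -(eqn_pmul2r G0); apply/eqP; rewrite -(Frobenius_Cauchy h0).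
rewrite (set_partition_big _ (classes_partition [set: gT])) /=.
rewrite -sum_nat_const [RHS]big_mkcond [LHS]big_mkcond.
apply: eq_bigr => C _; rewrite inE.
case: imsetP => [[y _ CE]|_] //=.
have rC : repr C \in C by rewrite CE; apply: (@mem_repr_classes _ [group of [set: gT]]); rewrite mem_classes ?inE.
have classC a : a \in C -> a ^: [set: gT] = C.
  by rewrite CE => /imsetP[z zG ->]; rewrite classGidl.
have psiC a : a \in C -> (psi a \in C) = (psi (repr C) ^: [set: gT] == C).
  move=> aC; apply/idP/eqP => [pC|<-].
    rewrite -{2}(classC _ pC); move: aC; rewrite -{1}(classC _ rC).
    case/imsetP => z _ ->; rewrite conjgE !psiM psiV.
    by rewrite mulgA -mulgA -conjgE classGidl ?inE.
  move: aC; rewrite -{1}(classC _ rC) => /imsetP[z _ ->].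
  by rewrite conjgE !psiM psiV -conjgE memJ_class ?inE.
transitivity (\sum_(a in C) ((psi (repr C) ^: [set: gT] == C) * #|'C[a]|))%N.
  by apply: eq_bigr => a aC; rewrite card_fix (classC a aC) psiC.
rewrite -big_distrr /=; case: eqP => _; rewrite ?mul0n ?mul1n //.
transitivity (\sum_(a in C) #|'C[repr C]|)%N.
  apply: eq_bigr => a aC; apply/eqP.
  have c0 : (0 < #|C|)%N by rewrite card_gt0; apply/set0Pn; exists a.
  by rewrite -(eqn_pmul2l c0) -{1}(classC a aC) -{1}(classC _ rC) !class_stabilizer.
by rewrite sum_nat_const -{1}(classC _ rC) class_stabilizer cardsT.
Qed.

End FiniteTwistedConjugacy.

(** * Moebius inversion and periodic points *)

Section GaussCongruence.

Lemma moebius_primes_dvd q d : prime q -> ~~ (q %| d)%N -> (0 < d)%N ->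
  moebius (q * d)%N = (- moebius d).
Proof.
move=> pq qd d0; rewrite /moebius.
have q0 := prime_gt0 pq.
have pE : perm_eq (primes (q * d)%N) (q :: primes d).
  apply: uniq_perm; rewrite ?primes_uniq //=.
    by rewrite primes_uniq mem_primes (negbTE qd) !andbF.
  by move=> r; rewrite primesM // inE primes_prime // !inE.
rewrite (perm_size pE) (perm_all _ pE) /=.
have -> : logn q (q * d) == 1%N by rewrite lognM // logn_prime // eqxx logn_coprime // prime_coprime.
have -> : all (fun r => logn r (q * d) == 1%N) (primes d) =
    all (fun r => logn r d == 1%N) (primes d).
  apply: eq_in_all => r; rewrite mem_primes => /and3P[pr _ rd].
  have rq : (r == q) = false by apply: contraNF qd => /eqP <-.
  by rewrite lognM // logn_prime // rq.
by case: (all _ _); rewrite /= ?oppr0 // exprS mulN1r.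
Qed.

Lemma moebius_sqr q d : prime q -> (q %| d)%N -> (0 < d)%N -> moebius (q * d)%N = 0.
Proof.
move=> pq qd d0; rewrite /moebius; case: ifP => // /allP /(_ q).
have q0 := prime_gt0 pq.
rewrite mem_primes pq dvdn_mulr // muln_gt0 q0 d0 => /(_ isT).
rewrite lognM // logn_prime // eqxx add1n eqSS.
by rewrite -[logn q d == 0%N]negbK -lt0n logn_gt0 mem_primes pq d0 qd.
Qed.

(** Pair d with q * d for a prime divisor q of n: the terms cancel. *)
Lemma sum_moebius n : (1 < n)%N -> \sum_(d <- divisors n) moebius d = 0.
Proof.
move=> n1; have n0 : (0 < n)%N by exact: ltnW.
have [q pq qn] : exists2 q, prime q & (q %| n)%N.
  by exists (pdiv n); [exact: pdiv_prime|exact: pdiv_dvd].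
have q0 := prime_gt0 pq.
have nq0 : (0 < n %/ q)%N by rewrite divn_gt0 // dvdn_leq.
rewrite (bigID (fun d => (q %| d)%N)) /=.
have -> : \sum_(d <- divisors n | (q %| d)%N) moebius d =
    \sum_(d <- divisors (n %/ q)%N) moebius (q * d)%N.
  have pE : perm_eq [seq d <- divisors n | (q %| d)%N] [seq (q * d)%N | d <- divisors (n %/ q)%N].
    apply: uniq_perm; first by rewrite filter_uniq // divisors_uniq.
      rewrite map_inj_uniq ?divisors_uniq // => x y /eqP.
      by rewrite eqn_pmul2l // => /eqP.
    move=> d; rewrite mem_filter -dvdn_divisors //.
    apply/andP/mapP => [[qd dn]|[e]].
      exists (d %/ q)%N; last by rewrite mulnC divnK.
      by rewrite -dvdn_divisors // dvdn_divRL // divnK.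
    by rewrite -dvdn_divisors // dvdn_divRL // => en ->; rewrite dvdn_mulr // mulnC.
  by rewrite -big_filter (perm_big _ pE) big_map.
rewrite (bigID (fun d => (q %| d)%N)) /= big1_seq ?add0r => [|d /andP[qd]]; last first.
  rewrite -dvdn_divisors // => dn.
  by apply: moebius_sqr => //; apply: dvdn_gt0 dn.
have -> : \sum_(d <- divisors (n %/ q)%N | ~~ (q %| d)%N) moebius (q * d)%N =
    - (\sum_(d <- divisors (n %/ q)%N | ~~ (q %| d)%N) moebius d).
  rewrite -sumrN big_seq_cond [RHS]big_seq_cond; apply: eq_bigr => d /andP[dn qd].
  apply: moebius_primes_dvd => //.
  by move: dn; rewrite -dvdn_divisors // => /dvdn_gt0; apply.
rewrite addrC; apply/eqP; rewrite subr_eq0; apply/eqP.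
rewrite -big_filter -[RHS]big_filter; apply: perm_big; apply: uniq_perm;
  rewrite ?filter_uniq ?divisors_uniq // => d.
rewrite !mem_filter -!dvdn_divisors //.
case qd: (q %| d)%N => //=; rewrite dvdn_divRL //.
by rewrite mulnC Gauss_dvd ?qn ?andbT // prime_coprime // qd.
Qed.

(** After the exchange of the sums, p e is multiplied by the sum of moebius over
    the divisors of n %/ e. *)
Lemma moebius_inversion (a p : nat -> int) n : (0 < n)%N ->
  (forall m, (0 < m)%N -> (m %| n)%N -> a m = \sum_(e <- divisors m) p e) ->
  \sum_(d <- divisors n) moebius d * a (n %/ d)%N = p n.
Proof.
move=> n0 ap.
have -> : \sum_(d <- divisors n) moebius d * a (n %/ d)%N =
    \sum_(d <- divisors n) \sum_(e <- divisors n | (d * e %| n)%N) moebius d * p e.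
  rewrite big_seq_cond [RHS]big_seq_cond; apply: eq_bigr => d /andP[+ _].
  rewrite -dvdn_divisors // => dn; have d0 := dvdn_gt0 n0 dn.
  have nd0 : (0 < n %/ d)%N by rewrite divn_gt0 // dvdn_leq.
  rewrite ap // ?dvdn_div // mulr_sumr -[RHS]big_filter; apply: perm_big.
  apply: uniq_perm; rewrite ?filter_uniq ?divisors_uniq // => e.
  rewrite mem_filter -!dvdn_divisors // dvdn_divRL // mulnC.
  apply/idP/andP => [en|[]//]; split=> //; apply: dvdn_trans en.
  exact: dvdn_mull.
rewrite (exchange_big_dep predT) //=.
have -> : \sum_(e <- divisors n) \sum_(d <- divisors n | (d * e %| n)%N) moebius d * p e =
    \sum_(e <- divisors n) (n == e)%:R * p e.
  rewrite big_seq_cond [RHS]big_seq_cond; apply: eq_bigr => e /andP[+ _].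
  rewrite -dvdn_divisors // => en; have e0 := dvdn_gt0 n0 en.
  have ne0 : (0 < n %/ e)%N by rewrite divn_gt0 // dvdn_leq.
  rewrite -mulr_suml; congr (_ * _).
  transitivity (\sum_(d <- divisors (n %/ e)%N) moebius d).
    rewrite -big_filter; apply: perm_big.
    apply: uniq_perm; rewrite ?filter_uniq ?divisors_uniq // => d.
    rewrite mem_filter -!dvdn_divisors // dvdn_divRL //.
    apply/andP/idP => [[]//|den]; split=> //; apply: dvdn_trans den.
    exact: dvdn_mulr.
  case: eqP => [<-|ne]; first by rewrite divnn n0 big_seq1.
  rewrite sum_moebius // ltn_neqAle ne0 andbT; apply/eqP => e1.
  by apply: ne; rewrite -(divnK en) -e1 mul1n.
rewrite (bigD1_seq n) ?divisors_uniq -?dvdn_divisors //= eqxx mul1r.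
by rewrite big1 ?addr0 // => e /negbTE; rewrite eq_sym => ->; rewrite mul0r.
Qed.

Section PeriodicPoints.
Context (T : finType) (F : T -> T).
Local Close Scope classical_set_scope.
Local Open Scope set_scope.

Let least_period x n : (0 < n)%N -> iter n F x = x -> exists e,
  [/\ (0 < e)%N, iter e F x = x & forall m, (iter m F x == x) = (e %| m)%N].
Proof.
move=> n0 nx; have ex : exists m, (0 < m)%N && (iter m F x == x).
  by exists n; rewrite n0 nx eqxx.
case: (ex_minnP ex) => e /andP[e0 /eqP ee] emin; exists e; split=> // m.
have iterq q : iter (q * e)%N F x = x.
  by elim: q => [//|q IH]; rewrite mulSn iterD IH.
rewrite {1}(divn_eq m e) addnC iterD iterq /dvdn.
have [m0|m0] := posnP (m %% e)%N; first by rewrite m0 eqxx.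
apply/negbTE/negP => mx.
have := emin (m %% e)%N; rewrite m0 mx => /(_ isT).
by rewrite leqNgt ltn_mod e0.
Qed.

Definition exact_period e : {set T} :=
  [set x | [forall m : 'I_e.+1, (0 < m)%N ==> ((iter m F x == x) == (e == m))]].

Let exact_periodP e x : (0 < e)%N -> reflect (forall m, (iter m F x == x) = (e %| m)%N)
  (x \in exact_period e).
Proof.
move=> e0; rewrite inE; apply: (iffP forallP) => [h|h m]; last first.
  apply/implyP => m0; rewrite h; apply/eqP; apply/idP/eqP => [em|<- //].
  by apply/eqP; rewrite eqn_leq dvdn_leq // -ltnS ltn_ord.
have /= := h ord_max; rewrite e0 eqxx => /eqP/eqP ex.
have [e' [e'0 e'x he']] := least_period e0 ex.
have e'e : (e' %| e)%N by rewrite -he' ex.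
have lt : (e' < e.+1)%N by rewrite ltnS dvdn_leq.
have := h (Ordinal lt); rewrite /= e'0 e'x eqxx => /eqP/esym/eqP e'E.
by rewrite e'E.
Qed.

Lemma card_fix_iter m : (0 < m)%N ->
  #|[set x | iter m F x == x]| = (\sum_(e <- divisors m) #|exact_period e|)%N.
Proof.
move=> m0.
transitivity (\sum_(x in [set x | iter m F x == x]) \sum_(e <- divisors m | x \in exact_period e) 1)%N.
  rewrite -sum1_card; apply: eq_bigr => x; rewrite inE => /eqP mx.
  have [e [e0 ex he]] := least_period m0 mx.
  have em : (e %| m)%N by rewrite -he mx.
  rewrite big_mkcond (bigD1_seq e) ?divisors_uniq -?dvdn_divisors //=.
  have -> : x \in exact_period e by apply/exact_periodP.
  rewrite big1_seq // => e' /andP[ne]; rewrite -dvdn_divisors // => e'm.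
  have e'0 := dvdn_gt0 m0 e'm; case: ifP => // /(exact_periodP _ e'0) h.
  by case/eqP: ne; apply/eqP; rewrite eqn_dvd -h ex eqxx -he h dvdnn.
rewrite (exchange_big_dep predT) //=; rewrite big_seq_cond [RHS]big_seq_cond.
apply: eq_bigr => e /andP[]; rewrite -dvdn_divisors // => em _.
rewrite -sum1_card; apply: eq_bigl => x; rewrite inE.
have e0 := dvdn_gt0 m0 em.
by apply/andP/idP => [[]//|xe]; split=> //; rewrite (exact_periodP x e0 xe).
Qed.

(** The points of exact period e split into cycles of length e. *)
Lemma exact_period_dvd e : (0 < e)%N -> (e %| #|exact_period e|)%N.
Proof.
move=> e0; pose R x y := [exists i : 'I_e, iter i F x == y].
have RP x y : x \in exact_period e -> reflect (exists j, iter j F x = y) (R x y).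
  move=> /(exact_periodP x e0) hx; apply: (iffP existsP) => [[i /eqP <-]|[j <-]].
    by exists i.
  exists (Ordinal (ltn_pmod j e0)) => /=; apply/eqP.
  have iterq q : iter (q * e)%N F x = x.
    by apply/eqP; rewrite hx dvdn_mull.
  by rewrite {2}(divn_eq j e) addnC iterD iterq.
have stable x j : x \in exact_period e -> iter j F x \in exact_period e.
  move=> /(exact_periodP x e0) hx; apply/exact_periodP => // m.
  have back : iter (j * e - j)%N F (iter j F x) = x.
    rewrite -iterD subnK ?leq_pmulr //; apply/eqP.
    by rewrite hx dvdn_mull.
  rewrite -hx -!iterD; apply/eqP/eqP => [mj|mx]; last by rewrite addnC iterD mx.
  have -> : iter m F x = iter (j * e - j)%N F (iter (m + j) F x).
    by rewrite -{1}back -!iterD; congr (iter _ F x); lia.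
  by rewrite mj back.
have Rsym x y : x \in exact_period e -> y \in exact_period e -> R x y -> R y x.
  move=> xD yD /(RP _ _ xD) [j <-]; have /(exact_periodP x e0) hx := xD.
  apply/(RP _ _ (stable x j xD)); exists (j * e - j)%N; rewrite -iterD subnK ?leq_pmulr //.
  by apply/eqP; rewrite hx dvdn_mull.
have eR : {in exact_period e & &, equivalence_rel R}.
  move=> x y z xD yD zD; split=> [|xy]; first by apply/RP => //; exists 0%N.
  apply/idP/idP => [xz|yz].
    have /(RP _ _ yD) [i yx] := Rsym _ _ xD yD xy; have /(RP _ _ xD) [j <-] := xz.
    by apply/RP => //; exists (j + i)%N; rewrite iterD yx.
  have /(RP _ _ xD) [i yx] := xy; have /(RP _ _ yD) [j <-] := yz.
  by apply/RP => //; exists (j + i)%N; rewrite iterD yx.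
have part := equivalence_partitionP eR.
rewrite (card_uniform_partition _ part (n := e)) ?dvdn_mull // => B.
case/imsetP => x xD ->; have /(exact_periodP x e0) hx := xD.
have -> : [set y in exact_period e | R x y] = [set iter (i : 'I_e) F x | i in 'I_e].
  apply/setP => y; rewrite !inE; apply/andP/imsetP => [[_ /existsP[i /eqP <-]]|[i _ ->]].
    by exists i.
  split; last by apply/existsP; exists i.
  by have := stable x i xD; rewrite inE.
have inj (i j : 'I_e) : (i <= j)%N -> iter i F x = iter j F x -> i = j.
  move=> ij eij; apply/val_inj/eqP; rewrite /= eqn_leq ij /=.
  have : iter (e - j + i) F x == x.
    by rewrite iterD eij -iterD subnK ?hx // ltnW.
  rewrite hx => /dvdn_leq; rewrite addn_gt0 subn_gt0 ltn_ord => /(_ isT).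
  by rewrite -{1}(subnK (ltnW (ltn_ord j))) leq_add2l.
rewrite card_in_imset ?card_ord // => i j _ _ ij.
by case/orP: (leq_total i j) => le; [|apply/esym]; apply: inj.
Qed.

Lemma gauss_congruence n : (0 < n)%N ->
  (n%:Z %| \sum_(d <- divisors n) moebius d * #|[set x | iter (n %/ d) F x == x]|%:Z)%Z.
Proof.
move=> n0.
rewrite (@moebius_inversion (fun m => #|[set x | iter m F x == x]|%:Z)
  (fun e => #|exact_period e|%:Z)) //; first exact: exact_period_dvd.
move=> m m0 _; rewrite card_fix_iter //.
exact: (big_morph Posz PoszD (erefl : Posz 0 = 0)).
Qed.

End PeriodicPoints.
End GaussCongruence.

(** * Gauss congruences for twisted conjugacy *)

Section TwistedGauss.
Context (G : groupType) (phi : G -> G) (A : set G).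
Hypotheses (phiM : morphic phi) (fgG : finitely_generated [set: G])
  (sA : subgroup A) (cA : abelian_set A) (fA : finite_index A).

(** F maps a conjugacy class C of the quotient Q to the class of psi y for any y
    in C. It is extended to all subsets of Q so as to have values among the
    classes: the fixed points of its iterates are then automatically classes. *)
Lemma twisted_gauss_congruence (r : nat -> nat) n :
  (forall d, (0 < d)%N -> exists2 s, twisted_transversal (iter d phi) s & size s = r d) ->
  (0 < n)%N ->
  (n%:Z %| \sum_(d <- divisors n) moebius d * (r (n %/ d)%N)%:Z)%Z.
Proof.
move=> hr n0.
have [|N [sN nN phiN [T fT] Ntw]] := finite_quotient_twisted n phiM fgG sA cA fA.
  by move=> d /hr [s ts _]; exists s.
pose Q := quotient_type sN nN fT.
pose q g : Q := to_quotient sN nN fT g.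
have qM g h : q (g * h)%g = (q g * q h)%g by exact: to_quotientM.
have qK (x : Q) : q (of_quotient x) = x by exact: of_quotientK.
pose psi (x : Q) : Q := q (phi (of_quotient x)).
have psiq g : psi (q g) = q (phi g).
  apply: to_quotientE; rewrite -(morphicV _ phiM) -phiM; apply: phiN.
  exact: to_quotientK.
have psiqd d g : iter d psi (q g) = q (iter d phi g).
  by elim: d => [//|d IH]; rewrite !iterS IH psiq.
have psiM x y : psi (x * y)%g = (psi x * psi y)%g.
  by rewrite -[x]qK -[y]qK -qM !psiq phiM qM.
have psidM d x y : iter d psi (x * y)%g = (iter d psi x * iter d psi y)%g.
  by elim: d => [//|d IH]; rewrite !iterS IH psiM.
pose F (C : {set Q}) : {set Q} := (psi (repr C) ^: finset.setT)%g.
have psiV x : psi x^-1%g = (psi x)^-1%g.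
  have psi1 : psi 1%g = 1%g by apply: (mulgI (psi 1%g)); rewrite -psiM !mulg1.
  by apply: (mulgI (psi x)); rewrite -psiM !mulgV.
have FE (x : Q) : F (x ^: finset.setT)%g = (psi x ^: finset.setT)%g.
  have rx : repr (x ^: finset.setT)%g \in (x ^: finset.setT)%g.
    apply: (@mem_repr_classes _ [group of (finset.setT : {set Q})]).
    by rewrite mem_classes ?inE.
  rewrite /F; case/imsetP: rx => z _ ->.
  by rewrite conjgE !psiM psiV -conjgE classGidl ?inE.
have FdE d (x : Q) : iter d F (x ^: finset.setT)%g = (iter d psi x ^: finset.setT)%g.
  by elim: d => [//|d IH]; rewrite !iterS IH FE.
have rE d : (0 < d <= n)%N -> r d = #|finset (fun C => iter d F C == C)|.
  move=> dn; have /andP[d0 _] := dn; have [s [us st sc] <-] := hr d d0.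
  have phid := morphic_iter d phiM.
  transitivity #|orbit (twisted_action (psidM d)) finset.setT @: (finset.setT : {set Q})|;
      last first.
    rewrite card_twisted_orbits; apply: eq_card => C; rewrite !inE.
    have clE : C \in classes (finset.setT : {set Q}) -> C = (repr C ^: finset.setT)%g.
      move=> Ccl; have := @mem_repr_classes _ [group of (finset.setT : {set Q})] _ Ccl.
      move: (repr C) => y yC; case/imsetP: Ccl => x _ CE; rewrite CE in yC *.
      by case/imsetP: yC => z _ ->; rewrite classGidl ?inE.
    apply/andP/eqP => [[Ccl /eqP e]|e]; first by rewrite {1}(clE Ccl) FdE e.
    have Ccl : C \in classes (finset.setT : {set Q}).
      by rewrite -e -(prednK d0) iterS mem_classes ?inE.
    by split=> //; rewrite -FdE -(clE Ccl) e.
  pose L := [seq orbit (twisted_action (psidM d)) finset.setT (q g) | g <- s].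
  have orbP g h : orbit (twisted_action (psidM d)) finset.setT (q g) =
      orbit (twisted_action (psidM d)) finset.setT (q h) <->
      twisted_conjugate (iter d phi) g h.
    split=> [/esym/orbit_eqP/orbitP[a _]|[z hE]].
      rewrite /= -[a]qK psiqd; set w := of_quotient a.
      rewrite -(morphicV _ qM) -(qM w^-1%g g) -(qM (w^-1 * g)%g) => /to_quotient_eqP Nyh.
      pose y := (w^-1 * g * iter d phi w)%g; rewrite -/y in Nyh.
      apply: (@twisted_conjugate_trans _ _ _ y) => //.
        by exists w^-1%g; rewrite (morphicV _ phid) invgK.
      have -> : h = (y * (y^-1 * h) * y^-1 * y)%g by rewrite !gsimp.
      exact: Ntw dn (nN _ _ Nyh).
    apply/esym/orbit_eqP/orbitP; exists (q z^-1%g); rewrite ?inE //=.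
    rewrite psiqd -(morphicV _ qM) invgK -(qM z g) -(qM (z * g)%g) hE.
    by rewrite (morphicV _ phid).
  have uL : uniq L.
    rewrite map_inj_in_uniq // => g h gs hs /orbP; exact: st.
  transitivity (size L); first by rewrite size_map.
  rewrite -(card_uniqP uL); apply: eq_card => O; apply/mapP/imsetP.
    by move=> [g _ ->]; exists (q g).
  move=> [x _ ->]; rewrite -[x]qK; have [g gs gx] := sc (of_quotient x).
  by exists g => //; apply/esym/orbP.
rewrite (eq_big_seq (fun d => moebius d * #|finset (fun C => iter (n %/ d) F C == C)|%:Z)).
  exact: gauss_congruence.
move=> d; rewrite -dvdn_divisors // => dn; rewrite rE // leq_div andbT.
by rewrite divn_gt0 ?(dvdn_gt0 n0 dn) // dvdn_leq.
Qed.

End TwistedGauss.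

(** * Lifting paths and loops through a covering map *)

Section CoveringSpaces.
Context (R : realType).

Lemma near_eq_continuous (S T : topologicalType) (f g : S -> T) x :
  (\forall y \near x, f y = g y) -> {for x, continuous g} -> {for x, continuous f}.
Proof.
move=> e cg W /=; rewrite (nbhs_singleton e) => /cg /= h.
by apply: filterS2 e h => y /= ->.
Qed.

Lemma pair_continuous (S T U : topologicalType) (f : S -> T) (g : S -> U) x :
  {for x, continuous f} -> {for x, continuous g} ->
  {for x, continuous (fun y => (f y, g y))}.
Proof.
move=> cf cg W [[A B] /= [nA nB] AB].
suff : nbhs x (fun y => W (f y, g y)) by [].
have nA' : nbhs x (f @^-1` A) := cf _ nA; have nB' : nbhs x (g @^-1` B) := cg _ nB.
by apply: filterS2 nA' nB' => y Ay By; exact: AB.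
Qed.

(** Connectedness of the real line, as an induction principle: a property that
    is locally constant is constant. *)
Lemma real_line_induction (P : R -> Prop) (a : R) : P a ->
  (forall b : R, exists2 J : set R, nbhs b J & forall b' b'', J b' -> J b'' -> P b' -> P b'') ->
  forall b, P b.
Proof.
move=> Pa loc b; have cR : connected [set: R].
  by apply/connected_intervalP => x y _ _ z _.
have : [set b | P b] = [set: R].
  have oP : open [set b | P b].
    rewrite openE => c Pc; have [J Jc hJ] := loc c; have Jcc := nbhs_singleton Jc.
    by apply: filterS Jc => d Jd; exact: hJ Pc.
  have cP : closed [set b | P b].
    rewrite -openC openE => c nPc; have [J Jc hJ] := loc c; have Jcc := nbhs_singleton Jc.
    apply: filterS Jc => d Jd Pd; apply: nPc; exact: hJ Pd.
  apply: cR; first by exists a.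
  - by exists [set b | P b]; rewrite ?setTI.
  - by exists [set b | P b]; rewrite ?setTI.
by move=> /seteqP[_ /(_ b I)].
Qed.

Definition clamp (a b t : R) : R := Num.max a (Num.min t b).

Lemma clamp_continuous a b : continuous (clamp a b).
Proof.
move=> t; apply: (@continuous_max R R (cst a) (fun t => Num.min t b)).
  exact: cst_continuous.
by apply: (@continuous_min R R id (cst b)); [exact: cvg_id|exact: cst_continuous].
Qed.

Lemma clamp_in a b t : a <= b -> a <= clamp a b t <= b.
Proof. by move=> ab; rewrite /clamp le_max lexx /= ge_max ab ge_min lexx orbT. Qed.

Lemma clamp_id a b t : a <= t <= b -> clamp a b t = t.
Proof. by move=> /andP[at_ tb]; rewrite /clamp (min_l tb) (max_r at_). Qed.

Lemma glue_continuous (Y : topologicalType) (f g : R -> Y) a :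
  continuous f -> continuous g -> f a = g a ->
  continuous (fun s => if s <= a then f s else g s).
Proof.
move=> cf cg fg; rewrite continuous_subspace_setT.
have -> : [set: R] = [set s | s <= a] `|` [set s | a <= s].
  by apply/esym/seteqP; split=> // s _; apply/orP; exact: le_total.
apply: withinU_continuous; [exact: closed_le|exact: closed_ge| |].
  apply: (@subspace_eq_continuous _ _ _ f); last exact: continuous_subspaceT.
  by move=> s /set_mem /= sa; rewrite /from_subspace /= sa.
apply: (@subspace_eq_continuous _ _ _ g); last exact: continuous_subspaceT.
move=> s /set_mem /= as_; rewrite /from_subspace /=; case: ifP => // sa.
by have -> : s = a by apply/eqP; rewrite eq_le sa.
Qed.

Lemma within_comp_continuous (S T U : topologicalType) (A : set T) (f : T -> U)
    (c : S -> T) : {within A, continuous f} -> continuous c ->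
  (forall x, A (c x)) -> continuous (f \o c).
Proof.
move=> /subspace_continuousP cf cc Ac x W /(cf _ (Ac x)) h.
have {}h : nbhs (c x) [set y | A y -> W (f y)] := h.
suff: nbhs x (fun z => W (f (c z))) by [].
have h2 : nbhs x (c @^-1` [set y | A y -> W (f y)]) := cc x _ h.
by apply: filterS h2 => z hz; exact: hz (Ac z).
Qed.

Context (Y X : topologicalType) (p : Y -> X).

(** A sheet S over U, with the continuous section sigma of p that it carries. *)
Definition chart (U : set X) (S : set Y) (sigma : X -> Y) : Prop :=
  [/\ open S, forall z, S z -> U (p z) /\ sigma (p z) = z,
      forall x, U x -> S (sigma x) /\ p (sigma x) = x &
      forall x, U x -> {for x, continuous sigma}].

Hypothesis pcov : covering_map p.

Let pc : continuous p. Proof. by case: pcov. Qed.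

Lemma covering_charts x : exists U (F : set (set Y)),
  [/\ open U, U x, trivIset F id, forall y, U (p y) -> exists2 S, F S & S y &
      forall S, F S -> exists sigma, chart U S sigma].
Proof.
have [_ _ /(_ x) [U [oU Ux [F [pF tF hF]]]]] := pcov.
exists U, F; split=> //.
  by move=> y Uy; have : (p @^-1` U) y by []; rewrite pF => -[S FS Sy]; exists S.
move=> S FS; have [oS iS pS opS] := hF S FS.
have Sy z : S z -> U (p z) by move=> Sz; rewrite -pS; exists z.
have hs x' : U x' -> exists z, S z /\ p z = x'.
  by rewrite -pS => -[z Sz <-]; exists z.
have [[y0 _]|nY] := pselect (exists y : Y, True); last first.
  exfalso; have : U x by []. by rewrite -pS => -[z _ _]; apply: nY; exists z.
pose sigma x' := if pselect (exists z, S z /\ p z = x') is left e then projT1 (cid e) else y0.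
have sP x' : U x' -> S (sigma x') /\ p (sigma x') = x'.
  by move=> /hs e; rewrite /sigma; case: pselect => // e'; case: cid.
exists sigma; split=> // [z Sz|x' Ux' W].
  have Uz := Sy _ Sz; split=> //; have [Ss ps] := sP _ Uz.
  by apply: iS => //; exact: mem_set.
have [Ss ps] := sP _ Ux'.
rewrite nbhsE /= => -[W' [oW' W's] W'W].
have nV : nbhs x' (p @` (W' `&` S)).
  apply: open_nbhs_nbhs; split; last by exists (sigma x').
  by apply: opS; [exact: openI|exact: subIsetr].
suff: nbhs x' (fun v => W (sigma v)) by [].
apply: filterS nV => v [z [W'z Sz] <-]; apply: W'W.
have [_ e] := sP _ (Sy _ Sz).
suff -> : sigma (p z) = z by [].
by apply: iS => //; apply: mem_set => //; exact: (sP _ (Sy _ Sz)).1.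
Qed.

(** Near b, u and v stay in the sheets of u b and v b over the same U; at a point
    where they agree these sheets meet, hence are equal, and then u and v agree
    all along. *)
Lemma unique_lifting (u v : R -> Y) a : continuous u -> continuous v ->
  (forall t, p (u t) = p (v t)) -> u a = v a -> forall t, u t = v t.
Proof.
move=> cu cv puv uva; apply: (real_line_induction uva) => b.
have [U [F [oU Ux tF covF chF]]] := covering_charts (p (u b)).
have [S FS Sub] := covF _ Ux.
have [S' FS' Svb] : exists2 S', F S' & S' (v b) by apply: covF; rewrite -puv.
have [sg [oS hS _ _]] := chF S FS; have [sg' [oS' hS' _ _]] := chF S' FS'.
exists (u @^-1` S `&` v @^-1` S').
  apply: filterI; [apply: cu|apply: cv]; exact: open_nbhs_nbhs.
move=> b' b'' [/= Su Sv] [/= Su' Sv'] uv.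
have SS' : S = S' by apply: (tF S S' FS FS'); exists (u b'); split; rewrite // uv.
by rewrite -(hS _ Su').2 puv; apply: (hS _ _).2; rewrite SS'.
Qed.

(** Lifts are extended past b' inside a sheet; u is constant on the negative
    half-line so that the induction over the real line can start at 0. *)
Lemma path_lifting (u : R -> X) (y : Y) : continuous u ->
  (forall s, s <= 0 -> u s = u 0) -> p y = u 0 -> forall b, exists w : R -> Y,
  [/\ continuous w, forall s, p (w s) = u (Num.min s b) & forall s, s <= 0 -> w s = y].
Proof.
move=> cu u0 py; apply: (@real_line_induction _ 0).
  exists (cst y); split=> // [|s]; first exact: cst_continuous.
  by rewrite u0 // ge_min lexx orbT.
move=> b; have [U [F [oU Ux tF covF chF]]] := covering_charts (u b).
have : nbhs b (u @^-1` U) by apply: cu; exact: open_nbhs_nbhs.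
move=> /nbhs_ballP [e e0 eU]; exists (ball b e); first exact: nbhsx_ballx.
move=> b' b'' Jb' Jb'' [w [cw pw w0]].
have [b''b'|b'b''] := leP b'' b'.
  exists (w \o (fun s => Num.min s b'')); split.
  - move=> s; apply: continuous_comp; last exact: cw.
    apply: (@continuous_min R R id (cst b'')); [exact: cvg_id|exact: cst_continuous].
  - by move=> s /=; rewrite pw -minA (min_l b''b').
  - by move=> s s0 /=; rewrite w0 // ge_min s0.
have Uwb' : U (p (w b')) by rewrite pw minxx; exact: eU.
have [S FS Sw] := covF _ Uwb'; have [sg [oS hS hU csg]] := chF S FS.
have JU s : U (u (clamp b' b'' s)).
  apply: eU; have /andP[h1 h2] := clamp_in s (ltW b'b'').
  move: Jb' Jb''; rewrite /ball /= !ltr_distl => /andP[k1 k2] /andP[k3 k4].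
  by apply/andP; split; lra.
exists (fun s => if s <= b' then w s else sg (u (clamp b' b'' s))); split.
- apply: glue_continuous => // [s|].
    have ccu : {for s, continuous (u \o clamp b' b'')}.
      by apply: continuous_comp; [exact: clamp_continuous|exact: cu].
    exact: (continuous_comp ccu (csg _ (JU s))).
  by rewrite /= clamp_id ?lexx ?ltW // -[in LHS](hS _ Sw).2 pw minxx.
- move=> s; case: leP => sb'; first by rewrite pw (min_l sb') (min_l (le_trans sb' (ltW b'b''))).
  rewrite (hU _ (JU s)).2 /clamp max_r // le_min (ltW sb') /=; exact: ltW.
- move=> s s0; case: leP => sb'; first exact: w0.
  have b'0 : b' <= 0 by exact: le_trans (ltW sb') s0.
  rewrite -(w0 b' b'0) -(hS _ Sw).2 pw minxx; congr sg.
  rewrite (u0 b') // u0 // /clamp ge_max b'0 ge_min s0.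
  by [].
Qed.

(** Lifting the paths G (s, _) from a common origin depends continuously on s:
    for each t continuity in s at s0 propagates from t to nearby values of t,
    inside a sheet. *)
Lemma lifting_family (G : R * R -> X) (y : Y) : continuous G ->
  (forall s t, t <= 0 -> G (s, t) = G (s, 0)) -> (forall s, p y = G (s, 0)) ->
  exists W : R -> R -> Y, [/\ forall s, continuous (W s),
    forall s t, p (W s t) = G (s, Num.min t 1), forall s, W s 0 = y &
    forall t, continuous (W^~ t)].
Proof.
move=> cG G0 py.
have lift s : exists w : R -> Y, [/\ continuous w,
    forall t, p (w t) = G (s, Num.min t 1) & forall t, t <= 0 -> w t = y].
  apply: (@path_lifting (fun t => G (s, t))); [|exact: G0|exact: py].
  move=> t; apply: (continuous_comp (f := fun t => (s, t)) (g := G)); last exact: cG.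
  by apply: pair_continuous; [exact: cvg_cst|exact: cvg_id].
pose W s := projT1 (cid (lift s)).
have cW s : continuous (W s) by rewrite /W; case: cid => w [].
have pW s t : p (W s t) = G (s, Num.min t 1) by rewrite /W; case: cid => w [].
have W0 s t : t <= 0 -> W s t = y by rewrite /W; case: cid => w /= [_ _ h] /h.
exists W; split=> // [s|t s0]; first exact: W0.
pose K (st : R * R) := G (st.1, Num.min st.2 1).
have cm : continuous (fun t : R => Num.min t 1).
  by move=> r; apply: (@continuous_min R R id (cst 1)); [exact: cvg_id|exact: cst_continuous].
have cK : continuous K.
  move=> st; apply: (continuous_comp (f := fun st : R * R => (st.1, Num.min st.2 1)) (g := G)); last exact: cG.
  apply: pair_continuous; first exact: cvg_fst.
  apply: (continuous_comp (f := snd) (g := fun t : R => Num.min t 1)); last exact: cm.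
  exact: cvg_snd.
move: t; apply: (@real_line_induction (fun t => {for s0, continuous (W^~ t)}) 0).
  have -> : W^~ 0 = cst y by apply/funext => s; exact: W0.
  exact: cst_continuous.
move=> b; have [U [F [oU Ux tF covF chF]]] := covering_charts (K (s0, b)).
have : nbhs (s0, b) (K @^-1` U) by apply: cK; exact: open_nbhs_nbhs.
case=> -[V J] /= [nV nJ] VJU; have /nbhs_ballP[e /= e0 eJ] := nJ.
exists (ball b e) => [|t1 t2 J1 J2 C1]; first exact: nbhsx_ballx.
have KU s r : V s -> ball b e r -> U (K (s, r)) by move=> Vs /eJ Jr; apply: VJU.
have Vs0 : V s0 by exact: nbhs_singleton.
have [S FS Sw] : exists2 S, F S & S (W s0 t1).
  by apply: covF; rewrite pW; apply: (KU s0).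
have [sg [oS hS hU csg]] := chF S FS.
apply: (@near_eq_continuous _ _ _ (fun s => sg (K (s, t2)))); last first.
  have ccK : {for s0, continuous (fun s => K (s, t2))}.
    apply: (continuous_comp (f := fun s => (s, t2)) (g := K)); last exact: cK.
    by apply: pair_continuous; [exact: cvg_id|exact: cvg_cst].
  exact: (continuous_comp ccK (csg _ (KU _ _ Vs0 J2))).
have nS : nbhs s0 [set s | S (W s t1)] by apply: C1; exact: open_nbhs_nbhs.
apply: filterS2 nV nS => s Vs Ss.
pose c := clamp (Num.min t1 t2) (Num.max t1 t2).
have c1 : c t1 = t1 by rewrite /c clamp_id // ge_min lexx le_max lexx.
have c2 : c t2 = t2 by rewrite /c clamp_id // ge_min le_max lexx !orbT.
have Jc r : ball b e (c r).
  have /andP[] : Num.min t1 t2 <= c r <= Num.max t1 t2.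
    by apply: clamp_in; rewrite le_max ge_min lexx.
  move: J1 J2; rewrite /ball /= !ltr_distl => /andP[k1 k2] /andP[k3 k4].
  move=> h1 h2; rewrite ge_min in h1; rewrite le_max in h2.
  by case/orP: h1 => h1; case/orP: h2 => h2; apply/andP; split; lra.
have := @unique_lifting (W s \o c) (fun r => sg (K (s, c r))) t1.
rewrite /= c1 => /(_ _ _ _ _ t2); rewrite c2; apply.
- by move=> r; apply: continuous_comp; [exact: clamp_continuous|exact: cW].
- move=> r; have cKr : {for r, continuous (fun r => K (s, c r))}.
    apply: (continuous_comp (f := fun r => (s, c r)) (g := K)); last exact: cK.
    by apply: pair_continuous; [exact: cvg_cst|exact: clamp_continuous].
  exact: (continuous_comp cKr (csg _ (KU _ _ Vs (Jc r)))).
- by move=> r; rewrite pW (hU _ (KU _ _ Vs (Jc r))).2.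
- by have -> : K (s, t1) = p (W s t1); [rewrite pW|rewrite (hS _ Ss).2].
Qed.

Hypothesis Ysc : simply_connected R Y.

(** A null-homotopy of l, pushed down to X, is lifted from y. The three sides
    where it is constant lift to the constant y, so that the fourth side lifts
    to a loop. *)
Lemma loop_lifting (l : R -> Y) (y : Y) : continuous l -> l 0 = l 1 ->
  p y = p (l 0) -> exists w : R -> Y, [/\ continuous w, w 0 = y, w 1 = y &
    forall t, 0 <= t <= 1 -> p (w t) = p (l t)].
Proof.
move=> cl l01 py; have [_ _ /(_ (l 0) l)] := Ysc.
case=> [|F [cF F0 F1 Fe]]; first by split=> //; exact: continuous_subspaceT.
pose c := @clamp 0 1; have cc : continuous c := @clamp_continuous 0 1.
have c01 t : 0 <= c t <= 1 by apply: clamp_in.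
have cid t : 0 <= t <= 1 -> c t = t by exact: clamp_id.
pose G (st : R * R) := p (F (c st.1, c st.2)).
have cG : continuous G.
  move=> st; apply: (continuous_comp (f := F \o (fun st : R * R => (c st.1, c st.2)))); last exact: pc.
  apply: (@within_comp_continuous (R * R)%type (R * R)%type _ _ _ _ cF) => [x|x];
    last by split; rewrite /= in_itv /=; exact: c01.
  apply: (@pair_continuous (R * R)%type R R).
    by apply: (continuous_comp (f := fst) (g := c)); [exact: cvg_fst|exact: cc].
  by apply: (continuous_comp (f := snd) (g := c)); [exact: cvg_snd|exact: cc].
have c0 t : t <= 0 -> c t = 0 by move=> t0; rewrite /c /clamp max_l // ge_min t0.
have c1 : c 1 = 1 by apply: cid; rewrite ler01 lexx.
have [||W [cW pW W0 cWt]] := @lifting_family G y cG.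
- by move=> s t t0; rewrite /G /= (c0 _ t0) (c0 0).
- by move=> s; rewrite /G /= (c0 0) // (Fe _ (c01 s)).1.
have W1 t : W 1 t = y.
  apply: (@unique_lifting (W 1) (cst y) 0) => // [|{}t]; first exact: cst_continuous.
  by rewrite pW /G /= c1 F1.
have Ws s : W s 1 = y.
  apply: (@unique_lifting (W^~ 1) (cst y) 1) => // [|{}s]; first exact: cst_continuous.
  by rewrite pW /G /= minxx c1 (Fe _ (c01 s)).2.
exists (W 0); split=> // t t01; have /andP[_ t1] := t01.
by rewrite pW /G /= (min_l t1) (cid _ t01) (c0 0) // F0.
Qed.

(** The relation between the ends of a path from y0 and of the path from y1 with
    the same image in X. It is the graph of the deck transformation that takes
    y0 to y1. *)
Definition transports y0 y1 z w : Prop := exists g om : R -> Y,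
  [/\ continuous g, continuous om & forall t, p (om t) = p (g t)] /\
  [/\ g 0 = y0, g 1 = z, om 0 = y1 & om 1 = w].

Lemma transports_ex y0 y1 z : p y0 = p y1 -> exists w, transports y0 y1 z w.
Proof.
move=> py; have [_ /(_ y0 z) [g0 [cg0 g00 g01]] _] := Ysc.
pose c := @clamp 0 1; have cc : continuous c := @clamp_continuous 0 1.
pose g := g0 \o c.
have cg : continuous g.
  apply: (within_comp_continuous cg0 cc) => t /=; rewrite in_itv /=.
  exact: clamp_in.
have c0 t : t <= 0 -> c t = 0 by move=> t0; rewrite /c /clamp max_l // ge_min t0.
have [|||w [cw pw w0]] := @path_lifting (p \o g) y1 _ _ _ 1.
- by move=> t; apply: continuous_comp; [exact: cg|exact: pc].
- by move=> s s0; rewrite /= /g /= (c0 _ s0) (c0 0).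
- by rewrite -py /g /= (c0 0) // g00.
exists (w 1), g, w; split; split=> //; last 3 first.
- by rewrite /g /= (c0 0).
- by rewrite /g /= /c clamp_id ?ler01 ?lexx.
- exact: w0.
move=> t; rewrite pw /= /g /=; congr (p (g0 _)); rewrite /c /clamp.
by rewrite -minA minxx.
Qed.

Definition concat (g g' : R -> Y) (t : R) : Y :=
  if t <= 2^-1 then g (2 * t) else g' (2 * t - 1).

Lemma concat_continuous (g g' : R -> Y) : continuous g -> continuous g' -> g 1 = g' 0 ->
  continuous (concat g g').
Proof.
move=> cg cg' gg'; apply: glue_continuous.
- move=> t; apply: (continuous_comp (f := (fun t => 2 * t) : R -> R) (g := g)); last exact: cg.
  exact: mulrl_continuous.
- move=> t; apply: (continuous_comp (f := (fun t => 2 * t - 1) : R -> R) (g := g')); last exact: cg'.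
  by apply: cvgB; [exact: mulrl_continuous|exact: cvg_cst].
- by rewrite mulfV // subrr.
Qed.

(** Two paths from y0 to z differ by a loop, whose image in X lifts from y1 to a
    loop. *)
Lemma transports_fun y0 y1 z w w' :
  transports y0 y1 z w -> transports y0 y1 z w' -> w = w'.
Proof.
move=> [g [om [[cg com pom] [g0 g1 om0 om1]]]] [g' [om' [[cg' com' pom'] [g0' g1' om0' om1']]]].
pose l := concat g (fun t => g' (1 - t)).
have cl : continuous l.
  apply: concat_continuous => // [t|]; last by rewrite subr0 g1 g1'.
  apply: (continuous_comp (f := (fun t => 1 - t) : R -> R) (g := g')); last exact: cg'.
  by apply: cvgB; [exact: cvg_cst|exact: cvg_id].
have l0 : l 0 = y0 by rewrite /l /concat invr_ge0 ler0n mulr0.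
have h12 : (1 <= 2^-1 :> R) = false by apply/negbTE; rewrite -ltNge invf_lt1 ?ltr1n.
have l1 : l 1 = y0.
  by rewrite /l /concat h12 mulr1 (_ : 1 - (2 - 1) = 0 :> R) //; ring.
have [||W [cW W0 W1 pW]] := loop_lifting (l := l) (y := y1) cl.
- by rewrite l0 l1.
- by rewrite l0 -g0 -om0 pom.
pose c := @clamp 0 1; have cc : continuous c := @clamp_continuous 0 1.
have c01 t : 0 <= c t <= 1 by apply: clamp_in.
have c0 : c 0 = 0 by apply: clamp_id; rewrite lexx ler01.
have c1 : c 1 = 1 by apply: clamp_id; rewrite lexx ler01.
have chalf : continuous ((fun t => c t / 2) : R -> R).
  move=> t; apply: (continuous_comp (f := c) (g := (fun t => t / 2) : R -> R)); first exact: cc.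
  exact: mulrr_continuous.
have e1 : W (1 / 2) = w.
  have := @unique_lifting (fun t => W (c t / 2)) (om \o c) 0.
  move=> /(_ _ _ _ _ 1); rewrite /= c1 om1; apply.
  - by move=> t; apply: (continuous_comp (f := (fun t => c t / 2) : R -> R) (g := W)); [exact: chalf|exact: cW].
  - by move=> t; apply: continuous_comp; [exact: cc|exact: com].
  - move=> t; have /andP[h0 h1] := c01 t; rewrite pW; last by apply/andP; split; lra.
    rewrite pom /l /concat; have -> : c t / 2 <= 2^-1 by lra.
    by congr (p (g _)); field.
  - by rewrite c0 mul0r W0 om0.
have e2 : W (1 / 2) = w'.
  have := @unique_lifting (fun t => W (1 - c t / 2)) (om' \o c) 0.
  move=> /(_ _ _ _ _ 1); rewrite /= c1 om1' (_ : 1 - 1 / 2 = 1 / 2 :> R); last by field.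
  apply.
  - move=> t; apply: (continuous_comp (f := (fun t => 1 - c t / 2) : R -> R) (g := W)); last exact: cW.
    by apply: cvgB; [exact: cvg_cst|exact: chalf].
  - by move=> t; apply: continuous_comp; [exact: cc|exact: com'].
  - move=> t; have /andP[h0 h1] := c01 t; rewrite pW; last by apply/andP; split; lra.
    rewrite pom' /l /concat; case: ifP => [h|_]; last by congr (p (g' _)); field.
    have -> : c t = 1 by lra.
    by rewrite g1' -g1; congr (p (g _)); field.
  - by rewrite c0 mul0r subr0 W1 om0'.
by rewrite -e1 e2.
Qed.

End CoveringSpaces.

(** * Deck transformations of a universal cover *)

Section LocallyPathConnected.
Context (R : realType).

(** Paths are maps on the whole real line; constant extension makes this
    equivalent to the use of [0, 1], and spares the restrictions. *)
Definition locally_path_connected (T : topologicalType) : Prop :=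
  forall (x : T) N, nbhs x N -> exists2 V, nbhs x V & forall x', V x' ->
    exists d : R -> T, [/\ continuous d, d 0 = x, d 1 = x' & forall t, N (d t)].

Lemma homeomorphism_locally_path_connected (S T : topologicalType) (h : S -> T) :
  homeomorphism h -> locally_path_connected T -> locally_path_connected S.
Proof.
move=> [ch [k [ck hk kh]]] lT x N nN.
have nkN : nbhs (h x) (k @^-1` N) by apply: ck; rewrite hk.
have [V nV hV] := lT _ _ nkN; exists (h @^-1` V); first exact: ch.
move=> x' /hV [d [cd d0 d1 Nd]]; exists (k \o d); split=> //=.
- by move=> t; apply: continuous_comp; [exact: cd|exact: ck].
- by rewrite d0 hk.
- by rewrite d1 hk.
Qed.

Lemma covering_locally_path_connected (Y X : topologicalType) (p : Y -> X) :
  covering_map p -> locally_path_connected X -> locally_path_connected Y.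
Proof.
move=> cov lX y N nN; have [pc _ _] := cov.
have [U [F [oU Ux tF covF chF]]] := covering_charts cov (p y).
have [S FS Sy] := covF _ Ux; have [sg [oS hS hU csg]] := chF S FS.
have nUN : nbhs (p y) (U `&` sg @^-1` N).
  apply: filterI; first exact: open_nbhs_nbhs.
  by apply: csg => //; rewrite (hS _ Sy).2.
have [V nV hV] := lX _ _ nUN; exists (p @^-1` V `&` S).
  by apply: filterI; [exact: pc|exact: open_nbhs_nbhs].
move=> y' [/= Vy' Sy']; have [d [cd d0 d1 Nd]] := hV _ Vy'.
exists (sg \o d); split=> /=.
- by move=> t; apply: (continuous_comp (cd t)); apply: csg; case: (Nd t).
- by rewrite d0 (hS _ Sy).2.
- by rewrite d1 (hS _ Sy').2.
- by move=> t; case: (Nd t).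
Qed.

(** Points at distance less than the least positive coordinate of x have at least
    the support of x, so that the segments joining them to x stay in the same
    simplex. *)
Lemma realization_locally_path_connected n (K : {set {set 'I_n}}) :
  locally_path_connected (set_type (@realization R n K)).
Proof.
move=> x N [A [[B oB <-] /= Bx] BN].
pose xv : 'rV[R]_n := set_val x.
have [x0 x1 xK] : realization K xv by exact: set_valP.
have /nbhs_ballP[e /= e0 eB] : nbhs xv B by apply: open_nbhs_nbhs.
pose m : R := \big[Num.min/1]_(i < n | xv 0 i != 0) xv 0 i.
have m0 : 0 < m.
  by apply/bigmin_gtP; split=> // i xi; rewrite lt_def xi x0.
have mx i : xv 0 i != 0 -> m <= xv 0 i by move=> xi; exact: bigmin_le_cond.
pose e' := Num.min e m.
have e'0 : 0 < e' by rewrite lt_min e0.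
exists (set_val @^-1` ball xv e').
  apply: (@initial_continuous _ _ (set_val : set_type (realization K) -> _)).
  exact: nbhsx_ballx.
move=> z /=; pose zv : 'rV[R]_n := set_val z; rewrite -/zv.
have [z0 z1 zK] : realization K zv by exact: set_valP.
move=> [_ xz].
have supp i : zv 0 i = 0 -> xv 0 i = 0.
  move=> zi; apply/eqP/negPn/negP => xi.
  have := xz 0 i; rewrite /ball /= zi subr0 ger0_norm // lt_min => /andP[_].
  by rewrite ltNge mx.
pose c := @clamp R 0 1; have c01 t : 0 <= c t <= 1 by apply: clamp_in.
have c0 : c 0 = 0 by apply: clamp_id; rewrite lexx ler01.
have c1 : c 1 = 1 by apply: clamp_id; rewrite lexx ler01.
pose dv t : 'rV[R]_n := xv + c t *: (zv - xv).
have dvE t i : dv t 0 i = (1 - c t) * xv 0 i + c t * zv 0 i.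
  by rewrite !mxE; ring.
have cdv : continuous dv.
  move=> t; apply: cvgD; first exact: cvg_cst.
  by apply: cvgZr_tmp; exact: clamp_continuous.
have dK t : realization K (dv t).
  have /andP[h0 h1] := c01 t; have h1' : 0 <= 1 - c t by rewrite subr_ge0.
  split.
  - by move=> i; rewrite dvE addr_ge0 // mulr_ge0.
  - under eq_bigr do rewrite dvE.
    by rewrite big_split /= -!mulr_sumr x1 z1 !mulr1 subrK.
  - have [ct0|ct0] := eqVneq (c t) 0.
      rewrite (_ : dv t = xv) //; apply/rowP => i.
      by rewrite dvE ct0 subr0 mul1r mul0r addr0.
    rewrite (_ : finset _ = finset (fun i => zv 0 i != 0)) //.
    apply/finset.setP => i; rewrite !finset.inE dvE; congr (~~ _).
    apply/eqP/eqP => [|zi]; last by rewrite zi (supp _ zi) !mulr0 addr0.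
    move/eqP; rewrite paddr_eq0 ?mulr_ge0 // => /andP[_].
    by rewrite mulf_eq0 (negbTE ct0) /= => /eqP.
pose d t : set_type (realization K) := exist _ (dv t) (mem_set (dK t)).
have svd t : set_val (d t) = dv t by [].
exists d; split.
- by apply: continuous_comp_initial; exact: cdv.
- by apply: val_inj => /=; rewrite /dv c0 scale0r addr0.
- by apply: val_inj => /=; rewrite /dv c1 scale1r addrC subrK.
- move=> t; apply: BN => /=; apply: eB; split=> // i j; rewrite svd (ord1 i).
  have /andP[h0 h1] := c01 t.
  have := xz 0 j; rewrite /ball /= dvE lt_min => /andP[h _].
  rewrite (_ : _ - _ = c t * (xv 0 j - zv 0 j)); last by ring.
  rewrite normrM (ger0_norm h0); apply: le_lt_trans h.
  by rewrite ler_piMl.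
Qed.

Lemma polyhedron_locally_path_connected (X : topologicalType) :
  compact_polyhedron R X -> locally_path_connected X.
Proof.
move=> [n [K [_ [h hh]]]]; apply: homeomorphism_locally_path_connected hh _.
exact: realization_locally_path_connected.
Qed.

End LocallyPathConnected.

Section DeckTransformations.
Context (R : realType) (Y X : topologicalType) (p : Y -> X).
Hypotheses (cov : covering_map p) (Ysc : simply_connected R Y)
  (lY : locally_path_connected R Y).

Let pc : continuous p. Proof. by case: cov. Qed.

Let transports_at y0 y1 : p y0 = p y1 -> transports R p y0 y1 y0 y1.
Proof.
move=> py; exists (cst y0), (cst y1); split; split=> //; exact: cst_continuous.
Qed.

Let transport_map y0 y1 (py : p y0 = p y1) z : Y :=
  projT1 (cid (transports_ex cov Ysc z py)).

Let transport_mapP y0 y1 (py : p y0 = p y1) z :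
  transports R p y0 y1 z (transport_map py z).
Proof. by rewrite /transport_map; case: cid. Qed.

Let transport_map_over y0 y1 (py : p y0 = p y1) z : p (transport_map py z) = p z.
Proof. by have [g [om [[_ _ pom] [_ <- _ <-]]]] := transport_mapP py z. Qed.

(** Near z the transport map is sg' o p, where sg' is the section onto the sheet
    of the image of z: a path from z inside a sheet is transported by sg'. *)
Let transport_map_continuous y0 y1 (py : p y0 = p y1) : continuous (transport_map py).
Proof.
move=> z; set c := transport_map py.
have [U [F [oU Ux tF covF chF]]] := covering_charts cov (p z).
have [S FS Sz] := covF _ Ux; have [sg [oS hS _ _]] := chF S FS.
have [S' FS' Sc] : exists2 S, F S & S (c z) by apply: covF; rewrite /c transport_map_over.
have [sg' [oS' hS' hU' csg']] := chF S' FS'.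
have [V nV hV] := lY (open_nbhs_nbhs (conj oS Sz)).
apply: (@near_eq_continuous _ _ _ (sg' \o p)); last first.
  by apply: continuous_comp; [exact: pc|exact: csg'].
apply: filterS nV => z' /hV [d [cd d0 d1 Sd]].
have [g [om [[cg com pom] [g0 g1 om0 om1]]]] := transport_mapP py z.
rewrite -/c in om1.
have Ud t : U (p (d t)) by exact: (hS _ (Sd t)).1.
have cd' : continuous (sg' \o p \o d).
  move=> t; have cpd : {for t, continuous (p \o d)}.
    by apply: continuous_comp; [exact: cd|exact: pc].
  exact: (continuous_comp cpd (csg' _ (Ud t))).
apply: (transports_fun cov Ysc (transport_mapP py z')).
exists (concat g d), (concat om (sg' \o p \o d)).
have e1 : om 1 = (sg' \o p \o d) 0.
  rewrite /= d0 om1; have <- : p (c z) = p z by exact: transport_map_over.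
  by rewrite (hS' _ Sc).2.
have h0 : (0 <= 2^-1 :> R) by rewrite invr_ge0 ler0n.
have h1 : (1 <= 2^-1 :> R) = false by apply/negbTE; rewrite -ltNge invf_lt1 ?ltr1n.
have h2 : (2 * 1 - 1 = 1 :> R) by ring.
split; split.
- by apply: concat_continuous => //; rewrite g1 d0.
- exact: concat_continuous.
- by move=> t; rewrite /concat; case: ifP => _ //=; rewrite (hU' _ (Ud _)).2.
- by rewrite /concat h0 mulr0.
- by rewrite /concat h1 h2.
- by rewrite /concat h0 mulr0.
- by rewrite /concat h1 h2 /= d1.
Qed.

Let transport_map_base y0 y1 (py : p y0 = p y1) : transport_map py y0 = y1.
Proof. exact: (transports_fun cov Ysc (transport_mapP py y0) (transports_at py)). Qed.

Lemma unique_lifting_sc (T : topologicalType) (u v : Y -> T) (q : T -> X) y0 :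
  covering_map q -> continuous u -> continuous v ->
  (forall y, q (u y) = q (v y)) -> u y0 = v y0 -> u = v.
Proof.
move=> covq cu cv quv uv0; apply/funext => y.
have [_ /(_ y0 y) [g0 [cg0 g00 g01]] _] := Ysc.
have cg : continuous (g0 \o clamp 0 1).
  apply: (within_comp_continuous cg0 (@clamp_continuous R 0 1)) => t /=.
  by rewrite in_itv /=; exact: clamp_in.
have := @unique_lifting R _ _ _ covq (u \o (g0 \o clamp 0 1)) (v \o (g0 \o clamp 0 1)) 0.
move=> /(_ _ _ _ _ 1); rewrite /= !clamp_id ?lexx ?ler01 // g00 g01; apply=> //.
- by move=> t; apply: continuous_comp; [exact: cg|exact: cu].
- by move=> t; apply: continuous_comp; [exact: cg|exact: cv].
Qed.

(** The transport maps from y0 to y1 and from y1 to y0 are inverse to each other,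
    by uniqueness of liftings. *)
Lemma deck_transitive y0 y1 : p y0 = p y1 -> exists c : deck p, c y0 = y1.
Proof.
move=> py; pose c := transport_map py; pose c' := transport_map (esym py).
have cc : continuous c by exact: transport_map_continuous.
have cc' : continuous c' by exact: transport_map_continuous.
have pcE y : p (c y) = p y by exact: transport_map_over.
have pc'E y : p (c' y) = p y by exact: transport_map_over.
have c0 : c y0 = y1 by exact: transport_map_base.
have c1 : c' y1 = y0 by exact: transport_map_base.
have cK : c' \o c = id.
  apply: (@unique_lifting_sc _ _ _ p y0) => //.
  - by move=> y; apply: continuous_comp; [exact: cc|exact: cc'].
  - by move=> y; exact: cvg_id.
  - by move=> y /=; rewrite pc'E pcE.
  - by rewrite /= c0 c1.
have cK' : c \o c' = id.
  apply: (@unique_lifting_sc _ _ _ p y1) => //.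
  - by move=> y; apply: continuous_comp; [exact: cc'|exact: cc].
  - by move=> y; exact: cvg_id.
  - by move=> y /=; rewrite pcE pc'E.
  - by rewrite /= c1 c0.
have hc : homeomorphism c.
  split=> //; exists c'; split=> // y.
    exact: (congr1 (fun f => f y) cK).
  exact: (congr1 (fun f => f y) cK').
have pcc : p \o c = p by apply/funext.
by exists (Deck hc pcc).
Qed.

Lemma deck_continuous (c : deck p) : continuous c.
Proof. by case: (deck_homeo c). Qed.

Lemma deckE (c : deck p) y : p (c y) = p y.
Proof. exact: (congr1 (fun f => f y) (deck_over c)). Qed.

Lemma deck_eq (c c' : deck p) y : c y = c' y -> c = c'.
Proof.
move=> cy; apply: deckP => z.
have e : (c : Y -> Y) = c'.
  apply: (@unique_lifting_sc _ _ _ p y) => //.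
  - exact: deck_continuous.
  - exact: deck_continuous.
  - by move=> w; rewrite !deckE.
by rewrite e.
Qed.

Lemma lifting_deck (h : X -> X) (g g' : Y -> Y) : lifting p h g -> lifting p h g' ->
  exists c : deck p, g' = c \o g.
Proof.
move=> [cg pg] [cg' pg']; have [[y0 _] _ _] := Ysc.
have pgg' y : p (g y) = p (g' y).
  by have := congr1 (fun f => f y) pg; have := congr1 (fun f => f y) pg' => /= -> ->.
have [c c0] := deck_transitive (pgg' y0); exists c.
apply: (unique_lifting_sc cov (y0 := y0)) => //.
- by move=> y; apply: continuous_comp; [exact: cg|exact: deck_continuous].
- by move=> y /=; rewrite deckE.
Qed.

End DeckTransformations.

(** * Lifting classes and twisted conjugacy classes *)

Section EventuallyInvariantSubgroup.
Context (G : groupType) (H : set G) (sH : subgroup H).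
Local Notation K := (subgroup_type sH).

(** phi x = z * x * (phi z)^-1 for z = x^-1. *)
Lemma twisted_conjugate_iterate (L : groupType) (phi : L -> L) m x :
  morphic phi -> twisted_conjugate phi x (iter m phi x).
Proof.
move=> phiM; elim: m => [|m IH]; first exact: twisted_conjugate_refl.
apply: twisted_conjugate_trans IH _ => //; exists (iter m phi x)^-1%g.
by rewrite iterS (morphicV _ phiM) invgK mulVg mul1g.
Qed.

Lemma iter_subgroup_val (phi : G -> G) (psi : K -> K) m a :
  (forall a, subgroup_val (psi a) = phi (subgroup_val a)) ->
  subgroup_val (iter m psi a) = iter m phi (subgroup_val a).
Proof. by move=> e; elim: m => [//|m IH]; rewrite !iterS e IH. Qed.

(** The subgroup H meets every twisted class, since x is twisted conjugate to all
    its iterates. If z conjugates a to b in G, then some iterate of z lies in H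
    and conjugates the same iterates of a and b, which are twisted conjugate to a
    and b inside H. *)
Lemma twisted_transversal_restrict (phi : G -> G) (psi : K -> K) (s : seq G) :
  morphic phi -> (forall a, subgroup_val (psi a) = phi (subgroup_val a)) ->
  (forall x, exists m, H (iter m phi x)) ->
  twisted_transversal phi s ->
  exists2 t, twisted_transversal psi t & size t = size s.
Proof.
move=> phiM e phiH [us sinj scov].
have psiM : morphic psi.
  by move=> a b; apply: subgroup_val_inj; rewrite !(e, subgroup_valM) phiM.
have down a b : twisted_conjugate psi a b ->
    twisted_conjugate phi (subgroup_val a) (subgroup_val b).
  by move=> [z ->]; exists (subgroup_val z); rewrite !subgroup_valM subgroup_valV e.
have up a b : twisted_conjugate phi (subgroup_val a) (subgroup_val b) ->
    twisted_conjugate psi a b.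
  move=> [z bE]; have [m Hm] := phiH z.
  have iM := morphic_iter m phiM.
  apply: twisted_conjugate_trans (twisted_conjugate_iterate m a psiM) _ => //.
  apply: twisted_conjugate_trans (twisted_conjugate_sym psiM
    (twisted_conjugate_iterate m b psiM)) => //.
  exists (in_subgroup sH Hm); apply: subgroup_val_inj.
  rewrite !subgroup_valM subgroup_valV e subgroup_valK !(iter_subgroup_val _ _ e) bE.
  by rewrite !iM (morphicV _ iM) -iterSr iterS.
have [r rP] : exists r : G -> K, forall x, twisted_conjugate phi x (subgroup_val (r x)).
  have ex x : exists a : K, twisted_conjugate phi x (subgroup_val a).
    have [m Hm] := phiH x; exists (in_subgroup sH Hm); rewrite subgroup_valK.
    exact: twisted_conjugate_iterate.
  by exists (fun x => projT1 (cid (ex x))) => x; case: cid.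
have rinj x y : x \in s -> y \in s -> twisted_conjugate psi (r x) (r y) -> x = y.
  move=> xs ys /down xy; apply: sinj => //.
  apply: twisted_conjugate_trans (rP x) _ => //.
  apply: twisted_conjugate_trans xy _ => //.
  exact/twisted_conjugate_sym.
exists (map r s); last by rewrite size_map.
split.
- rewrite map_inj_in_uniq // => x y xs ys rxy; apply: rinj => //.
  by rewrite rxy; exact: twisted_conjugate_refl.
- move=> _ _ /mapP[x xs ->] /mapP[y ys ->] xy.
  by rewrite (rinj x y).
- move=> a; have [x xs xa] := scov (subgroup_val a).
  exists (r x); first exact: map_f.
  apply: up; apply: twisted_conjugate_trans xa => //.
  exact/twisted_conjugate_sym.
Qed.

End EventuallyInvariantSubgroup.

Section LiftingClasses.
Context (R : realType) (Y X : topologicalType) (p : Y -> X).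
Hypotheses (cov : covering_map p) (Ysc : simply_connected R Y)
  (lY : locally_path_connected R Y).

Lemma lifting_iter f g n : lifting p f g -> lifting p (iter n f) (iter n g).
Proof.
move=> [cg pg]; elim: n => [|n [cn pn]]; first by split=> // y; exact: cvg_id.
split; first by move=> y; apply: (continuous_comp (cn y)); exact: cg.
apply/funext => y /=; have := congr1 (fun h => h (iter n g y)) pg => /= ->.
by have := congr1 (fun h => h y) pn => /= ->.
Qed.

Lemma induced_endomorphism_iter (g : Y -> Y) (phi : deck p -> deck p) n :
  induced_endomorphism g phi -> induced_endomorphism (iter n g) (iter n phi).
Proof.
move=> gphi; elim: n => [//|n IH] c; apply/funext => y /=.
have := congr1 (fun h => h (iter n g y)) (gphi (iter n phi c)) => /= ->.
by have := congr1 (fun h => h y) (IH c) => /= ->.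
Qed.

Lemma lifting_class_refl (g : Y -> Y) : lifting_class p g g.
Proof.
by exists 1%g => //; rewrite invg1. Qed.

Lemma lifting_class_sym (g h : Y -> Y) : lifting_class p g h -> lifting_class p h g.
Proof.
move=> [c _ <-]; exists c^-1%g => //; rewrite invgK; apply/funext => y.
change ((c^-1 * c)%g (g ((c^-1 * c)%g y)) = g y).
by rewrite mulVg.
Qed.

Lemma lifting_class_trans (g h k : Y -> Y) :
  lifting_class p g h -> lifting_class p h k -> lifting_class p g k.
Proof.
move=> [c _ <-] [d _ <-]; by exists (d * c)%g => //; rewrite invgM.
Qed.

Lemma lifting_class_eq (g h : Y -> Y) :
  lifting_class p g h -> lifting_class p g = lifting_class p h.
Proof.
move=> gh; apply/seteqP; split=> k gk.
  exact: lifting_class_trans (lifting_class_sym gh) gk.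
exact: lifting_class_trans gh gk.
Qed.

(** Conjugation by z takes c o g to z c (phi z)^-1 o g, by definition of phi; deck
    transformations that agree at one point are equal. *)
Lemma lifting_class_twisted (g : Y -> Y) (phi : deck p -> deck p) (c d : deck p) :
  morphic phi -> induced_endomorphism g phi ->
  lifting_class p (c \o g) (d \o g) <-> twisted_conjugate phi c d.
Proof.
move=> phiM gphi.
have conj (z : deck p) : z \o (c \o g) \o (z^-1)%g = (z * c * (phi z)^-1)%g \o g.
  rewrite -(morphicV _ phiM); apply/funext => y /=.
  by have := congr1 (fun h => h y) (gphi (z^-1)%g) => /= ->.
split=> [[z _ zE]|[z ->]]; last by exists z.
exists z; have [[y _] _ _] := Ysc; apply: (deck_eq cov Ysc (y := g y)).
by have := congr1 (fun h => h y) zE; rewrite conj.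
Qed.

Lemma reidemeister_transversal f g (phi : deck p -> deck p) :
  morphic phi -> lifting p f g -> induced_endomorphism g phi ->
  finite_set (lifting_classes p f) ->
  exists2 s, twisted_transversal phi s & size s = reidemeister_number p f.
Proof.
move=> phiM fg gphi fin; pose cls (c : deck p) := lifting_class p (c \o g).
have clsP c : lifting_classes p f (cls c).
  exists (c \o g) => //; case: fg => cg pg; split.
    by move=> y; apply: continuous_comp; [exact: cg|exact: deck_continuous].
  by rewrite compA deck_over.
have clsE c d : cls c = cls d <-> twisted_conjugate phi c d.
  rewrite -(lifting_class_twisted c d phiM gphi); split=> [cd|].
    by rewrite -/(cls c _) cd; exact: lifting_class_refl.
  exact: lifting_class_eq.
have [r rP] : exists r : set (Y -> Y) -> deck p,
    forall C, lifting_classes p f C -> cls (r C) = C.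
  have ex C : exists c, lifting_classes p f C -> cls c = C.
    have [[h fh <-]|nC] := pselect (lifting_classes p f C); last by exists 1%g.
    by have [c ->] := lifting_deck cov Ysc lY fg fh; exists c.
  by exists (fun C => projT1 (cid (ex C))) => C; case: cid.
pose F := fset_set (lifting_classes p f).
have inFE C : (C \in F) = (C \in lifting_classes p f) by exact: in_fset_set.
have inF C : C \in enum_fset F -> lifting_classes p f C.
  by move=> CF; apply: set_mem; rewrite -inFE.
exists (map r (enum_fset F)); last by rewrite size_map.
split.
- rewrite map_inj_in_uniq ?fset_uniq // => C D /inF fC /inF fD rCD.
  by rewrite -(rP C) // rCD rP.
- move=> _ _ /mapP[C /inF fC ->] /mapP[D /inF fD ->] /clsE.
  by rewrite !rP // => ->.
- move=> c; exists (r (cls c)); last by apply/clsE; exact: rP.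
  by apply: map_f; have : cls c \in F by rewrite inFE; exact/mem_set/clsP.
Qed.

End LiftingClasses.

Theorem theorem8p5 (R : realType) (X Xt : topologicalType) (p : Xt -> X)
    (f : X -> X) (ft : Xt -> Xt) (phi : {multiplicative deck p -> deck p})
    (H : set (deck p)) :
  compact_polyhedron R X ->
  connected [set: X] ->
  continuous f ->
  universal_cover R p ->
  (forall n, (0 < n)%N -> finite_set (lifting_classes p (iter n f))) ->
  lifting p f ft ->
  induced_endomorphism ft phi ->
  subgroup H ->
  (forall x, H x -> H (phi x)) ->
  (forall x, exists n, (0 < n)%N /\ H (iter n phi x)) ->
  finitely_generated H ->
  type_I R H ->
  forall n, (0 < n)%N ->
    (n%:Z %| \sum_(d <- divisors n)
               moebius d * (reidemeister_number p (iter (n %/ d) f))%:Z)%Z.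
Proof.
move=> polX _ _ [cov Ysc] fin fft ftphi sH Hphi phiH fgH tI n n0.
have lY := covering_locally_path_connected cov (polyhedron_locally_path_connected polX).
have phiM : morphic phi by move=> x y; exact: gmulfM.
pose psi a := in_subgroup sH (Hphi _ (subgroup_valP (a : subgroup_type sH))).
have psiE a : subgroup_val (psi a) = phi (subgroup_val a) by [].
have psiM : morphic psi.
  by move=> a b; apply: subgroup_val_inj; rewrite !(psiE, subgroup_valM) phiM.
have fgK := finitely_generated_subgroup_type sH fgH.
have [A [sA aA iA]] := virtually_abelian_of_fc fgK (type_I_fc_center sH tI).
apply: (twisted_gauss_congruence psiM fgK sA aA iA
  (r := fun d => reidemeister_number p (iter d f))) => // d d0.
have [s sP <-] := reidemeister_transversal cov Ysc lY (morphic_iter d phiM)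
  (lifting_iter d fft) (induced_endomorphism_iter d ftphi) (fin d d0).
apply: (twisted_transversal_restrict (morphic_iter d phiM) _ _ sP).
  by move=> a; exact: iter_subgroup_val.
have Hiter m x : H x -> H (iter m phi x).
  by move=> Hx; elim: m => [//|m IH]; rewrite iterS; apply: (Hphi).
move=> x; have [m [_ Hm]] := phiH x; exists m.
have -> : iter m (iter d phi) x = iter (m * d) phi x.
  by elim: (m) => [//|k IH]; rewrite iterS IH mulSn iterD.
by rewrite -(prednK d0) mulnS addnC iterD; exact: Hiter.
Qed.
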